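(* Cyclic Hantzsche-Wendt manifolds do not have a $\operatorname{Spin}^{\mathbb{C}}$-structure.
   Context: A flat manifold of dimension $n$ is a compact connected Riemannian manifold without boundary, of dimension $n$, with sectional curvature equal to zero. It is of the form $\mathbb{R}^n/\Gamma$, where $\Gamma=\pi_1(M^n)$ is a torsion-free discrete cocompact subgroup of $\operatorname{Isom}(\mathbb{R}^n)=\operatorname{O}(n)\ltimes\mathbb{R}^n$, with multiplication $(A,a)(B,b)=(AB,a+Ab)$; its holonomy group is isomorphic to the image of $\Gamma$ under $(A,a)\mapsto A$. A Hantzsche-Wendt manifold (HW-manifold) of dimension $n$ is any oriented flat manifold of dimension $n$ with holonomy group $(\mathbb{Z}_2)^{n-1}$; $n$ is then always odd. For $1\le i\le n$ let $B_i=\operatorname{diag}(-1,\dots,-1,1,-1,\dots,-1)\in\operatorname{SO}(n)$, with the entry $1$ in position $i$. The HW-manifold $M^n$ of dimension $n$ is cyclic if and only if $\pi_1(M^n)$ is generated by the elements $$\beta_i=(B_i,(0,\dots,0,\tfrac12,\tfrac12,0,\dots,0)),\quad 1\le i\le n-1,$$ where the entries $\tfrac12$ are in positions $i$ and $i+1$, and $$\beta_n=(\beta_1\beta_2\cdots\beta_{n-1})^{-1}=(B_n,(\tfrac12,0,\dots,0,\tfrac12)).$$ $\lambda_n:\operatorname{Spin}(n)\to\operatorname{SO}(n)$ is the universal covering, $\operatorname{Spin}^{\mathbb{C}}(n)=(\operatorname{Spin}(n)\times S^1)/\{1,-1\}$ (where $-1$ acts by $(g,z)\mapsto(-g,-z)$),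 and $\bar{\lambda}_n:\operatorname{Spin}^{\mathbb{C}}(n)\to\operatorname{SO}(n)$ is the homomorphism $\bar{\lambda}_n[g,z]=\lambda_n(g)$. A $\operatorname{Spin}^{\mathbb{C}}$-structure on a compact oriented $n$-dimensional manifold $W$ is a lift of the classifying map $\delta:W\to\operatorname{BSO}(n)$ of its tangent bundle through $B(\bar{\lambda}_n):\operatorname{BSpin}^{\mathbb{C}}(n)\to\operatorname{BSO}(n)$. Equivalently, the Stiefel-Whitney class $w_2(W)\in H^2(W,\mathbb{Z}_2)$ is the mod $2$ reduction of a class in $H^2(W,\mathbb{Z})$.
   Formalization: The dimension is assumed greater than 3: in dimension 3 the cyclic Hantzsche-Wendt manifold is a closed orientable 3-manifold, hence parallelizable, and does have a Spin^C-structure; dimension 1 (the circle) is likewise excluded. *)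

(* Defs.v *)
From HB Require Import structures.
From mathcomp Require Import all_boot all_order all_algebra.
From mathcomp Require Import complex.
From mathcomp Require Import all_classical all_reals all_analysis.
From mathcomp Require Import ring.

Set Implicit Arguments.
Unset Strict Implicit.
Unset Printing Implicit Defensive.

Import Order.TTheory GRing.Theory Num.Theory.
Import numFieldNormedType.Exports.

Local Open Scope classical_set_scope.
Local Open Scope ring_scope.

(* Carriers with a group structure and a topology; the compatibility of the
   two is not recorded, since no definition below depends on it. *)
#[short(type="topGroupType")]
HB.structure Definition TopGroup := {G of Group G & Topological G}.

Section Subgroups.
Variable G : groupType.

Definition is_subgroup (H : set G) : Prop :=
  [/\ H 1%g, forall g h, H g -> H h -> H (g * h)%g & forall g, H g -> H g^-1%g].

Record subgroup := Subgroup {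
  subgroup_set :> set G;
  subgroupP : is_subgroup subgroup_set }.

Definition generated (A : set G) : set G := smallest is_subgroup A.

Definition torsion_free (H : set G) : Prop :=
  forall g k, H g -> (0 < k)%N -> (g ^+ k)%g = 1%g -> g = 1%g.

End Subgroups.

(* Groups of invertible elements of a ring; the inverse is obtained by choice
   and is the inverse in the ring by uniqueness. *)
Section RingGroups.
Variable A : pzRingType.

Record ringGroup := RingGroup {
  ring_group_set : set A;
  ring_group1 : ring_group_set 1;
  ring_groupM : forall x y,
    ring_group_set x -> ring_group_set y -> ring_group_set (x * y);
  ring_groupV : forall x, ring_group_set x ->
    exists y, [/\ ring_group_set y, y * x = 1 & x * y = 1] }.

Definition ring_group_sort (H : ringGroup) : Type := set_type (ring_group_set H).

End RingGroups.
Coercion ring_group_sort : ringGroup >-> Sortclass.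

Section RingGroupStructure.
Variables (A : pzRingType) (H : ringGroup A).

HB.instance Definition _ := Choice.copy H (set_type (ring_group_set H)).

Definition rg_val (x : H) : A := set_val x.

Lemma rg_valP (x : H) : ring_group_set H (rg_val x).
Proof. exact: set_valP. Qed.

Lemma rg_val_inj : injective rg_val.
Proof. exact: val_inj. Qed.

Definition rg_mk (x : A) (Hx : ring_group_set H x) : H := SigSub (mem_set Hx).

Definition rg_one : H := rg_mk (ring_group1 H).
Definition rg_mul (x y : H) : H := rg_mk (ring_groupM (rg_valP x) (rg_valP y)).
Definition rg_inv (x : H) : H :=
  let e := cid (ring_groupV (rg_valP x)) in
  rg_mk (let: And3 Hy _ _ := projT2 e in Hy).

Lemma rg_mulE x y : rg_val (rg_mul x y) = rg_val x * rg_val y.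
Proof. by []. Qed.

Lemma rg_invE x :
  rg_val (rg_inv x) * rg_val x = 1 /\ rg_val x * rg_val (rg_inv x) = 1.
Proof. by rewrite /rg_inv; case: cid => y []. Qed.

Lemma rg_mulA : associative rg_mul.
Proof. by move=> x y z; apply: rg_val_inj; rewrite !rg_mulE mulrA. Qed.
Lemma rg_mul1 : left_id rg_one rg_mul.
Proof. by move=> x; apply: rg_val_inj; rewrite rg_mulE mul1r. Qed.
Lemma rg_mulr1 : right_id rg_one rg_mul.
Proof. by move=> x; apply: rg_val_inj; rewrite rg_mulE mulr1. Qed.
Lemma rg_mulV : left_inverse rg_one rg_inv rg_mul.
Proof. by move=> x; apply: rg_val_inj; rewrite rg_mulE (rg_invE x).1. Qed.
Lemma rg_mulrV : right_inverse rg_one rg_inv rg_mul.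
Proof. by move=> x; apply: rg_val_inj; rewrite rg_mulE (rg_invE x).2. Qed.

HB.instance Definition _ :=
  isGroup.Build H rg_mulA rg_mul1 rg_mulr1 rg_mulV rg_mulrV.

End RingGroupStructure.

Section SpecialOrthogonal.
Variables (R : realType) (n : nat).

Definition so_set : set 'M[R]_n := [set A | A^T *m A = 1%:M /\ \det A = 1].

Lemma so_set1 : so_set 1.
Proof. by split; [rewrite trmx1 mulmx1 | rewrite det1]. Qed.

Lemma so_setM A B : so_set A -> so_set B -> so_set (A * B).
Proof.
move=> [oA dA] [oB dB]; split; last by rewrite det_mulmx dA dB mulr1.
by rewrite trmx_mul mulmxA -(mulmxA B^T) oA mulmx1.
Qed.

Lemma so_setV A : so_set A -> exists B, [/\ so_set B, B * A = 1 & A * B = 1].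
Proof.
move=> [oA dA]; exists A^T; split=> //; last exact: mulmx1C.
by split; [rewrite trmxK; apply: mulmx1C | rewrite det_tr].
Qed.

Definition so_group : ringGroup 'M[R]_n := RingGroup so_set1 so_setM so_setV.
Definition SO : Type := so_group.

HB.instance Definition _ := Group.copy SO so_group.
HB.instance Definition _ := Topological.copy SO (set_type so_set).

Definition so_mx (g : SO) : 'M[R]_n := rg_val g.

End SpecialOrthogonal.

Section Circle.
Variable R : realType.

Definition circle_set : set R[i] := [set z | `|z| = 1].

Lemma circle_set1 : circle_set 1.
Proof. by rewrite /circle_set/= normr1. Qed.

Lemma circle_setM z w : circle_set z -> circle_set w -> circle_set (z * w).
Proof. by rewrite /circle_set/= normrM => -> ->; rewrite mulr1. Qed.

Lemma circle_setV z :
  circle_set z -> exists w, [/\ circle_set w, w * z = 1 & z * w = 1].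
Proof.
rewrite /circle_set/= => z1.
have z0 : z != 0 by rewrite -normr_eq0 z1 oner_neq0.
exists z^-1; split; [by rewrite normfV z1 invr1 | exact: mulVf | exact: mulfV].
Qed.

Definition circle_group : ringGroup R[i] :=
  RingGroup circle_set1 circle_setM circle_setV.
Definition circle : Type := circle_group.

HB.instance Definition _ := Group.copy circle circle_group.

Definition circle_coords (z : circle) : R * R :=
  (complex.Re (rg_val z), complex.Im (rg_val z)).

HB.instance Definition _ :=
  Topological.copy circle (initial_topology circle_coords).

End Circle.

Section Clifford.
Variables (R : realType) (n : nat).

(* An element is its family of coordinates in the basis
   e_S = e_{s_1} ... e_{s_k}, for S = {s_1 < ... < s_k}. *)
Definition clifford : Type := {set 'I_n} -> R.

HB.instance Definition _ := GRing.Lmodule.copy clifford ({set 'I_n} -> R).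
HB.instance Definition _ := Topological.copy clifford {ptws {set 'I_n} -> R}.

Definition symdiff (S T : {set 'I_n}) : {set 'I_n} := ((S :\: T) :|: (T :\: S))%SET.

(* e_S e_T = cl_sign S T e_(symdiff S T): every pair s > t costs a
   transposition, and every common index contributes e_s ^ 2 = -1. *)
Definition cl_sign (S T : {set 'I_n}) : R :=
  \prod_(s in S) \prod_(t in T) (if (t <= s)%N then -1 else 1).

Definition cl_one : clifford := fun S => (S == finset.set0)%:R.

Definition cl_mul (x y : clifford) : clifford :=
  fun U => \sum_(S : {set 'I_n}) cl_sign S (symdiff S U) * x S * y (symdiff S U).

Lemma cl_addE (x y : clifford) S : (x + y) S = x S + y S.
Proof. by []. Qed.
Lemma cl_scaleE (a : R) (x : clifford) S : (a *: x) S = a * x S.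
Proof. by []. Qed.

Lemma in_symdiff S T i : (i \in symdiff S T) = (i \in S) (+) (i \in T).
Proof. by rewrite !inE; case: (i \in S); case: (i \in T). Qed.

Lemma symdiffA : associative symdiff.
Proof. by move=> S T U; apply/setP => i; rewrite !in_symdiff addbA. Qed.
Lemma symdiffC : commutative symdiff.
Proof. by move=> S T; apply/setP => i; rewrite !in_symdiff addbC. Qed.
Lemma symdiff0 S : symdiff finset.set0 S = S.
Proof. by apply/setP => i; rewrite in_symdiff inE. Qed.
Lemma symdiffK S : involutive (symdiff S).
Proof. by move=> T; apply/setP => i; rewrite !in_symdiff addbA addbb. Qed.

Lemma prod_symdiff (f : 'I_n -> R) S T : (forall i, f i ^+ 2 = 1) ->
  \prod_(i in symdiff S T) f i = (\prod_(i in S) f i) * \prod_(i in T) f i.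
Proof.
move=> f2; rewrite !(big_mkcond (fun i => i \in _)) -big_split/=.
apply: eq_bigr => i _; rewrite in_symdiff.
by case: (i \in S); case: (i \in T) => /=; rewrite ?mulr1 ?mul1r // -expr2 f2.
Qed.

Let sgn2 (b : bool) : (if b then -1 else 1 : R) ^+ 2 = 1.
Proof. by case: b; rewrite ?sqrrN expr1n. Qed.

Lemma cl_signl S S' T : cl_sign (symdiff S S') T = cl_sign S T * cl_sign S' T.
Proof.
rewrite /cl_sign prod_symdiff// => i.
by rewrite -prodrXl big1.
Qed.

Lemma cl_signr S T T' : cl_sign S (symdiff T T') = cl_sign S T * cl_sign S T'.
Proof.
by rewrite /cl_sign -big_split/=; apply: eq_bigr => s _; exact: prod_symdiff.
Qed.

Lemma cl_sign0l T : cl_sign finset.set0 T = 1.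
Proof. by rewrite /cl_sign big_set0. Qed.
Lemma cl_sign0r S : cl_sign S finset.set0 = 1.
Proof. by rewrite /cl_sign big1 // => s _; rewrite big_set0. Qed.

Lemma cl_mulA : associative cl_mul.
Proof.
move=> x y z; apply/funext => U; rewrite /cl_mul.
transitivity (\sum_S \sum_T cl_sign S (symdiff S T) * cl_sign T (symdiff T U) *
   x S * y (symdiff S T) * z (symdiff T U)).
  apply: eq_bigr => S _; rewrite mulr_sumr.
  rewrite (reindex_inj (inv_inj (symdiffK S)))/=; apply: eq_bigr => T _.
  have -> : symdiff (symdiff S T) (symdiff S U) = symdiff T U.
    apply/setP => i; rewrite !in_symdiff.
    by case: (i \in S); case: (i \in T); case: (i \in U).
  have eU : symdiff S U = symdiff (symdiff S T) (symdiff T U).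
    apply/setP => i; rewrite !in_symdiff.
    by case: (i \in S); case: (i \in T); case: (i \in U).
  have s2 A B : cl_sign A B ^+ 2 = 1.
    by rewrite /cl_sign -prodrXl big1 // => i _; rewrite -prodrXl big1.
  have E : cl_sign S (symdiff S U) * cl_sign (symdiff S T) (symdiff T U) =
           cl_sign S (symdiff S T) * cl_sign T (symdiff T U).
    rewrite eU cl_signr cl_signl mulrACA -mulrA; congr (_ * _).
    by rewrite mulrA -expr2 s2 mul1r.
  by rewrite -E; ring.
rewrite exchange_big/=; apply: eq_bigr => T _; rewrite mulr_sumr mulr_suml.
apply: eq_bigr => S _; ring.
Qed.

Lemma cl_mul1 : left_id cl_one cl_mul.
Proof.
move=> x; apply/funext => U; rewrite /cl_mul (bigD1 finset.set0)//= big1 => [|S S0].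
  by rewrite symdiff0 cl_sign0l /cl_one eqxx addr0 !mul1r.
by rewrite /cl_one (negbTE S0) mulr0 mul0r.
Qed.

Lemma cl_mulr1 : right_id cl_one cl_mul.
Proof.
move=> x; apply/funext => U; rewrite /cl_mul (bigD1 U)//= big1 => [|S SU].
  have -> : symdiff U U = finset.set0 by rewrite -{2}[U]symdiff0 symdiffC -symdiffA
     symdiffC; apply/setP => i; rewrite !in_symdiff !inE; case: (i \in U).
  by rewrite cl_sign0r /cl_one eqxx addr0 mul1r mulr1.
rewrite /cl_one; case: eqP => [e|_]; last by rewrite mulr0.
by case/eqP: SU; rewrite -[U](symdiffK S) e symdiffC symdiff0.
Qed.

Lemma cl_mulDl : left_distributive cl_mul +%R.
Proof.
move=> x y z; apply/funext => U; rewrite cl_addE /cl_mul -big_split/=.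
by apply: eq_bigr => S _; rewrite cl_addE mulrDr mulrDl.
Qed.

Lemma cl_mulDr : right_distributive cl_mul +%R.
Proof.
move=> x y z; apply/funext => U; rewrite cl_addE /cl_mul -big_split/=.
by apply: eq_bigr => S _; rewrite cl_addE mulrDr.
Qed.

Lemma cl_one_neq0 : cl_one != 0.
Proof.
apply/eqP => /(congr1 (fun f => f finset.set0)); rewrite /cl_one eqxx.
by move/eqP; rewrite oner_eq0.
Qed.

HB.instance Definition _ := GRing.Zmodule_isNzRing.Build clifford
  cl_mulA cl_mul1 cl_mulr1 cl_mulDl cl_mulDr cl_one_neq0.

Lemma cl_mulE (x y : clifford) U : (x * y) U =
  \sum_(S : {set 'I_n}) cl_sign S (symdiff S U) * x S * y (symdiff S U).
Proof. by []. Qed.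

Lemma cl_scaleAl (a : R) (x y : clifford) : a *: (x * y) = (a *: x) * y.
Proof.
apply/funext => U; rewrite cl_scaleE !cl_mulE mulr_sumr.
by apply: eq_bigr => S _; rewrite cl_scaleE; ring.
Qed.

HB.instance Definition _ := GRing.Lmodule_isLalgebra.Build R clifford cl_scaleAl.

Lemma cl_scaleAr (a : R) (x y : clifford) : a *: (x * y) = x * (a *: y).
Proof.
apply/funext => U; rewrite cl_scaleE !cl_mulE mulr_sumr.
by apply: eq_bigr => S _; rewrite cl_scaleE; ring.
Qed.

HB.instance Definition _ := GRing.Lalgebra_isAlgebra.Build R clifford cl_scaleAr.

Definition cl_vec (v : 'cV[R]_n) : clifford :=
  fun S => \sum_(i < n) v i 0 * (S == [set i]%SET)%:R.

End Clifford.

Section SpinGroup.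
Variables (R : realType) (n : nat).
Local Notation cl := (clifford R n).

Definition unit_vec (v : 'cV[R]_n) : Prop := v^T *m v = 1%:M.

Definition spin_set : set cl := [set x | exists s : seq 'cV[R]_n,
  [/\ forall v, v \in s -> unit_vec v, ~~ odd (size s)
    & x = \prod_(v <- s) cl_vec v]].

Let E (S : {set 'I_n}) : cl := fun T => (T == S)%:R.

Let EM S T : E S * E T = cl_sign R S T *: E (symdiff S T).
Proof.
apply/funext => U; rewrite cl_mulE cl_scaleE (bigD1 S)//= big1 => [|V VS].
  rewrite /E eqxx mulr1 addr0 -(can_eq (symdiffK S)) symdiffK.
  by case: eqP => [->|_]; rewrite ?symdiffK // !mulr0.
by rewrite /E (negbTE VS) mulr0 mul0r.
Qed.

Let vecE v : cl_vec v = \sum_i v i 0 *: E [set i]%SET.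
Proof.
apply/funext => S; rewrite /cl_vec; elim/big_rec2: _ => //= i x f _ ->.
by rewrite cl_addE cl_scaleE.
Qed.

Lemma cl_vec_coord (v : 'cV[R]_n) i : cl_vec v [set i]%SET = v i 0.
Proof.
rewrite /cl_vec (bigD1 i)//= eqxx mulr1 big1 ?addr0// => j ji.
by rewrite (inj_eq set1_inj) eq_sym (negbTE ji) mulr0.
Qed.

Lemma cl_vecD (v w : 'cV[R]_n) : cl_vec (v + w) = cl_vec v + cl_vec w.
Proof.
by rewrite !vecE -big_split/=; apply: eq_bigr => i _; rewrite mxE scalerDl.
Qed.

Lemma cl_vecZ a (v : 'cV[R]_n) : cl_vec (a *: v) = a *: cl_vec v.
Proof.
by rewrite !vecE scaler_sumr; apply: eq_bigr => i _; rewrite mxE scalerA.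
Qed.

Lemma cl_vecN (v : 'cV[R]_n) : cl_vec (- v) = - cl_vec v.
Proof. by rewrite -scaleN1r cl_vecZ scaleN1r. Qed.

Lemma clifford_relation (v w : 'cV[R]_n) :
  cl_vec v * cl_vec w + cl_vec w * cl_vec v = (- 2 * (v^T *m w) 0 0)%:A.
Proof.
have EE i j : E [set i]%SET * E [set j]%SET + E [set j]%SET * E [set i]%SET =
    (- 2 * (i == j)%:R)%:A.
  rewrite !EM (symdiffC [set j]%SET) -scalerDl /cl_sign !big_set1.
  have [->|ij] := eqVneq i j.
    have -> : symdiff [set j]%SET [set j]%SET = finset.set0.
      by apply/setP => k; rewrite in_symdiff addbb inE.
    by rewrite leqnn; congr (_ *: _); rewrite mulr1 (natrD _ 1 1) opprD.
  have /orP[lt|lt] : (i < j)%N || (j < i)%N by rewrite -neq_ltn.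
    by rewrite (ltnW lt) leqNgt lt/= subrr mulr0 !scale0r.
  by rewrite (ltnW lt) leqNgt lt/= addNr mulr0 !scale0r.
rewrite !vecE !mulr_suml.
under eq_bigr => i _ do rewrite mulr_sumr.
under [X in _ + X]eq_bigr => i _ do rewrite mulr_sumr.
rewrite [X in _ + X]exchange_big -big_split/= mxE mulr_sumr scaler_suml.
apply: eq_bigr => i _; rewrite -big_split/= (bigD1 i)//= big1 => [|j ji].
  rewrite addr0 -!scalerAl -!scalerAr !scalerA (mulrC (w i 0)) -scalerDr EE.
  rewrite eqxx mulr1 scalerA [v^T _ _]mxE.
  by congr (_ *: _); rewrite /GRing.scale/=; ring.
rewrite -!scalerAl -!scalerAr !scalerA (mulrC (w j 0)) -scalerDr EE.
by rewrite eq_sym (negbTE ji) mulr0 scale0r scaler0.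
Qed.

Lemma cl_vec_unit v : unit_vec v -> cl_vec v * cl_vec v = -1.
Proof.
move=> v1; have := clifford_relation v v; rewrite v1 mxE eqxx mulr1.
rewrite -mulr2n -scaler_nat => /(congr1 (fun x => 2^-1 *: x)).
rewrite !scalerA mulVf ?pnatr_eq0// scale1r => ->.
by rewrite mulrN mulVf ?pnatr_eq0// scaleN1r.
Qed.

Lemma unit_vecN v : unit_vec v -> unit_vec (- v).
Proof. by rewrite /unit_vec mulmxN [(- v)^T]linearN/= mulNmx opprK. Qed.

Lemma spin_set1 : spin_set 1.
Proof. by exists [::]; rewrite big_nil. Qed.

Lemma spin_setM x y : spin_set x -> spin_set y -> spin_set (x * y).
Proof.
move=> [s [us es ->]] [t [ut et ->]]; exists (s ++ t); split.
- by move=> v; rewrite mem_cat => /orP[/us|/ut].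
- by rewrite size_cat oddD (negbTE es).
- by rewrite big_cat.
Qed.

Lemma spin_setV x : spin_set x -> exists y, [/\ spin_set y, y * x = 1 & x * y = 1].
Proof.
move=> [s [us es ->]]; exists (\prod_(v <- rev (map -%R s)) cl_vec v); split.
- exists (rev (map -%R s)); split=> //; last by rewrite size_rev size_map.
  by move=> v; rewrite mem_rev => /mapP[w /us uw ->]; exact: unit_vecN.
- elim: s us {es} => [|v s IH] us; first by rewrite !big_nil mulr1.
  have uv : unit_vec v by exact/us/mem_head.
  have us' w : w \in s -> unit_vec w by move=> ws; apply: us; rewrite inE ws orbT.
  rewrite map_cons rev_cons big_rcons/= big_cons mulrA -(mulrA _ (cl_vec (- v))).
  by rewrite cl_vecN mulNr (cl_vec_unit uv) opprK mulr1 (IH us').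
- elim: s us {es} => [|v s IH] us; first by rewrite !big_nil mulr1.
  have uv : unit_vec v by exact/us/mem_head.
  have us' w : w \in s -> unit_vec w by move=> ws; apply: us; rewrite inE ws orbT.
  rewrite map_cons rev_cons big_rcons/= big_cons.
  rewrite -mulrA (mulrA (\prod_(j <- s) _)) (IH us') mul1r.
  by rewrite cl_vecN mulrN (cl_vec_unit uv) opprK.
Qed.

Definition spin_group : ringGroup cl := RingGroup spin_set1 spin_setM spin_setV.
Definition Spin : Type := spin_group.

HB.instance Definition _ := Group.copy Spin spin_group.
HB.instance Definition _ := Topological.copy Spin (set_type spin_set).

Definition spin_val (g : Spin) : cl := rg_val g.

(* The matrix of w |-> g w g^-1 on the space of vectors. *)
Definition spin_cover_mx (g : Spin) : 'M[R]_n := \matrix_(i, j)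
  (spin_val g * cl_vec (delta_mx j 0) * spin_val g^-1%g) [set i]%SET.

Let det_rank1 (u : 'cV[R]_n) (w : 'rV[R]_n) :
  \det (1%:M + u *m w) = 1 + (w *m u) 0 0.
Proof.
pose M := block_mx (1%:M : 'M[R]_1) (- w) u (1%:M : 'M[R]_n).
have M1 : M = block_mx 1%:M 0 u 1%:M *m block_mx 1%:M (- w) 0 (1%:M + u *m w).
  rewrite mulmx_block !(mul1mx, mul0mx, mulmx1, mulmx0, addr0) mulmxN.
  by rewrite addrC addrK.
have M2 : M = block_mx 1%:M (- w) 0 1%:M *m block_mx (1%:M + w *m u) 0 u 1%:M.
  rewrite mulmx_block !(mul1mx, mul0mx, mulmx1, mulmx0, add0r) mulNmx.
  by rewrite addrK.
have := congr1 determinant M1; rewrite {1}M2 !det_mulmx !det_lblock !det_ublock.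
by rewrite !det1 !mulr1 !mul1r => <-; rewrite det_mx11 !mxE eqxx.
Qed.

Let refl (v : 'cV[R]_n) : 'M[R]_n := 2 *: (v *m v^T) - 1%:M.

Let reflP v : unit_vec v -> [/\ (refl v)^T *m refl v = 1%:M,
  \det (refl v) = - (-1) ^+ n
  & forall w, cl_vec v * cl_vec w = cl_vec (refl v *m w) * cl_vec v].
Proof.
move=> v1; split.
- have -> : (refl v)^T = refl v.
    by rewrite /refl linearB linearZ/= trmx_mul trmxK trmx1.
  have PP : v *m v^T *m (v *m v^T) = v *m v^T.
    by rewrite mulmxA -(mulmxA v) v1 mulmx1.
  rewrite /refl mulmxBl mulmxBr !(mul1mx, mulmx1) -scalemxAl -scalemxAr PP.
  have -> : 2 *: (2 *: (v *m v^T)) = 2 *: (v *m v^T) + 2 *: (v *m v^T).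
    by rewrite -[X in X *: _](natrD _ 1 1) scaler_nat mulr2n.
  by rewrite addrK opprB addrC subrK.
- have -> : refl v = (-1) *: (1%:M + (- 2 *: v) *m v^T).
    by rewrite /refl -scalemxAl scaleN1r opprD scaleNr opprK addrC.
  rewrite detZ det_rank1 -scalemxAr v1 !mxE eqxx mulr1n. ring.
- move=> w; rewrite /refl mulmxBl mul1mx -scalemxAl -mulmxA.
  have -> : v^T *m w = ((v^T *m w) 0 0)%:M by exact: mx11_scalar.
  rewrite mul_mx_scalar scalerA cl_vecD cl_vecN cl_vecZ mulrDl mulNr -scalerAl.
  rewrite cl_vec_unit// scalerN.
  have := clifford_relation v w; rewrite mulNr scaleNr => <-.
  by rewrite addrK.
Qed.

Lemma spin_set_conj x : spin_set x -> exists2 A, so_set A &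
  forall w, x * cl_vec w = cl_vec (A *m w) * x.
Proof.
move=> [s [us es ->]].
suff [A [oA dA cA]] : exists A : 'M[R]_n, [/\ A^T *m A = 1%:M,
    \det A = (- (-1) ^+ n) ^+ size s & forall w,
    \prod_(v <- s) cl_vec v * cl_vec w =
    cl_vec (A *m w) * \prod_(v <- s) cl_vec v].
  exists A => //; split=> //; rewrite dA -(odd_double_half (size s)).
  by rewrite (negbTE es) add0n -mul2n exprM sqrrN sqrr_sign expr1n.
elim: s us {es} => [|v s IH] us.
  exists 1%:M; split; rewrite ?trmx1 ?mulmx1 ?det1 ?expr0// => w.
  by rewrite big_nil mul1mx mul1r mulr1.
have [|A [oA dA cA]] := IH; first by move=> w ws; apply: us; rewrite inE ws orbT.
have [oB dB cB] := reflP (us v (mem_head _ _)).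
exists (refl v *m A); split; first 1 last.
- by rewrite det_mulmx dB dA -exprS.
- by move=> w; rewrite !big_cons -mulrA cA mulrA cB mulmxA mulrA.
- by rewrite trmx_mul mulmxA -(mulmxA A^T) oB mulmx1.
Qed.

Let spin_coverE g (A : 'M[R]_n) :
  (forall w, spin_val g * cl_vec w = cl_vec (A *m w) * spin_val g) ->
  spin_cover_mx g = A.
Proof.
move=> cA; apply/matrixP => i j; rewrite mxE cA -mulrA.
have -> : spin_val g * spin_val g^-1%g = 1 by exact: (rg_invE g).2.
rewrite mulr1 cl_vec_coord mxE (bigD1 j)//= big1 => [|k kj].
  by rewrite mxE !eqxx mulr1 addr0.
by rewrite mxE (negbTE kj) mulr0.
Qed.

Lemma spin_cover_so g : so_set (spin_cover_mx g).
Proof. by have [A sA /spin_coverE->] := spin_set_conj (rg_valP g). Qed.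

Definition spin_cover (g : Spin) : SO R n :=
  @rg_mk _ (so_group R n) _ (spin_cover_so g).

Lemma spin_coverP g w :
  spin_val g * cl_vec w = cl_vec (so_mx (spin_cover g) *m w) * spin_val g.
Proof.
have [A sA cA] := spin_set_conj (rg_valP g).
by rewrite cA -(spin_coverE cA).
Qed.

Lemma spin_coverM g h : spin_cover (g * h)%g = (spin_cover g * spin_cover h)%g.
Proof.
apply: rg_val_inj; apply: spin_coverE => w.
rewrite /spin_val rg_mulE -mulrA spin_coverP mulrA spin_coverP mulmxA mulrA.
by [].
Qed.

Lemma spin_coverN g h : spin_val h = - spin_val g -> spin_cover h = spin_cover g.
Proof.
move=> hg; apply: rg_val_inj; apply: spin_coverE => w.
by rewrite hg mulNr spin_coverP mulrN.
Qed.

End SpinGroup.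

Section SpinC.
Variables (R : realType) (n : nat).
Local Open Scope quotient_scope.
Implicit Types p q : Spin R n * circle R.

Definition opposite p q : Prop :=
  spin_val q.1 = - spin_val p.1 /\ rg_val q.2 = - rg_val p.2.

Lemma opposite_sym p q : opposite p q -> opposite q p.
Proof. by move=> [e1 e2]; split; rewrite ?e1 ?e2 opprK. Qed.

Lemma opposite_inj p q r : opposite p q -> opposite p r -> q = r.
Proof.
case: q r => [q1 q2] [r1 r2] [/= e1 e2] [/= e3 e4]; congr (_, _).
  by apply: rg_val_inj; rewrite -[LHS]/(spin_val _) e1 -e3.
by apply: rg_val_inj; rewrite e2 -e4.
Qed.

Lemma oppositeMl p q r : opposite p q -> opposite (p * r)%g (q * r)%g.
Proof.
move=> [e1 e2]; split.
  by rewrite -[LHS]/(spin_val q.1 * spin_val r.1) e1 mulNr.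
by rewrite -[LHS]/(rg_val q.2 * rg_val r.2) e2 mulNr.
Qed.

Lemma oppositeMr p q r : opposite p q -> opposite (r * p)%g (r * q)%g.
Proof.
move=> [e1 e2]; split.
  by rewrite -[LHS]/(spin_val r.1 * spin_val q.1) e1 mulrN.
by rewrite -[LHS]/(rg_val r.2 * rg_val q.2) e2 mulrN.
Qed.

Definition spinc_rel p q : bool := `[< q = p \/ opposite p q >].

Lemma spinc_rel_refl : reflexive spinc_rel.
Proof. by move=> p; apply/asboolP; left. Qed.

Lemma spinc_rel_sym : symmetric spinc_rel.
Proof.
move=> p q; apply/asbool_equiv_eq.
by split=> -[->|/opposite_sym]; [left|right|left|right].
Qed.

Lemma spinc_rel_trans : transitive spinc_rel.
Proof.
move=> q p r /asboolP[->//|pq] /asboolP[->|qr]; apply/asboolP; first by right.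
by left; apply: opposite_inj qr _; exact: opposite_sym.
Qed.

Definition spinc_equiv := EquivRel _ spinc_rel_refl spinc_rel_sym spinc_rel_trans.
Definition SpinC : Type := quotient_topology {eq_quot spinc_equiv}.

HB.instance Definition _ :=
  Topological.copy SpinC (quotient_topology {eq_quot spinc_equiv}).

Definition spinc_mk p : SpinC := \pi_{eq_quot spinc_equiv} p.
Definition spinc_repr (x : SpinC) : Spin R n * circle R :=
  repr (x : {eq_quot spinc_equiv}).

Lemma spinc_reprK x : spinc_mk (spinc_repr x) = x.
Proof. exact: reprK. Qed.

Lemma spinc_mkP p q : spinc_mk p = spinc_mk q <-> (q = p \/ opposite p q).
Proof. by split=> [/eqmodP/asboolP|h]; [|apply/eqmodP/asboolP]. Qed.

Definition spinc_one : SpinC := spinc_mk 1%g.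
Definition spinc_mul (x y : SpinC) : SpinC :=
  spinc_mk (spinc_repr x * spinc_repr y)%g.
Definition spinc_inv (x : SpinC) : SpinC := spinc_mk (spinc_repr x)^-1%g.

Lemma spinc_mkM p q : spinc_mul (spinc_mk p) (spinc_mk q) = spinc_mk (p * q)%g.
Proof.
have h p' q' r : spinc_mk p' = spinc_mk q' ->
    spinc_mk (p' * r)%g = spinc_mk (q' * r)%g.
  by move=> /spinc_mkP[->//|/oppositeMl h]; apply/spinc_mkP; right.
have h' p' q' r : spinc_mk p' = spinc_mk q' ->
    spinc_mk (r * p')%g = spinc_mk (r * q')%g.
  by move=> /spinc_mkP[->//|/oppositeMr h']; apply/spinc_mkP; right.
rewrite /spinc_mul (h _ _ _ (spinc_reprK (spinc_mk p))).
exact: h' (spinc_reprK (spinc_mk q)).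
Qed.

Lemma spinc_mulA : associative spinc_mul.
Proof.
move=> x y z; rewrite -[x]spinc_reprK -[y]spinc_reprK -[z]spinc_reprK.
by rewrite !spinc_mkM mulgA.
Qed.
Lemma spinc_mul1 : left_id spinc_one spinc_mul.
Proof. by move=> x; rewrite -[x]spinc_reprK spinc_mkM mul1g. Qed.
Lemma spinc_mulr1 : right_id spinc_one spinc_mul.
Proof. by move=> x; rewrite -[x]spinc_reprK spinc_mkM mulg1. Qed.
Lemma spinc_mulV : left_inverse spinc_one spinc_inv spinc_mul.
Proof. by move=> x; rewrite -{2}[x]spinc_reprK spinc_mkM mulVg. Qed.
Lemma spinc_mulrV : right_inverse spinc_one spinc_inv spinc_mul.
Proof. by move=> x; rewrite -{1}[x]spinc_reprK spinc_mkM mulgV. Qed.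

HB.instance Definition _ := isGroup.Build SpinC
  spinc_mulA spinc_mul1 spinc_mulr1 spinc_mulV spinc_mulrV.

Definition spinc_cover (x : SpinC) : SO R n := spin_cover (spinc_repr x).1.

Lemma spinc_coverE p : spinc_cover (spinc_mk p) = spin_cover p.1.
Proof.
rewrite /spinc_cover.
have /spinc_mkP[<-//|[e _]] := spinc_reprK (spinc_mk p).
by symmetry; apply: spin_coverN.
Qed.

Lemma spinc_coverM x y :
  spinc_cover (x * y)%g = (spinc_cover x * spinc_cover y)%g.
Proof.
rewrite -[x]spinc_reprK -[y]spinc_reprK.
rewrite -[LHS]/(spinc_cover (spinc_mul _ _)) spinc_mkM !spinc_coverE.
exact: spin_coverM.
Qed.

End SpinC.

Section Milnor.
Variables (R : realType) (G : topGroupType).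
Local Open Scope quotient_scope.

(* A point t_0 g_0 + t_1 g_1 + ... of the infinite join G * G * ...: almost
   all t_i vanish, they add up to 1, and g_i is only defined when t_i > 0; the
   i-th term is [None] when t_i = 0 and [Some (t_i, g_i)] otherwise. *)
Definition join_coef (x : nat -> option (R * G)) (i : nat) : R :=
  if x i is Some (t, _) then t else 0.

Definition join_set : set (nat -> option (R * G)) := [set x |
  (forall i t g, x i = Some (t, g) -> 0 < t) /\
  exists2 N, (forall i, (N <= i)%N -> x i = None) &
             \sum_(i < N) join_coef x i = 1].

Definition EG : Type := set_type join_set.

HB.instance Definition _ := Choice.copy EG (set_type join_set).

Definition EG_coef (i : nat) (x : EG) : R := join_coef (set_val x) i.

(* The coarsest topology for which the t_i are continuous, and the g_i are
   continuous on the sets where t_i > 0. *)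
Definition EG_subbase : set (set EG) := [set A |
  (exists i (U : set R), open U /\ A = EG_coef i @^-1` U) \/
  (exists i (V : set G), open V /\
     A = [set x | exists t g, set_val x i = Some (t, g) /\ V g])].

HB.instance Definition _ := isSubBaseTopological.Build EG EG_subbase id.

Lemma join_act_set (g : G) (x : nat -> option (R * G)) : join_set x ->
  join_set (fun i => omap (fun th => (th.1, th.2 * g)%g) (x i)).
Proof.
move=> [x0 [N xN x1]]; split=> [i t h|].
  by case: (x i) (x0 i) => [[t' h']|]//= /(_ _ _ erefl) + [<-].
exists N => [i /xN->//|]; rewrite -[RHS]x1; apply: eq_bigr => i _.
by rewrite /join_coef; case: (x i) => [[]|].
Qed.

Definition EG_act (x : EG) (g : G) : EG :=
  SigSub (mem_set (join_act_set g (set_valP x))).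

Lemma EG_act1 x : EG_act x 1%g = x.
Proof.
apply: val_inj; apply/funext => i /=.
by case: (sval x i) => [[t h]|]//=; rewrite mulg1.
Qed.

Lemma EG_actM x g h : EG_act x (g * h)%g = EG_act (EG_act x g) h.
Proof.
apply: val_inj; apply/funext => i /=.
by case: (sval x i) => [[t k]|]//=; rewrite mulgA.
Qed.

Definition EG_orbit (x y : EG) : bool := `[< exists g, y = EG_act x g >].

Lemma EG_orbit_refl : reflexive EG_orbit.
Proof. by move=> x; apply/asboolP; exists 1%g; rewrite EG_act1. Qed.

Lemma EG_orbit_sym : symmetric EG_orbit.
Proof.
move=> x y; apply/asbool_equiv_eq; split=> -[g ->]; exists g^-1%g;
  by rewrite -EG_actM mulgV EG_act1.
Qed.

Lemma EG_orbit_trans : transitive EG_orbit.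
Proof.
move=> y x z /asboolP[g ->] /asboolP[h ->]; apply/asboolP.
by exists (g * h)%g; rewrite EG_actM.
Qed.

Definition EG_equiv := EquivRel _ EG_orbit_refl EG_orbit_sym EG_orbit_trans.
Definition BG : Type := quotient_topology {eq_quot EG_equiv}.

HB.instance Definition _ :=
  Topological.copy BG (quotient_topology {eq_quot EG_equiv}).

Definition BG_proj (x : EG) : BG := \pi_{eq_quot EG_equiv} x.
Definition BG_repr (b : BG) : EG := repr (b : {eq_quot EG_equiv}).

Lemma BG_reprK b : BG_proj (BG_repr b) = b.
Proof. exact: reprK. Qed.

Lemma BG_projP x y : BG_proj x = BG_proj y <-> exists g, y = EG_act x g.
Proof. by split=> [/eqmodP/asboolP|h]; [|apply/eqmodP/asboolP]. Qed.

End Milnor.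

Section MilnorMap.
Variables (R : realType) (G H : topGroupType) (f : G -> H).

Lemma join_map_set (x : nat -> option (R * G)) : join_set x ->
  join_set (fun i => omap (fun tg => (tg.1, f tg.2)) (x i)).
Proof.
move=> [x0 [N xN x1]]; split=> [i t h|].
  by case: (x i) (x0 i) => [[t' h']|]//= /(_ _ _ erefl) + [<-].
exists N => [i /xN->//|]; rewrite -[RHS]x1; apply: eq_bigr => i _.
by rewrite /join_coef; case: (x i) => [[]|].
Qed.

Definition EG_map (x : EG R G) : EG R H :=
  SigSub (mem_set (join_map_set (set_valP x))).

Definition BG_map (b : BG R G) : BG R H := BG_proj (EG_map (BG_repr b)).

Lemma BG_mapE : (forall g h, f (g * h)%g = (f g * f h)%g) ->
  forall x, BG_map (BG_proj x) = BG_proj (EG_map x).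
Proof.
move=> fM x; rewrite /BG_map.
have /BG_projP[g {2}->] := BG_reprK (BG_proj x).
apply/BG_projP; exists (f g); apply: val_inj; apply/funext => i /=.
by case: (sval _ i) => [[t h]|]//=; rewrite fM.
Qed.

End MilnorMap.

Section SpinCStructures.
Variables (R : realType) (n : nat).

(* [F], with its right SO(n)-action [act] and its projection [p] onto [W],
   stands for the bundle of oriented orthonormal frames of W. *)
Variables (W F : topologicalType) (p : F -> W) (act : F -> SO R n -> F).

(* An SO(n)-equivariant map F -> ESO(n) over d is an isomorphism of F with the
   pullback of the universal bundle by d. *)
Definition classifying_map (d : W -> BG R (SO R n)) : Prop :=
  continuous d /\
  exists Phi : F -> EG R (SO R n), [/\ continuous Phi,
    forall f g, Phi (act f g) = EG_act (Phi f) g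
    & forall f, BG_proj (Phi f) = d (p f)].

Definition spinc_lift (d : W -> BG R (SO R n)) (l : W -> BG R (SpinC R n)) :
  Prop := continuous l /\ BG_map (@spinc_cover R n) \o l = d.

(* The classifying map is determined up to homotopy only, and every map in its
   homotopy class is a classifying map. *)
Definition has_spinc_structure : Prop :=
  exists d, classifying_map d /\ exists l, spinc_lift d l.

End SpinCStructures.

Section EuclideanMotions.
Variables (R : realType) (n : nat).

Definition motion : Type := (SO R n * 'cV[R]_n)%type.

HB.instance Definition _ := Choice.copy motion (SO R n * 'cV[R]_n)%type.
HB.instance Definition _ := Topological.copy motion (SO R n * 'cV[R]_n)%type.

Definition motion_one : motion := (1%g, 0).
Definition motion_mul (s t : motion) : motion :=
  ((s.1 * t.1)%g, s.2 + so_mx s.1 *m t.2).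
Definition motion_inv (s : motion) : motion :=
  ((s.1^-1)%g, - (so_mx s.1^-1%g *m s.2)).

Lemma so_mxM (A B : SO R n) : so_mx (A * B)%g = so_mx A *m so_mx B.
Proof. by []. Qed.
Lemma so_mx1 : so_mx (1%g : SO R n) = 1%:M.
Proof. by []. Qed.

Lemma motion_mulA : associative motion_mul.
Proof.
move=> s t u; congr (_, _); first exact: mulgA.
by rewrite /= so_mxM mulmxDr mulmxA addrA.
Qed.
Lemma motion_mul1 : left_id motion_one motion_mul.
Proof.
by case=> A a; rewrite /motion_mul/= mul1g so_mx1 mul1mx add0r.
Qed.
Lemma motion_mulr1 : right_id motion_one motion_mul.
Proof. by case=> A a; rewrite /motion_mul/= mulg1 mulmx0 addr0. Qed.
Lemma motion_mulV : left_inverse motion_one motion_inv motion_mul.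
Proof. by case=> A a; rewrite /motion_mul/= mulVg addNr. Qed.
Lemma motion_mulrV : right_inverse motion_one motion_inv motion_mul.
Proof.
case=> A a; rewrite /motion_mul/= mulgV mulmxN mulmxA -so_mxM mulgV.
by rewrite so_mx1 mul1mx subrr.
Qed.

HB.instance Definition _ := isGroup.Build motion
  motion_mulA motion_mul1 motion_mulr1 motion_mulV motion_mulrV.

Definition motion_act (s : motion) (x : 'cV[R]_n) : 'cV[R]_n :=
  so_mx s.1 *m x + s.2.

(* The action of the differential of a motion on frames: the columns of U form
   an oriented orthonormal frame at x. *)
Definition motion_frame_act (s : motion) (xU : 'cV[R]_n * SO R n) :=
  (motion_act s xU.1, (s.1 * xU.2)%g).

Lemma motion_act1 x : motion_act 1%g x = x.
Proof. by rewrite /motion_act so_mx1 mul1mx addr0. Qed.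
Lemma motion_actM s t x : motion_act (s * t)%g x = motion_act s (motion_act t x).
Proof.
rewrite /motion_act so_mxM mulmxDr mulmxA -[RHS]addrA.
by rewrite [X in _ = _ + X]addrC.
Qed.
Lemma motion_frame_act1 x : motion_frame_act 1%g x = x.
Proof. by case: x => x U; rewrite /motion_frame_act motion_act1 mul1g. Qed.
Lemma motion_frame_actM s t x :
  motion_frame_act (s * t)%g x = motion_frame_act s (motion_frame_act t x).
Proof. by rewrite /motion_frame_act motion_actM mulgA. Qed.

End EuclideanMotions.

Section OrbitSpaces.
Variables (G : groupType) (T : choiceType) (act : G -> T -> T).
Hypothesis act1 : forall x, act 1%g x = x.
Hypothesis actM : forall g h x, act (g * h)%g x = act g (act h x).
Variable H : subgroup G.

Definition orbit_rel (x y : T) : bool := `[< exists2 g, subgroup_set H g & y = act g x >].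

Lemma orbit_refl : reflexive orbit_rel.
Proof.
by move=> x; apply/asboolP; exists 1%g; rewrite ?act1//; case: (subgroupP H).
Qed.

Lemma orbit_sym : symmetric orbit_rel.
Proof.
have [_ _ HV] := subgroupP H.
move=> x y; apply/asbool_equiv_eq; split=> -[g Hg ->]; exists g^-1%g;
  by rewrite -?actM ?mulVg ?act1//; apply: HV.
Qed.

Lemma orbit_trans : transitive orbit_rel.
Proof.
have [_ HM _] := subgroupP H.
move=> y x z /asboolP[g Hg ->] /asboolP[h Hh ->]; apply/asboolP.
by exists (h * g)%g; rewrite ?actM//; apply: HM.
Qed.

Definition orbit_equiv := EquivRel _ orbit_refl orbit_sym orbit_trans.

End OrbitSpaces.

Section FlatManifolds.
Variables (R : realType) (n : nat) (Gamma : subgroup (motion R n)).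
Local Open Scope quotient_scope.

Definition point_equiv :=
  orbit_equiv (@motion_act1 R n) (@motion_actM R n) Gamma.
Definition flat_manifold : Type := quotient_topology {eq_quot point_equiv}.

HB.instance Definition _ :=
  Topological.copy flat_manifold (quotient_topology {eq_quot point_equiv}).

Definition frame_equiv :=
  orbit_equiv (@motion_frame_act1 R n) (@motion_frame_actM R n) Gamma.
Definition frame_bundle : Type := quotient_topology {eq_quot frame_equiv}.

HB.instance Definition _ :=
  Topological.copy frame_bundle (quotient_topology {eq_quot frame_equiv}).

Definition flat_pi (x : 'cV[R]_n) : flat_manifold := \pi_{eq_quot point_equiv} x.
Definition frame_pi (xU : 'cV[R]_n * SO R n) : frame_bundle :=
  \pi_{eq_quot frame_equiv} xU.
Definition frame_repr (f : frame_bundle) : 'cV[R]_n * SO R n :=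
  repr (f : {eq_quot frame_equiv}).

Definition frame_proj (f : frame_bundle) : flat_manifold :=
  flat_pi (frame_repr f).1.
Definition frame_act (f : frame_bundle) (g : SO R n) : frame_bundle :=
  frame_pi ((frame_repr f).1, ((frame_repr f).2 * g)%g).

Lemma flat_piP x y :
  flat_pi x = flat_pi y <-> exists2 s, subgroup_set Gamma s & y = motion_act s x.
Proof. by split=> [/eqmodP/asboolP|h]; [|apply/eqmodP/asboolP]. Qed.

Lemma frame_piP x y :
  frame_pi x = frame_pi y <-> exists2 s, subgroup_set Gamma s & y = motion_frame_act s x.
Proof. by split=> [/eqmodP/asboolP|h]; [|apply/eqmodP/asboolP]. Qed.

Lemma frame_reprK f : frame_pi (frame_repr f) = f.
Proof. exact: reprK. Qed.

Lemma frame_projE x U : frame_proj (frame_pi (x, U)) = flat_pi x.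
Proof.
have /frame_piP[s Gs e] := frame_reprK (frame_pi (x, U)).
by apply/flat_piP; exists s => //; move/(congr1 fst): e.
Qed.

Lemma frame_actE x U g : frame_act (frame_pi (x, U)) g = frame_pi (x, (U * g)%g).
Proof.
have /frame_piP[s Gs e] := frame_reprK (frame_pi (x, U)).
apply/frame_piP; exists s => //.
rewrite /motion_frame_act/= mulgA; congr (_, (_ * g)%g).
  by move/(congr1 fst): e.
by move/(congr1 snd): e.
Qed.

Definition discrete_subgroup : Prop :=
  forall s, subgroup_set Gamma s -> isolated Gamma s.

Definition flat_manifold_group : Prop := [/\ discrete_subgroup,
  compact [set: flat_manifold] & torsion_free Gamma].

Definition holonomy : set (SO R n) := fst @` Gamma.

Definition hantzsche_wendt : Prop := flat_manifold_group /\
  exists f : 'rV['Z_2]_n.-1 -> SO R n,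
    [/\ injective f, forall u v, f (u + v) = (f u * f v)%g & range f = holonomy].

Definition hw_rotation (i : 'I_n) : 'M[R]_n :=
  diag_mx (\row_j (if j == i then 1 else -1)).

(* [ordS] is the cyclic successor of 'I_n, so that the last translation has its
   entries 1/2 in the last and in the first position. *)
Definition hw_translation (i : 'I_n) : 'cV[R]_n :=
  \col_j (if (j == i) || (j == ordS i) then 2^-1 else 0).

(* For n even hw_rotation i has determinant -1, and no such family exists. *)
Definition cyclic_hw : Prop := exists beta : 'I_n -> motion R n,
  [/\ forall i, so_mx (beta i).1 = hw_rotation i,
      forall i, (beta i).2 = hw_translation i
    & Gamma = generated (range beta) :> set (motion R n)].

End FlatManifolds.

(* Main.v *)
(** A SpinC-structure on the quotient of the Euclidean space by Gamma, pulled
    back to the universal cover, is trivialized by a section y.  For gamma in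
    Gamma and a lift g of its linear part to Spin(n), y (gamma x) [g, 1] and
    y x differ by a circle-valued function of x, which has a real logarithm F.
    The triples (gamma, g, F) form an extension of Gamma by a central copy of
    the integers, generated by (1, -1, pi).  Let b_i be a lift of beta_i and
    T_i = b_i ^ 2.  The anticommutation of the lifts of the B_i to Spin(n)
    determines the parity of the central defects of the relations
      beta_i beta_j t_i t_{j+1} = beta_j beta_i t_{i+1} t_j
    (for j > i + 1) and beta_i beta_{i+1} t_i t_{i+2} = beta_{i+1} beta_i t_{i+1}
    of Gamma, with t_i = beta_i ^ 2.  On the other hand, the commutator
    V = [b_i, b_j] satisfies V^{b_i} V = [T_i, b_j], which expresses each
    defect through the integers m_{ij} given by T_j^{b_i} = T_j^-1 zeta^{2 m_{ij}}.
    The relations also show that m_{ij} does not depend on i, and five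
    consecutive indices then give a contradiction modulo 2. *)
Require Import Defs.
From HB Require Import structures.
From mathcomp Require Import all_boot all_order all_algebra.
From mathcomp Require Import complex.
From mathcomp Require Import zify ring lra.
From mathcomp Require Import all_classical all_reals all_analysis.

Set Implicit Arguments.
Unset Strict Implicit.
Unset Printing Implicit Defensive.

Import Order.TTheory GRing.Theory Num.Theory.
Import numFieldNormedType.Exports.

(** * A parity obstruction for central extensions by the integers *)

(** The kernel of the extension has to be the integers. A SpinC-structure amounts to an integral
    class reducing to w_2: the extension of Gamma by the integers carries that class, and its spin
    component is the reduction modulo 2. Because this kernel is torsion-free, the commutator
    identity, which reads 2(k + q) = 2r on exponents, can be halved before it is reduced modulo 2;
    over a kernel of order 2 it would say nothing. Real logarithms produce this kernel. The
    circle-valued defect of a deck transformation is an arbitrary continuous function, but two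
    logarithms belonging to the same motion differ by a continuous function with values in the
    multiples of pi, hence by a constant. The bound n > 3 enters only through the number of
    generators: n is odd, so there are at least five, which is what the system of parities needs in
    order to be inconsistent. *)

Section CentralExtension.
Local Open Scope group_scope.
Variables (X G D : groupType) (pi : X -> G) (chi : X -> D) (zeta : int -> X).
Variables (M : X -> Prop) (b : nat -> X).
Hypothesis chiM : {morph chi : x y / x * y}.
Hypothesis zetaD : forall k l : int, zeta (k + l)%R = zeta k * zeta l.
Hypothesis zeta_inj : injective zeta.
Hypothesis zetaC : forall k x, zeta k * x = x * zeta k.
Hypothesis chi_zeta : forall k, chi (zeta k) = 1 -> exists l : int, k = (l + l)%R.
Hypothesis MM : forall x y, M x -> M y -> M (x * y).
Hypothesis M_fib : forall x y, M x -> M y -> pi x = pi y ->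
  exists k, x = y * zeta k.
Hypothesis Mb : forall i, (i < 5)%N -> M (b i).
Variable T : nat -> X.
Hypothesis TE : forall i, T i = b i * b i.
Hypothesis chi_b : forall i j, (i < 5)%N -> (j < 5)%N -> i != j ->
  chi (b i) * chi (b j) = chi (b j) * chi (b i) * chi (zeta 1).
Hypothesis chi_T : forall i, (i < 5)%N -> exists k, chi (T i) = chi (zeta k).
Hypothesis pi_T : forall i j, (i < 5)%N -> (j < 5)%N -> i != j ->
  pi (T j * b i * T j) = pi (b i).
Hypothesis pi_adj : forall i, (i < 3)%N ->
  pi (b i * b i.+1 * (T i * T i.+2)) = pi (b i.+1 * b i * T i.+1).
Hypothesis pi_far :
  pi (b 0 * b 3 * (T 0 * T 4)) = pi (b 3 * b 0 * (T 1 * T 3)).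

Let zeta0 : zeta 0 = 1.
Proof. by apply: (mulgI (zeta 0)); rewrite -zetaD addr0 mulg1. Qed.

Let zetaN k : zeta (- k)%R = (zeta k)^-1.
Proof. by apply: (mulgI (zeta k)); rewrite -zetaD subrr zeta0 mulgV. Qed.

Let zetaJ k x : zeta k ^ x = zeta k.
Proof. by rewrite conjgE zetaC mulKg. Qed.

Let zMz x k l : x * zeta k * zeta l = x * zeta (k + l)%R.
Proof. by rewrite zetaD mulgA. Qed.

Let zMM x k y l : x * zeta k * (y * zeta l) = x * y * zeta (k + l)%R.
Proof. by rewrite zetaD -!mulgA (mulgA (zeta k) y) (zetaC k y) -!mulgA. Qed.

Let chi1 : chi 1 = 1.
Proof. by apply: (mulgI (chi 1)); rewrite -chiM !mulg1. Qed.

Let chi_zetaC k x : chi (zeta k) * chi x = chi x * chi (zeta k).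
Proof. by rewrite -!chiM zetaC. Qed.

Let chi_zeta_eq k l : chi (zeta k) = chi (zeta l) -> exists m : int, (k = l + (m + m))%R.
Proof.
move=> e; have [m h] : exists m : int, (k - l = m + m)%R.
  by apply: chi_zeta; rewrite zetaD chiM e -chiM -zetaD subrr zeta0 chi1.
by exists m; rewrite -h addrC subrK.
Qed.

Let MT i : (i < 5)%N -> M (T i). Proof. by move=> h; rewrite TE; apply: MM; apply: Mb. Qed.

(** [pi_T] is the relation t_j^{b_i} = t_j^-1 written as a positive word, since [M] is only given to
    be closed under products. The central factor is an even power of [zeta 1] because [chi (T j)] is
    a value of [chi] on the centre and occurs twice in that word. *)
Let T_conj i j : (i < 5)%N -> (j < 5)%N -> i != j ->
  exists m : int, T j ^ b i = (T j)^-1 * zeta (m + m)%R.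
Proof.
move=> hi hj ij.
have [||k e] := M_fib _ _ (pi_T hi hj ij).
- by apply: MM; [apply: MM; [exact: MT|exact: Mb]|exact: MT].
- exact: Mb.
have [s hs] := chi_T hj.
have [m hm] : exists m : int, k = (m + m)%R.
  have := congr1 chi e; rewrite !chiM hs chi_zetaC -mulgA => /mulgI.
  rewrite -chiM -zetaD => /esym /chi_zeta_eq[m ->]; exists (s + m)%R; lia.
exists m; rewrite -hm.
by rewrite conjgE mulgA; apply: (mulIg (T j)); rewrite -!mulgA (zetaC k) mulKg
  (mulgA (T j)) e mulKg.
Qed.

(** Conjugation by [b i] inverts [T j] up to a central factor; done twice, it is conjugation by
    [T i], and the two factors cancel. *)
Let TC i j : (i < 5)%N -> (j < 5)%N -> T i * T j = T j * T i.
Proof.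
move=> hi hj; have [->//|ij] := eqVneq i j.
have [m h] := T_conj hi hj ij.
have : T j ^ T i = T j.
  rewrite (TE i) conjgM h conjMg conjVg h zetaJ invgM invgK.
  by rewrite -mulgA -zetaC mulKg.
by move=> e; rewrite [RHS]conjgC e.
Qed.

(* For V = [b_i, b_j], the last two hypotheses compute the two sides of
   V^{b_i} V = [T_i, b_j]. *)
Lemma central_ext_par i j k (Y : X) (q r : int) : (i < 5)%N -> (j < 5)%N ->
  i != j ->
  b i * b j * T i = b j * b i * Y * zeta k ->
  Y ^ b i = Y^-1 * zeta (q + q)%R -> Y * T i = T i * Y ->
  T i ^ b j = (T i)^-1 * zeta (r + r)%R -> (k + q = r)%R.
Proof.
move=> hi hj ij e Yb YT Tb.
have YTV : Y * (T i)^-1 = (T i)^-1 * Y.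
  by apply: (mulIg (T i)); rewrite mulgVK -mulgA YT mulKg.
have eV : [~ b i, b j] = Y * (T i)^-1 * zeta k.
  apply: (mulgI (b j * b i)); rewrite -commgC.
  by apply: (mulIg (T i)); rewrite e -!mulgA (zetaC k) mulKg.
have : [~ b i, b j] ^ b i * [~ b i, b j] = [~ T i, b j].
  by rewrite TE /commg !conjgE !invgM !mulgA !(mulgK, mulgVK).
have Tbi : T i ^ b i = T i by rewrite TE conjMg conjgE mulKg.
rewrite [RHS]commgEl Tb eV YTV 2!conjMg conjVg Tbi Yb zetaJ.
rewrite !(mulgA (T i)^-1) zMz zMM => h.
have {}h : (T i)^-1 * Y^-1 * ((T i)^-1 * Y) * zeta (q + q + k + k)%R =
    (T i)^-1 * (T i)^-1 * zeta (r + r)%R by [].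
move: h; rewrite -!mulgA => /mulgI.
rewrite (mulgA (T i)^-1) -YTV -mulgA mulKg => /mulgI /zeta_inj; lia.
Qed.

(** Conjugating [T j] by b_l b_l' contributes zeta(2m - 2m'), by b_l' b_l the inverse. As [W1], [W2]
    and the centre fix [T j], this forces 4(m - m') = 0 in a torsion-free kernel. *)
Lemma central_ext_indep l l' j W1 W2 k m m' : l != j ->
  b l * b l' * W1 = b l' * b l * W2 * zeta k ->
  T j ^ W1 = T j -> T j ^ W2 = T j ->
  T j ^ b l = (T j)^-1 * zeta (m + m)%R ->
  T j ^ b l' = (T j)^-1 * zeta (m' + m')%R -> m = m'.
Proof.
move=> lj e c1 c2 h h'.
have := congr1 (fun x => T j ^ x) e.
have c3 : T j ^ (zeta k) = T j by rewrite conjgE -zetaC mulKg.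
have J p q x y : T j ^ x = (T j)^-1 * zeta (p + p)%R ->
    T j ^ y = (T j)^-1 * zeta (q + q)%R ->
    T j ^ (x * y) = T j * zeta (p + p - (q + q))%R.
  move=> hx hy; rewrite conjgM hx conjMg conjVg hy zetaJ invgM invgK -zetaN.
  by rewrite zetaC zMz addrC.
rewrite !(conjgM _ (_ * _)) (J _ _ _ _ h h') (J _ _ _ _ h' h).
rewrite 2!(conjMg (T j)) !zetaJ c1 c2 (conjMg (T j)) zetaJ c3 => /mulgI /zeta_inj; lia.
Qed.

Let JV x y p : x ^ y = x^-1 * zeta (p + p)%R ->
  x^-1 ^ y = x^-1^-1 * zeta (- p - p)%R.
Proof. by move=> h; rewrite conjVg h invgM -zetaN zetaC opprD. Qed.

Let JM x x' y p q : x * x' = x' * x -> x ^ y = x^-1 * zeta (p + p)%R ->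
  x' ^ y = x'^-1 * zeta (q + q)%R ->
  (x * x') ^ y = (x * x')^-1 * zeta ((p + q) + (p + q))%R.
Proof.
move=> c h h'; rewrite conjMg h h' zMM c invgM; congr (_ * zeta _); lia.
Qed.

(** Let m_j be the common value of the [m i j], let chi(T_j) = chi(zeta s_j), and put a_j = s_j +
    m_j modulo 2. Then [adjE] and [adjP] give a_i + a_{i+1} + a_{i+2} = 1 for i = 0, 1, 2, so a_0 =
    a_3 and a_1 = a_4, while [farE] and [farP] give a_0 + a_1 + a_3 + a_4 = 1. *)
Lemma central_extension_absurd : False.
Proof.
have commT i j : (i < 5)%N -> (j < 5)%N -> T j ^ T i = T j.
  by move=> hi hj; rewrite conjgE (TC hj hi) mulKg.
have commTT i i' j : (i < 5)%N -> (i' < 5)%N -> (j < 5)%N -> T j ^ (T i * T i') = T j.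
  by move=> hi hi' hj; rewrite conjgM !commT.
have [m hm] : exists m : nat -> nat -> int, forall i j, (i < 5)%N -> (j < 5)%N -> i != j ->
    T j ^ b i = (T j)^-1 * zeta (m i j + m i j)%R.
  have /choice[m hm] : forall ij : nat * nat, exists m : int, (ij.1 < 5)%N -> (ij.2 < 5)%N ->
      ij.1 != ij.2 -> T ij.2 ^ b ij.1 = (T ij.2)^-1 * zeta (m + m)%R.
    move=> [i j] /=; case: (ltnP i 5) => hi; last by exists 0%R.
    case: (ltnP j 5) => hj; last by exists 0%R.
    case: (eqVneq i j) => ij; first by exists 0%R.
    by have [m hm] := T_conj hi hj ij; exists m.
  by exists (fun i j => m (i, j)) => i j; apply: (hm (i, j)).
have adj i : (i < 3)%N -> exists k, b i * b i.+1 * (T i * T i.+2) = b i.+1 * b i * T i.+1 * zeta k.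
  move=> hi; apply: M_fib (pi_adj hi).
    by apply: MM; apply: MM; do ?[apply: Mb|apply: MT]; lia.
  by apply: MM; [apply: MM|]; do ?[apply: Mb|apply: MT]; lia.
have [k0 e0] := adj 0%N isT; have [k1 e1] := adj 1%N isT; have [k2 e2] := adj 2%N isT.
have [k3 e3] : exists k, b 0 * b 3 * (T 0 * T 4) = b 3 * b 0 * (T 1 * T 3) * zeta k.
  apply: M_fib pi_far.
    by apply: MM; apply: MM; do ?[apply: Mb|apply: MT]; lia.
  by apply: MM; apply: MM; do ?[apply: Mb|apply: MT]; lia.
have I01 j : (j < 5)%N -> 0%N != j -> 1%N != j -> m 0%N j = m 1%N j.
  by move=> h5 h0 h1; apply: (central_ext_indep h0 e0); rewrite ?commTT ?commT ?hm.
have I12 j : (j < 5)%N -> 1%N != j -> 2%N != j -> m 1%N j = m 2%N j.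
  by move=> h5 h0 h1; apply: (central_ext_indep h0 e1); rewrite ?commTT ?commT ?hm.
have I23 j : (j < 5)%N -> 2%N != j -> 3%N != j -> m 2%N j = m 3%N j.
  by move=> h5 h0 h1; apply: (central_ext_indep h0 e2); rewrite ?commTT ?commT ?hm.
have I03 j : (j < 5)%N -> 0%N != j -> 3%N != j -> m 0%N j = m 3%N j.
  by move=> h5 h0 h1; apply: (central_ext_indep h0 e3); rewrite ?commTT ?commT ?hm.
have TVC i j : (i < 5)%N -> (j < 5)%N -> T i * (T j)^-1 = (T j)^-1 * T i.
  by move=> hi hj; apply: commuteV; apply: TC.
have adjE i k : (i < 3)%N ->
    b i * b i.+1 * (T i * T i.+2) = b i.+1 * b i * T i.+1 * zeta k ->
    (k + (m i i.+1 - m i i.+2) = m i.+1 i)%R.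
  move=> hi e; apply: (@central_ext_par i i.+1 k (T i.+1 * (T i.+2)^-1)).
  - lia.
  - lia.
  - lia.
  - by apply: (mulIg (T i.+2)); rewrite -[LHS]mulgA e -!mulgA (zetaC k) mulKg.
  - apply: JM; [by apply: TVC; lia|by apply: hm; lia|].
    by apply: JV; apply: hm; lia.
  - rewrite -mulgA -TVC; try lia.
    by rewrite !mulgA TC //; lia.
  - by apply: hm; lia.
have farE : (k3 + (m 0%N 1%N + (m 0%N 3%N - m 0%N 4%N)) = m 3%N 0%N)%R.
  apply: (@central_ext_par 0%N 3%N k3 (T 1 * (T 3 * (T 4)^-1))) => //.
  - by apply: (mulIg (T 4%N)); rewrite -[LHS]mulgA e3 -!mulgA (zetaC k3) mulKg.
  - apply: JM; [|exact: hm|apply: JM; [exact: TVC|exact: hm|]].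
      by rewrite mulgA TC // -!mulgA TVC.
    by apply: JV; apply: hm.
  - by rewrite -!mulgA -(TVC 0%N 4%N) // (mulgA (T 3)) TC // !mulgA TC.
  - exact: hm.
have /choice[s hs] : forall i, exists s, (i < 5)%N -> chi (T i) = chi (zeta s).
  move=> i; case: (ltnP i 5) => hi; last by exists 0%R.
  by have [s hs] := chi_T hi; exists s.
have adjP i k : (i < 3)%N ->
    b i * b i.+1 * (T i * T i.+2) = b i.+1 * b i * T i.+1 * zeta k ->
    exists l, (1 + s i + s i.+2 = s i.+1 + k + (l + l))%R.
  move=> hi /(congr1 chi); rewrite !chiM chi_b ?hs; try lia.
  by rewrite -!mulgA => /mulgI/mulgI; rewrite -!chiM -!zetaD addrA => /chi_zeta_eq.
have farP : exists l, (1 + s 0%N + s 4%N = s 1%N + s 3%N + k3 + (l + l))%R.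
  move: e3 => /(congr1 chi); rewrite !chiM chi_b ?hs; try lia.
  by rewrite -!mulgA => /mulgI/mulgI; rewrite -!chiM -!zetaD !addrA => /chi_zeta_eq.
have := adjE 0%N _ isT e0; have := adjE 1%N _ isT e1; have := adjE 2%N _ isT e2.
have [l0] := adjP 0%N _ isT e0; have [l1] := adjP 1%N _ isT e1; have [l2] := adjP 2%N _ isT e2.
have [l3] := farP; move: farE.
have := I01 2%N isT isT isT; have := I01 3%N isT isT isT; have := I01 4%N isT isT isT.
have := I12 0%N isT isT isT; have := I12 3%N isT isT isT; have := I12 4%N isT isT isT.
have := I23 0%N isT isT isT; have := I23 1%N isT isT isT; have := I23 4%N isT isT isT.
have := I03 1%N isT isT isT; have := I03 2%N isT isT isT; have := I03 4%N isT isT isT.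
lia.
Qed.
End CentralExtension.

Local Open Scope classical_set_scope.
Local Open Scope ring_scope.

(** * Gluing local sections over the boxes of a Euclidean space *)

Section Boxes.
Variables (R : realType) (n : nat).
Implicit Types (lo hi : 'I_n -> R) (x : 'cV[R]_n).

Definition box lo hi : set 'cV[R]_n := [set x | forall i, lo i <= x i 0 <= hi i].

Definition clamp lo hi x : 'cV[R]_n :=
  \col_i Num.min (hi i) (Num.max (lo i) (x i 0)).

Lemma col_cvg (T : Type) (F : set_system T) (f : T -> 'cV[R]_n) (l : 'cV[R]_n)
  {FF : Filter F} : (forall i, (fun t => f t i 0) @ F --> l i 0) -> f @ F --> l.
Proof.
move=> h A [P Pn PA].
have : \forall t \near F, forall i, P i 0 (f t i 0).
  by apply: filter_forall => i; apply: h; exact: Pn.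
by apply: filterS => t Pt; apply: PA => i j; rewrite ord1.
Qed.

Lemma col_continuous (T : topologicalType) (f : T -> 'cV[R]_n) :
  (forall i, continuous (fun t => f t i 0)) -> continuous f.
Proof. by move=> h t; apply: (@col_cvg _ (nbhs t)) => i; exact: h. Qed.

Lemma clamp_continuous lo hi : continuous (clamp lo hi).
Proof.
apply: col_continuous => i; under eq_fun => y do rewrite mxE.
move=> x; apply: (@continuous_min R _ (cst (hi i))
  (fun y : 'cV[R]_n => Num.max (lo i) (y i 0))); first exact: cst_continuous.
apply: (@continuous_max R _ (cst (lo i)) (fun y : 'cV[R]_n => y i 0)).
  exact: cst_continuous.
exact: coord_continuous.
Qed.

Lemma clamp_box lo hi x : (forall i, lo i <= hi i) -> box lo hi (clamp lo hi x).
Proof.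
by move=> h i; rewrite mxE le_min h le_max lexx ge_min lexx.
Qed.

Lemma clamp_id lo hi x : box lo hi x -> clamp lo hi x = x.
Proof.
move=> h; apply/colP => i; rewrite mxE; have /andP[h1 h2] := h i.
by rewrite (max_idPr h1) (min_idPr h2).
Qed.

Lemma closed_box lo hi : closed (box lo hi).
Proof.
have -> : box lo hi = \bigcap_(i in [set: 'I_n])
    ((fun x => x i 0) @^-1` [set y : R | lo i <= y <= hi i]).
  by apply/seteqP; split=> x h i; [move=> _; apply: h|apply: h].
apply: closed_bigI => i _; apply: preimage_closed; first by move=> x _; exact: coord_continuous.
rewrite (_ : [set y | _] = [set` `[lo i, hi i]]); first exact: interval_closed.
by apply/seteqP; split=> y /=; rewrite in_itv.
Qed.

Lemma compact_box lo hi : compact (box lo hi).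
Proof.
pose B := [set v : 'rV[R]_n | forall i, [set` `[lo i, hi i]] (v ord0 i)].
have cB : compact B.
  by apply: (@rV_compact R n (fun i => [set` `[lo i, hi i]])) => i; exact: segment_compact.
have -> : box lo hi = trmx @` B.
  apply/seteqP; split=> [x h|_ [v h <-] i].
    by exists x^T; [move=> i /=; rewrite mxE in_itv/=; exact: h|rewrite trmxK].
  by have := h i; rewrite /= in_itv mxE.
apply: continuous_compact => //; apply: continuous_subspaceT; apply: col_continuous => i.
under eq_fun => w do rewrite mxE.
exact: coord_continuous.
Qed.

Definition upd lo (i : 'I_n) (m : R) : 'I_n -> R := fun j => if j == i then m else lo j.

Section Sections.
Variables (E : Type) (C : set 'cV[R]_n -> ('cV[R]_n -> E) -> Prop).
Hypothesis C_ext : forall K s s', C K s -> (forall x, K x -> s x = s' x) -> C K s'.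
Hypothesis C_sub : forall K K' s, C K s -> K' `<=` K -> C K' s.
Hypothesis C_loc : forall x, exists2 e, 0 < e & exists s, C (ball x e) s.
(** Abstract form of the torsor property: where two sections are both defined they differ by a
    function, and composing this function with [r] extends it to all of [K2], where it corrects
    [s2]. Logarithms of a circle-valued map and sections of the SpinC-bundle are the two
    instances. *)
Hypothesis C_retract : forall (K1 K2 : set 'cV[R]_n) s1 s2 (r : 'cV[R]_n -> 'cV[R]_n),
  C K1 s1 -> C K2 s2 -> continuous r -> (forall x, K2 x -> K1 (r x) /\ K2 (r x)) ->
  exists2 s, C K2 s & forall x, K1 x -> K2 x -> r x = x -> s x = s1 x.
Hypothesis C_glue : forall K1 K2 s, closed K1 -> closed K2 ->
  C K1 s -> C K2 s -> C (K1 `|` K2) s.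
Hypothesis C_open : forall s, (forall x, exists2 e, 0 < e & C (ball x e) s) -> C setT s.

Let good lo hi := exists s, C (box lo hi) s.

(* A section over the second half is corrected along the retraction onto the
   common face, so that it agrees there with the section over the first half. *)
Lemma good_split lo hi i m : (forall j, lo j <= hi j) -> lo i <= m <= hi i ->
  good lo (upd hi i m) -> good (upd lo i m) hi -> good lo hi.
Proof.
move=> lh /andP[lm mh] [s1 C1] [s2 C2].
pose L := upd lo i m; pose H := upd hi i m.
have LH j : L j <= H j by rewrite /L /H /upd; case: ifP.
have [] := C_retract C1 C2 (@clamp_continuous L H).
  move=> x _; have h := clamp_box x LH.
  split=> j; have := h j; rewrite /L /H /upd; case: eqP => [->|_] // /andP[h1 h2].
    by rewrite h2 (le_trans lm h1).
  by rewrite h1 (le_trans h2 mh).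
move=> s C3 e.
exists (fun x => if x i 0 <= m then s1 x else s x).
apply: (@C_sub (box lo H `|` box L hi)); last first.
  move=> x h; case: (leP (x i 0) m) => xm; [left|right] => j; have := h j;
    rewrite /L /H /upd; case: eqP => [->|_] // /andP[h1 h2].
    by rewrite h1.
  by rewrite h2 ltW.
apply: C_glue; [exact: closed_box|exact: closed_box| |].
  apply: C_ext C1 _ => x h; have := h i.
  by rewrite /H /upd eqxx => /andP[_ ->].
apply: C_ext C3 _ => x h; case: ifP => // xm; apply: e => //.
- move=> j; have := h j; have := lh j; rewrite /L /upd; case: eqP => [->|_] // _.
  by case/andP => h1 _; rewrite xm (le_trans lm h1).
- apply: clamp_id => j; have := h j; rewrite /L /H /upd; case: eqP => [->|_] //.
  by case/andP => -> _; rewrite xm.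
Qed.

(** A Lebesgue number for the cover by balls carrying a section: a box with short enough sides lies
    in the ball about its lower corner. *)
Lemma good_small lo hi : exists2 e, 0 < e & forall lo' hi',
  box lo' hi' `<=` box lo hi -> (forall i, lo' i <= hi' i <= lo' i + e) -> good lo' hi'.
Proof.
have /compact_near_coveringP := @compact_box lo hi.
move=> /(_ R (0^'+) (fun e x => exists s, C (ball x e) s) _)[].
  move=> x _; have [e e0 [s Cs]] := C_loc x.
  exists (ball x (e / 2), [set d | d < e / 2]) => /=.
    split; first by apply: nbhsx_ballx; lra.
    by apply: nbhs_right_lt; lra.
  move=> [y d] /= [xy de]; exists s; apply: C_sub Cs _ => z yz.
  rewrite [e]splitr; apply: ball_triangle xy _.
  by apply: le_ball yz; exact: ltW.
move=> e /= e0 He.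
have /He h : ball 0 e (e / 2).
  by rewrite /ball/= sub0r normrN gtr0_norm; lra.
have {}h := h ltac:(by rewrite /=; lra).
exists (e / 4); first lra.
move=> lo' hi' sub w; pose a : 'cV[R]_n := \col_i lo' i.
have [|s Cs] := h a.
  by apply: sub => i; rewrite mxE lexx /=; case/andP: (w i).
exists s; apply: C_sub Cs _ => y yb; split; first lra.
move=> i j; rewrite ord1 /ball/= mxE distrC ger0_norm ?subr_ge0; last by case/andP: (yb i).
have := w i; have := yb i; lra.
Qed.

Lemma good_box lo hi : (forall i, lo i <= hi i) -> good lo hi.
Proof.
move=> lh; have [e e0 small] := good_small lo hi.
(* Only the sides of index below [k] may be longer than [e]; an inner induction on [m] cuts one such
   side into [m] slices of width [e]. *)
suff h k : (k <= n)%N -> forall lo' hi', box lo' hi' `<=` box lo hi ->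
    (forall i, lo' i <= hi' i) ->
    (forall i : 'I_n, (k <= i)%N -> hi' i <= lo' i + e) -> good lo' hi'.
  by apply: (h n) => // i; rewrite leqNgt ltn_ord.
elim: k => [|k IH] kn lo' hi' sub lh' w.
  by apply: small => // i; rewrite lh' w.
pose i := Ordinal kn.
have [m hm] : exists m : nat, hi' i <= lo' i + m%:R * e.
  exists (Num.bound ((hi' i - lo' i) / e)).
  rewrite -lerBlDl -ler_pdivrMr //; apply/ltW/archi_boundP.
  by rewrite divr_ge0 ?subr_ge0 // ltW.
elim: m lo' sub lh' w hm => [|m IHm] lo' sub lh' w hm.
  apply: IH => //; first exact: ltnW.
  move=> j; rewrite leq_eqVlt => /predU1P[kj|]; last exact: w.
  by have -> : j = i by [apply: val_inj]; move: hm; lra.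
have [h|h] := leP (hi' i) (lo' i + e).
  apply: IH => //; first exact: ltnW.
  move=> j; rewrite leq_eqVlt => /predU1P[kj|]; last exact: w.
  by have -> : j = i by [apply: val_inj].
apply: (@good_split lo' hi' i (lo' i + e)) => //; first lra.
- apply: IH; first exact: ltnW.
  + move=> x hx; apply: sub => j; have := hx j; have := lh' j.
    by rewrite /upd; case: eqP => [->|_] //; lra.
  + by move=> j; rewrite /upd; case: eqP => [->|_] //; lra.
  + move=> j; rewrite leq_eqVlt /upd => /predU1P[kj|kj].
      by have -> : j = i by [apply: val_inj]; rewrite eqxx.
    by case: eqP => [->|_]; [lra|exact: w].
- apply: IHm.
  + move=> x hx; apply: sub => j; have := hx j; have := lh' j.
    by rewrite /upd; case: eqP => [->|_] //; lra.
  + by move=> j; rewrite /upd; case: eqP => [->|_] //; lra.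
  + move=> j kj; rewrite /upd; case: eqP => [ji|_]; last exact: w.
    by move: kj; rewrite ji ltnn.
  + by rewrite /upd eqxx; move: hm; rewrite -natr1; lra.
Qed.

Let cube k := box (fun=> - k%:R) (fun=> k%:R).

(** The section over each cube is extended to the next without being changed, so the values
    stabilize at every point and no limit has to be taken. *)
Lemma global_section : exists s, C setT s.
Proof.
have k0 k : (- k%:R : R) <= k%:R by rewrite -subr_ge0 opprK -natrD ler0n.
have cubeS k l : (k <= l)%N -> cube k `<=` cube l.
  move=> kl x h i; have := h i; have : k%:R <= l%:R :> R by rewrite ler_nat.
  lra.
have step k s : C (cube k) s -> exists s', C (cube k.+1) s' /\ forall x, cube k x -> s' x = s x.
  move=> Cs; have [s2 C2] := good_box (fun i : 'I_n => k0 k.+1).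
  have [] := C_retract Cs C2 (@clamp_continuous (fun=> - k%:R) (fun=> k%:R)).
    move=> x _; have h : cube k (clamp (fun=> - k%:R) (fun=> k%:R) x).
      by apply: clamp_box => i; exact: k0.
    by split=> //; apply: cubeS h.
  move=> s' C' h'; exists s'; split=> // x cx; apply: h' => //; first exact: cubeS cx.
  exact: clamp_id.
pose S k := {s | C (cube k) s}.
pose next k (s : S k) : S k.+1 := let e := cid (step k _ (svalP s)) in exist _ (sval e) (svalP e).1.
have nextE k (s : S k) x : cube k x -> sval (next k s) x = sval s x.
  by move=> cx; rewrite /next/=; case: cid => s' [? h] /=; exact: h.
pose s0 : S 0%N := let e := cid (good_box (fun i : 'I_n => k0 0%N)) in exist _ (sval e) (svalP e).
pose f := fix f k : S k := if k is k'.+1 then next k' (f k') else s0.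
have fE k l x : (k <= l)%N -> cube k x -> sval (f l) x = sval (f k) x.
  move=> kl cx; rewrite -(subnKC kl); elim: (l - k)%N => [|d IH]; first by rewrite addn0.
  by rewrite addnS [f _]/= nextE ?IH//; apply: cubeS cx; rewrite leq_addr.
have /boolp.choice[bnd hbnd] : forall x : 'cV[R]_n, exists m : nat, forall i, `|x i 0| <= m%:R.
  move=> x; exists (\max_i Num.bound `|x i 0%R|) => i.
  apply: (le_trans (ltW (archi_boundP _))) => //.
  by rewrite ler_nat (leq_bigmax i).
have big x : exists k, cube k x.
  by exists (bnd x) => i; rewrite -ler_norml; exact: hbnd.
pose N x := sval (cid (big x)).
have NP x : cube (N x) x := svalP (cid (big x)).
exists (fun x => sval (f (N x)) x); apply: C_open => x; exists 1 => //.
have [k hk] : exists k, ball x 1 `<=` cube k.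
  exists (bnd x).+1 => y [_ xy] i; have := xy i 0; have := hbnd x i.
  rewrite /ball/= -natr1 ler_norml ltr_norml; lra.
apply: C_sub hk; apply: C_ext (svalP (f k)) _ => y cy.
by case: (leqP k (N y)) => h; [rewrite (fE _ _ _ h)|rewrite (fE _ _ _ (ltnW h))].
Qed.
End Sections.
End Boxes.

(** * The Clifford algebra and the kernel of the spin covering *)

Section CliffordAlgebra.
Variables (R : realType) (n : nat).
Local Notation cl := (clifford R n).
Implicit Types (x y : cl) (v w : 'cV[R]_n) (S T U : {set 'I_n}).

Definition cl_e (i : 'I_n) : cl := cl_vec (delta_mx i 0).

Lemma cl_eE i S : cl_e i S = (S == [set i]%SET)%:R.
Proof.
rewrite /cl_e /cl_vec (bigD1 i)//= mxE !eqxx mul1r big1 ?addr0// => j ji.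
by rewrite mxE (negbTE ji) mul0r.
Qed.

Lemma cl_vec_sum v : cl_vec v = \sum_i v i 0 *: cl_e i.
Proof.
apply/funext => S; rewrite /cl_vec; elim/big_rec2: _ => //= i x f _ ->.
by rewrite cl_addE cl_scaleE cl_eE.
Qed.

Lemma cl_eM i y U :
  (cl_e i * y) U = cl_sign R [set i]%SET (symdiff [set i]%SET U) * y (symdiff [set i]%SET U).
Proof.
rewrite cl_mulE (bigD1 [set i]%SET)//= big1 => [|S Si].
  by rewrite cl_eE eqxx mulr1 addr0.
by rewrite cl_eE (negbTE Si) mulr0 mul0r.
Qed.

Lemma cl_Me i y U :
  (y * cl_e i) U = cl_sign R (symdiff [set i]%SET U) [set i]%SET * y (symdiff [set i]%SET U).
Proof.
have sU : symdiff (symdiff [set i]%SET U) U = [set i]%SET.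
  by rewrite symdiffC (symdiffC _ U) symdiffK.
rewrite cl_mulE (bigD1 (symdiff [set i]%SET U))//= big1 => [|S Si].
  by rewrite sU cl_eE eqxx mulr1 addr0.
rewrite cl_eE; case: eqP => [e|]; last by rewrite mulr0.
by case/eqP: Si; rewrite -e symdiffC (symdiffC S) symdiffK.
Qed.

Lemma odd_card_symdiff1 i U : odd #|symdiff [set i]%SET U| = ~~ odd #|U|.
Proof.
have -> : symdiff [set i]%SET U = if i \in U then (U :\ i)%SET else (i |: U)%SET.
  apply/setP => j; case: ifP => iU; rewrite in_symdiff !inE;
  by case: (eqVneq j i) => [->|_] //=; rewrite ?iU.
case: ifP => iU; last by rewrite cardsU1 iU.
by rewrite (cardsD1 i U) iU /= negbK.
Qed.

(** e_i anticommutes with every other e_t and squares to -1. This sign rule is what allows averaging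
    over the e_i to isolate the scalar part. *)
Lemma cl_e_conj i y T :
  (cl_e i * y * cl_e i) T = - (-1) ^+ #|(T :\ i)%SET| * y T.
Proof.
rewrite cl_Me cl_eM symdiffK mulrA; congr (_ * _).
rewrite cl_signl mulrC mulrA.
have -> : cl_sign R [set i]%SET T * cl_sign R [set i]%SET [set i]%SET =
   - cl_sign R [set i]%SET T by rewrite {2}/cl_sign !big_set1 leqnn mulrN1.
rewrite mulNr; congr (- _).
rewrite /cl_sign big_set1.
rewrite [X in _ * X](_ : _ = \prod_(t in T) (if (i <= t)%N then -1 else 1)); last first.
  by apply: eq_bigr => t _; rewrite big_set1.
rewrite -big_split/= (bigID (fun t => t == i))/= big1 ?mul1r => [|t /andP[_ /eqP->]].
  rewrite (eq_bigl (mem (T :\ i)%SET)) => [|t]; last by rewrite !inE andbC.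
  rewrite (eq_bigr (fun=> -1)) ?prodr_const // => t; rewrite !inE => /andP[ti _].
  by case: (ltngtP t i) => //; rewrite ?(mulr1, mul1r) // => /val_inj e; rewrite e eqxx in ti.
by rewrite leqnn mulrNN mulr1.
Qed.

Definition cl_par (b : bool) y := forall T, odd #|T| != b -> y T = 0.

Lemma cl_par_vec b v y : cl_par b y -> cl_par (~~ b) (cl_vec v * y).
Proof.
move=> h T hT; rewrite cl_vec_sum mulr_suml.
elim/big_rec: _ => [//|i x _ hx]; rewrite cl_addE hx addr0.
rewrite -scalerAl cl_scaleE cl_eM h ?mulr0 // odd_card_symdiff1.
by case: (odd _) hT; case: b h.
Qed.

Lemma cl_par1 : cl_par false 1.
Proof.
move=> T hT; rewrite -[LHS]/((T == finset.set0)%:R).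
by case: (eqVneq T finset.set0) hT => [->|//]; rewrite cards0.
Qed.

Lemma cl_par_prod (s : seq 'cV[R]_n) : cl_par (odd (size s)) (\prod_(v <- s) cl_vec v).
Proof.
elim: s => [|v s IH]; first by rewrite big_nil; exact: cl_par1.
by rewrite big_cons; exact: cl_par_vec.
Qed.

Definition cl_dot x y : R := \sum_S x S * y S.

Lemma cl_dotE_adj i x y : cl_dot (cl_e i * x) y = - cl_dot x (cl_e i * y).
Proof.
rewrite /cl_dot -sumrN [LHS](reindex_inj (inv_inj (symdiffK [set i]%SET)))/=.
apply: eq_bigr => S _; rewrite !cl_eM symdiffK cl_signr.
rewrite {2}/cl_sign !big_set1 leqnn; ring.
Qed.

Lemma cl_dotDl x x' y : cl_dot (x + x') y = cl_dot x y + cl_dot x' y.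
Proof. by rewrite /cl_dot -big_split; apply: eq_bigr => S _; rewrite cl_addE mulrDl. Qed.
Lemma cl_dotZl a x y : cl_dot (a *: x) y = a * cl_dot x y.
Proof. by rewrite /cl_dot mulr_sumr; apply: eq_bigr => S _; rewrite cl_scaleE mulrA. Qed.
Lemma cl_dotC x y : cl_dot x y = cl_dot y x.
Proof. by apply: eq_bigr => S _; rewrite mulrC. Qed.
Lemma cl_dotNr x y : cl_dot x (- y) = - cl_dot x y.
Proof. by rewrite -(scaleN1r y) cl_dotC cl_dotZl mulN1r cl_dotC. Qed.
Lemma cl_dot_suml (I : finType) (F : I -> cl) y :
  cl_dot (\sum_i F i) y = \sum_i cl_dot (F i) y.
Proof.
elim/big_rec2: _ => [|i a b _ <-]; last by rewrite cl_dotDl.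
by rewrite -(scale0r (0 : cl)) cl_dotZl mul0r.
Qed.

(** Since unit vectors square to -1, skew-adjointness makes left multiplication by spin elements
    isometric; a scalar multiple of a spin element then has its factor determined up to sign by its
    norm. *)
Lemma cl_dot_vec v x y : cl_dot (cl_vec v * x) y = - cl_dot x (cl_vec v * y).
Proof.
rewrite cl_vec_sum mulr_suml cl_dot_suml mulr_suml [in RHS]cl_dotC cl_dot_suml -sumrN.
apply: eq_bigr => i _; rewrite -!scalerAl !cl_dotZl cl_dotE_adj mulrN.
by rewrite [in RHS]cl_dotC.
Qed.

Lemma cl_dot_spin (x y z : cl) : spin_set x -> cl_dot (x * y) (x * z) = cl_dot y z.
Proof.
move=> [s [us _ ->]]; elim: s us => [|v s IH] us; first by rewrite big_nil !mul1r.
rewrite big_cons -!mulrA cl_dot_vec mulrA cl_vec_unit; last exact/us/mem_head.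
rewrite mulN1r cl_dotNr opprK IH // => w ws.
by apply: us; rewrite inE ws orbT.
Qed.

Lemma cl_one_coord S : (1 : cl) S = (S == finset.set0)%:R.
Proof. by []. Qed.

Lemma cl_dot_one x : cl_dot x 1 = x finset.set0.
Proof.
rewrite /cl_dot (bigD1 finset.set0)//= big1 => [|S S0].
  by rewrite cl_one_coord eqxx mulr1 addr0.
by rewrite cl_one_coord (negbTE S0) mulr0.
Qed.

Lemma spin_norm x : spin_set x -> cl_dot x x = 1.
Proof.
by move=> hx; rewrite -[x]mulr1 cl_dot_spin // cl_dot_one cl_one_coord eqxx.
Qed.

(* If g covers A, then A(e_i) g = g e_i turns each step of the fold into
   g times an averaging of g^-1 by e_i, and all these averagings together leave
   of an even element only its scalar part: this is g up to a scalar factor, given by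
   a polynomial formula in A. *)
Definition cl_lift (A : 'M[R]_n) : cl :=
  foldr (fun i x => 2^-1 *: (x - cl_vec (col i A) * x * cl_e i)) 1 (enum 'I_n).

Lemma spin_val_par (g : Spin R n) : cl_par false (spin_val g).
Proof.
have [s [_ /negbTE es e]] := rg_valP g; rewrite /spin_val e -es; exact: cl_par_prod.
Qed.

Lemma spin_valK (g : Spin R n) : spin_val g * spin_val g^-1%g = 1.
Proof. exact: (rg_invE g).2. Qed.

Lemma cl_lift_spin (g : Spin R n) :
  cl_lift (so_mx (spin_cover g)) = spin_val g^-1%g finset.set0 *: spin_val g.
Proof.
pose av i (y : cl) : cl := 2^-1 *: (y - cl_e i * y * cl_e i).
have avT i y T : av i y T = 2^-1 * (y T + (-1) ^+ #|(T :\ i)%SET| * y T).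
  rewrite /av cl_scaleE; congr (_ * _).
  by rewrite -[LHS]/(y T - (cl_e i * y * cl_e i) T) cl_e_conj mulNr opprK.
(* When T has even size, T minus i has odd size exactly if i is in T: on even elements [av i] is the
   projection that kills the e_T with i in T. *)
have avE y l : cl_par false y -> forall T,
    foldr av y l T = if has (mem T) l then 0 else y T.
  move=> ey T; elim: l => [//|i l IH] /=.
  rewrite avT IH.
  case: (boolP (odd #|T|)) => hT.
    by rewrite (ey T) ?hT // !if_same !mulr0 addr0 mulr0.
  case: (boolP (i \in T)) => iT /=.
    by rewrite (cardsD1 i T) iT /= negbK in hT; rewrite -signr_odd hT; case: ifP => _; lra.
  have -> : (T :\ i)%SET = T.
    apply/setP => j; rewrite !inE; case: eqP => // ->; by rewrite (negbTE iT).
  by rewrite -signr_odd (negbTE hT); case: ifP => _; lra.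
set A := so_mx _; pose F (i : 'I_n) (x : cl) : cl := 2^-1 *: (x - cl_vec (col i A) * x * cl_e i).
have liftE l : foldr F 1 l = spin_val g * foldr av (spin_val g^-1%g) l.
  elim: l => [|i l IH]; first by rewrite /= spin_valK.
  rewrite [LHS]/= IH /F /= /av -scalerAr mulrBr; congr (_ *: (_ - _)).
  by rewrite !mulrA colE -spin_coverP.
rewrite -[LHS]/(foldr F 1 (enum 'I_n)) liftE.
have -> : foldr av (spin_val g^-1%g) (enum 'I_n) = spin_val g^-1%g finset.set0 *: 1.
  apply/funext => T; rewrite avE; last exact: spin_val_par.
  rewrite cl_scaleE cl_one_coord; case: (eqVneq T finset.set0) => [->|/finset.set0Pn[i iT]].
    rewrite mulr1; case: hasP => [[i _]|_ //]; by rewrite -[mem _ _]/(i \in _) finset.in_set0.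
  by rewrite mulr0; case: hasP => // h; case: h; exists i; rewrite ?mem_enum.
by rewrite -scalerAr mulr1.
Qed.

Lemma spin_coverP_uniq (g : Spin R n) (A : 'M[R]_n) :
  (forall w, spin_val g * cl_vec w = cl_vec (A *m w) * spin_val g) ->
  so_mx (spin_cover g) = A.
Proof.
move=> h; apply/matrixP => i j.
have e : cl_vec (so_mx (spin_cover g) *m delta_mx j 0) = cl_vec (A *m delta_mx j 0) :> cl.
  have := h (delta_mx j 0); rewrite spin_coverP => /(congr1 (fun x => x * spin_val g^-1%g)).
  by rewrite -!mulrA spin_valK !mulr1.
have := congr1 (fun x : cl => x [set i]%SET) e.
by rewrite !cl_vec_coord -!colE !mxE.
Qed.

Lemma spin_cover1 : spin_cover (1%g : Spin R n) = 1%g.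
Proof. by apply: (mulgI (spin_cover 1%g)); rewrite -spin_coverM !mulg1. Qed.

Lemma sqr1_sign (c : R) : c * c = 1 -> c = 1 \/ c = -1.
Proof.
move=> h; have /eqP : (c - 1) * (c + 1) = 0 by rewrite mulrDr !mulrBl h; ring.
by rewrite mulf_eq0 subr_eq0 addr_eq0 => /orP[]/eqP; [left|right].
Qed.

(** [cl_lift] sees only the matrix, so its values computed from g and from 1 agree: c g = 1 for a
    scalar c, and comparing norms leaves only c = 1 or c = -1. *)
Lemma spin_kernel (g : Spin R n) : spin_cover g = 1%g ->
  spin_val g = 1 \/ spin_val g = -1.
Proof.
move=> hg; have := cl_lift_spin g; rewrite hg -spin_cover1 cl_lift_spin.
rewrite invg1 -[spin_val 1%g]/(1 : cl) cl_one_coord eqxx scale1r.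
set c := spin_val _ _ => e.
have h : spin_val g = c *: 1.
  apply/esym; rewrite {1}e scalerA; suff -> : c * c = 1 by rewrite scale1r.
  have := spin_norm (rg_valP g) => h1.
  have : cl_dot (1 : cl) 1 = 1 by rewrite cl_dot_one cl_one_coord eqxx.
  by rewrite e cl_dotZl cl_dotC cl_dotZl h1 mulr1.
have := spin_norm (rg_valP g); rewrite -[rg_val g]/(spin_val g) h cl_dotZl cl_dotC cl_dotZl.
rewrite cl_dot_one cl_one_coord eqxx mulr1 => /sqr1_sign[->|->]; [left|right].
  exact: scale1r.
exact: scaleN1r.
Qed.
End CliffordAlgebra.

(** * Reflections and the surjectivity of the spin covering *)

Section Reflections.
Variables (R : realType) (n : nat).
Local Notation cl := (clifford R n).
Implicit Types (x y : cl) (u v w : 'cV[R]_n) (A : 'M[R]_n).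

Definition cdot u w : R := (u^T *m w) 0 0.

Lemma cdotC u w : cdot u w = cdot w u.
Proof. by rewrite /cdot !mxE; apply: eq_bigr => i _; rewrite !mxE mulrC. Qed.
Lemma cdotBl u v w : cdot (u - v) w = cdot u w - cdot v w.
Proof. by rewrite /cdot linearB/= mulmxBl !mxE. Qed.
Lemma cdotZl a v w : cdot (a *: v) w = a * cdot v w.
Proof. by rewrite /cdot linearZ/= -scalemxAl mxE. Qed.
Lemma cdot_orth A u w : A^T *m A = 1%:M -> cdot (A *m u) (A *m w) = cdot u w.
Proof. by move=> h; rewrite /cdot trmx_mul mulmxA -(mulmxA u^T) h mulmx1. Qed.
Lemma cdot_delta (i j : 'I_n) : cdot (delta_mx i 0) (delta_mx j 0) = (i == j)%:R.
Proof.
by rewrite /cdot trmx_delta mul_delta_mx_cond; case: eqP; rewrite ?mulr1n ?mulr0n !mxE.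
Qed.
Lemma cdot_gt0 u : u != 0 -> 0 < cdot u u.
Proof.
move=> u0; have e : cdot u u = \sum_i u i 0 ^+ 2.
  by rewrite /cdot !mxE; apply: eq_bigr => i _; rewrite !mxE expr2.
rewrite e lt_neqAle sumr_ge0 ?andbT => [|i _]; last exact: sqr_ge0.
apply: contra u0 => /eqP/esym/eqP; rewrite psumr_eq0 => [/allP h|i _]; last exact: sqr_ge0.
by apply/eqP/colP => i; have /= := h i (mem_index_enum i); rewrite sqrf_eq0 mxE => /eqP.
Qed.
Lemma unit_vecP u : cdot u u = 1 -> unit_vec u.
Proof.
by move=> h; rewrite /unit_vec; apply/matrixP => i j; rewrite !ord1 -[LHS]/(cdot u u) h mxE.
Qed.

Definition reflection v : 'M[R]_n := 1%:M - 2 *: (v *m v^T).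

Lemma reflectionE v w : reflection v *m w = w - (2 * cdot v w) *: v.
Proof.
rewrite /reflection mulmxBl mul1mx -scalemxAl -mulmxA (mx11_scalar (v^T *m w)).
by rewrite mul_mx_scalar scalerA.
Qed.

Lemma reflectionK v : unit_vec v -> reflection v *m reflection v = 1%:M.
Proof.
move=> v1; rewrite {1}/reflection mulmxBl mul1mx -scalemxAl -mulmxA.
have -> : v^T *m reflection v = - v^T.
  rewrite /reflection mulmxBr mulmx1 -scalemxAr mulmxA v1 mul1mx.
  by rewrite scaler_nat mulr2n opprD addrA subrr sub0r.
by rewrite mulmxN scalerN opprK /reflection subrK.
Qed.

Lemma tr_reflection v : (reflection v)^T = reflection v.
Proof. by rewrite /reflection linearB linearZ/= trmx1 trmx_mul trmxK. Qed.

Lemma cl_vec_reflection v w : unit_vec v ->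
  cl_vec v * cl_vec w = - (cl_vec (reflection v *m w) * cl_vec v) :> cl.
Proof.
move=> v1; rewrite reflectionE cl_vecD cl_vecN cl_vecZ mulrDl mulNr -scalerAl.
rewrite cl_vec_unit // scalerN opprK opprD.
have := clifford_relation v w; rewrite -/(cdot v w) mulNr scaleNr => /eqP.
by rewrite -subr_eq0 opprK => /eqP h; apply/eqP; rewrite -subr_eq0 opprD !opprK addrA h.
Qed.

Definition reflections (s : seq 'cV[R]_n) : 'M[R]_n :=
  foldr (fun v A => reflection v *m A) 1%:M s.

Lemma cl_vec_reflections s w : (forall v, v \in s -> unit_vec v) ->
  (\prod_(v <- s) cl_vec v) * cl_vec w =
  (-1) ^+ size s *: (cl_vec (reflections s *m w) * \prod_(v <- s) cl_vec v) :> cl.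
Proof.
elim: s => [|v s IH] us; first by rewrite big_nil mul1r mulr1 mul1mx scale1r.
rewrite !big_cons -mulrA IH => [|u hu]; last by apply: us; rewrite inE hu orbT.
rewrite -scalerAr (mulrA (cl_vec v)) cl_vec_reflection; last exact/us/mem_head.
by rewrite /= exprS mulN1r scaleNr mulNr scalerN mulmxA mulrA.
Qed.

(** The reflection along A e_k - e_k takes A e_k to e_k, both being unit vectors, and keeps the
    later basis vectors: these are fixed by A, hence orthogonal to A e_k - e_k. *)
Lemma cartan_dieudonne A : A^T *m A = 1%:M ->
  exists2 s, (forall v, v \in s -> unit_vec v) & A = reflections s.
Proof.
suff main k : (k <= n)%N -> forall A,
    (forall j : 'I_n, (k <= j)%N -> A *m delta_mx j 0 = delta_mx j 0 :> 'cV_n) ->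
    A^T *m A = 1%:M ->
    exists2 s, (forall v, v \in s -> unit_vec v) & A = reflections s.
  by apply: (main n) => // j nj; move: (ltn_ord j); rewrite ltnNge nj.
elim: k => [|k IH] kn {}A fixA oA.
  exists [::] => //; apply/matrixP => i j.
  by have /colP/(_ i) := fixA j isT; rewrite -colE /= !mxE andbT.
pose ek : 'cV[R]_n := delta_mx (Ordinal kn) 0; pose u := A *m ek - ek.
have [u0|u0] := eqVneq u 0.
  apply: (IH (ltnW kn)) => // j.
  rewrite leq_eqVlt => /predU1P[kj|]; last exact: fixA.
  have -> : j = Ordinal kn by apply: val_inj.
  by apply/eqP; rewrite -subr_eq0; apply/eqP.
have q0 := cdot_gt0 u0; set q := cdot u u in q0.
pose v := (Num.sqrt q)^-1 *: u.
have vw w : reflection v *m w = w - (2 * cdot u w / q) *: u.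
  rewrite reflectionE /v cdotZl scalerA; congr (_ - _ *: _).
  rewrite -[in RHS](sqr_sqrtr (ltW q0)) expr2 invfM; ring.
have v1 : unit_vec v.
  apply: unit_vecP; rewrite /v cdotZl cdotC cdotZl -/q -{3}(sqr_sqrtr (ltW q0)).
  by rewrite expr2; field; rewrite sqrtr_eq0 -ltNge.
have [|| s us e] := IH (ltnW kn) (reflection v *m A).
- move=> j; rewrite leq_eqVlt -mulmxA vw => /predU1P[kj|kj].
    have -> : j = Ordinal kn by apply: val_inj.
    rewrite -/ek; have -> : 2 * cdot u (A *m ek) / q = 1.
      have e1 : cdot u (A *m ek) = 1 - cdot ek (A *m ek).
        by rewrite /u cdotBl cdot_orth // cdot_delta eqxx.
      have e2 : q = 2 * cdot u (A *m ek).
        rewrite /q {1}/u cdotBl (cdotC _ u) (cdotC _ u).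
        have -> : cdot u ek = - cdot u (A *m ek).
          by rewrite e1 /u cdotBl (cdotC _ ek) cdot_delta eqxx mulr1n opprB.
        ring.
      by rewrite -e2 divff // gt_eqF.
    by rewrite scale1r /u opprB addrC subrK.
  have jk : (Ordinal kn == j) = false by apply/eqP => e; rewrite -e ltnn in kj.
  rewrite fixA //; have -> : cdot u (delta_mx j 0) = 0.
    by rewrite /u cdotBl cdot_delta jk -{1}(fixA j kj) cdot_orth // cdot_delta jk subr0.
  by rewrite mulr0 mul0r scale0r subr0.
- by rewrite trmx_mul tr_reflection mulmxA -(mulmxA A^T) reflectionK // mulmx1.
exists (v :: s) => [w|].
  by rewrite inE => /predU1P[->|/us].
by rewrite /= -e mulmxA reflectionK // mul1mx.
Qed.

Lemma cl_prod_e (l : seq 'I_n) k :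
  (\prod_(i <- l) cl_e R i) * cl_e R k =
  (-1) ^+ count (predC1 k) l *: (cl_e R k * \prod_(i <- l) cl_e R i).
Proof.
elim: l => [|i l IH]; first by rewrite big_nil mul1r mulr1 scale1r.
rewrite !big_cons -mulrA IH -scalerAr !mulrA /= exprD mulrC -scalerA; congr (_ *: _).
have [->|ik] := eqVneq i k; first by rewrite scale1r.
rewrite expr1 scaleN1r -mulNr; congr (_ * _).
have := clifford_relation (delta_mx i 0) (delta_mx k 0 : 'cV[R]_n).
rewrite -/(cdot _ _) cdot_delta (negbTE ik) mulr0 scale0r => /eqP.
by rewrite addr_eq0 => /eqP.
Qed.

Lemma cl_e_unit (i : 'I_n) : unit_vec (delta_mx i 0 : 'cV[R]_n).
Proof. by apply: unit_vecP; rewrite cdot_delta eqxx. Qed.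

Lemma spin_exists (s : seq 'cV[R]_n) : (forall v, v \in s -> unit_vec v) -> ~~ odd (size s) ->
  exists g : Spin R n, spin_val g = \prod_(v <- s) cl_vec v.
Proof.
move=> us es; have h : spin_set (\prod_(v <- s) cl_vec v : cl) by exists s.
by exists (@rg_mk _ (spin_group R n) _ h).
Qed.

Lemma spin_exists_e (l : seq 'I_n) : ~~ odd (size l) ->
  exists g : Spin R n, spin_val g = \prod_(i <- l) cl_e R i.
Proof.
move=> el; have [|| g e] := @spin_exists [seq delta_mx i 0 | i <- l].
- by move=> v /mapP[i _ ->]; exact: cl_e_unit.
- by rewrite size_map.
by exists g; rewrite e big_map.
Qed.

Hypothesis n_odd : odd n.

Lemma spin_cover_surj (A : SO R n) : exists g, spin_cover g = A.
Proof.
have [oA dA] := rg_valP A; have [s us e] := cartan_dieudonne oA.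
have [os|es] := boolP (odd (size s)); last first.
  have [g eg] := spin_exists us es; exists g; apply: rg_val_inj; apply: spin_coverP_uniq => w.
  by rewrite eg cl_vec_reflections // -signr_odd (negbTE es) scale1r -e.
(* For n odd, the product of all the e_i is central and has odd parity: it
   corrects the parity of s, and -A has determinant -1. *)
pose om := [seq delta_mx i 0 : 'cV[R]_n | i <- enum 'I_n].
have [v||g eg] := @spin_exists (s ++ om).
- by rewrite mem_cat => /orP[/us//|/mapP[i _ ->]]; exact: cl_e_unit.
- by rewrite size_cat size_map size_enum_ord oddD os n_odd.
have : so_mx (spin_cover g) = - rg_val A.
  apply: spin_coverP_uniq => w; rewrite eg big_cat /=.
  have -> : \prod_(v <- om) cl_vec v = \prod_(i <- enum 'I_n) cl_e R i :> cl.
    by rewrite big_map.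
  rewrite -mulrA.
  have -> : (\prod_(i <- enum 'I_n) cl_e R i) * cl_vec w =
     cl_vec w * (\prod_(i <- enum 'I_n) cl_e R i).
    rewrite cl_vec_sum mulr_suml mulr_sumr; apply: eq_bigr => k _.
    rewrite -scalerAr -scalerAl cl_prod_e; congr (_ *: _).
    have := count_predC (pred1 k) (enum 'I_n).
    rewrite size_enum_ord count_uniq_mem ?enum_uniq // mem_enum /= => en.
    have ec : odd (count (predC1 k) (enum 'I_n)) = false.
      by move: (n_odd); rewrite -[in odd n]en /= => /negbTE.
    by rewrite -signr_odd ec scale1r.
  rewrite mulrA cl_vec_reflections // -signr_odd os scaleN1r mulNmx cl_vecN.
  by rewrite -e !mulNr mulrA.
have [_ dg] := rg_valP (spin_cover g); rewrite /so_mx => h.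
move: dg; rewrite h -scaleN1r detZ dA mulr1 -signr_odd n_odd => /eqP.
by rewrite eq_sym -addr_eq0 (_ : 1 + 1 = 2%:R) // pnatr_eq0.
Qed.

Lemma spin_cover_unique (g h : Spin R n) : spin_cover g = spin_cover h ->
  spin_val g = spin_val h \/ spin_val g = - spin_val h.
Proof.
move=> e; have e1 : spin_cover (g * h^-1)%g = 1%g.
  rewrite spin_coverM e -spin_coverM mulgV.
  exact: spin_cover1.
have {}e1 := spin_kernel e1.
have -> : spin_val g = spin_val (g * h^-1)%g * spin_val h.
  by rewrite -[RHS]/(spin_val (g * h^-1 * h)%g) mulgVK.
by case: e1 => ->; rewrite ?mul1r ?mulN1r; [left|right].
Qed.

Definition hw_list (i : 'I_n) := [seq k <- enum 'I_n | k != i].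

Lemma size_hw_list i : (size (hw_list i)).+1 = n.
Proof.
rewrite size_filter -[RHS](size_enum_ord n) -(count_predC (pred1 i)) count_uniq_mem ?enum_uniq //.
by rewrite mem_enum.
Qed.

Lemma count_hw_list i k : (count (predC1 k) (hw_list i) + (k != i)).+1 = n.
Proof.
rewrite -[RHS](size_hw_list i) -(count_predC (pred1 k)) addnC.
by rewrite (count_uniq_mem _ (filter_uniq _ (enum_uniq _))) mem_filter mem_enum andbT.
Qed.

Lemma hw_rotationE (i k : 'I_n) w :
  (hw_rotation R i *m w) k 0 = (if k == i then 1 else -1) * w k 0.
Proof. by rewrite /hw_rotation mul_diag_mx !mxE. Qed.

(** E_i is the product of the n - 1 vectors e_k with k different from i. Moving e_k through E_i
    costs n - 1 signs if k = i and n - 2 otherwise, so E_i covers B_i when n is odd. Moving E_i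
    through E_j costs a sign for each of the n - 1 factors of E_j except e_i, an odd number. *)
Lemma hw_lift : exists E : 'I_n -> Spin R n,
  [/\ forall i, so_mx (spin_cover (E i)) = hw_rotation R i
    & forall i j, i != j -> spin_val (E i) * spin_val (E j) = - (spin_val (E j) * spin_val (E i))].
Proof.
have el i : ~~ odd (size (hw_list i)).
  by move: n_odd; rewrite -{1}(size_hw_list i).
have /boolp.choice[E hE] := fun i => spin_exists_e (el i).
have Ee i k : spin_val (E i) * cl_e R k = (if k == i then 1 else -1) *: (cl_e R k * spin_val (E i)).
  rewrite hE cl_prod_e; congr (_ *: _); rewrite -signr_odd.
  move: n_odd; rewrite -{1}(count_hw_list i k) /= oddD oddb negb_add.
  by case: (k == i) => /= /eqP ->.
exists E; split=> [i|i j ij].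
  apply: spin_coverP_uniq => w; rewrite !cl_vec_sum mulr_sumr mulr_suml.
  apply: eq_bigr => k _; rewrite hw_rotationE -scalerAr Ee -scalerAl scalerA.
  by rewrite mulrC.
have h l : spin_val (E i) * \prod_(k <- l) cl_e R k =
    (-1) ^+ count (predC1 i) l *: (\prod_(k <- l) cl_e R k * spin_val (E i)).
  elim: l => [|k l IH]; first by rewrite !big_nil mulr1 mul1r scale1r.
  rewrite !big_cons mulrA Ee -scalerAl -!mulrA IH -scalerAr scalerA /= exprD.
  by congr (_ * _ *: _); case: (k == i).
rewrite (hE j) h -[RHS]scaleN1r -signr_odd; congr (_ *: _).
by move: n_odd; rewrite -{1}(count_hw_list j i) ij addn1 /= negbK => ->.
Qed.
End Reflections.

(** * Local continuous lifts to the spin group *)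

Section CliffordConvergence.
Variables (R : realType) (n : nat) (T : Type) (F : set_system T) (FF : Filter F).
Local Notation cl := (clifford R n).
Implicit Types (f g : T -> cl) (l m : cl).

Definition cl_cvg f l := forall S, (fun t => f t S : R) @ F --> (l S : R).

Lemma cl_cvg_cst l : cl_cvg (fun=> l) l.
Proof. by move=> S; exact: cvg_cst. Qed.

Lemma cl_cvgD f g l m : cl_cvg f l -> cl_cvg g m -> cl_cvg (fun t => f t + g t) (l + m).
Proof. by move=> hf hg S; apply: cvgD; [exact: hf|exact: hg]. Qed.

Lemma cl_cvgZ (a : T -> R) (b : R) f l : a @ F --> b -> cl_cvg f l ->
  cl_cvg (fun t => a t *: f t) (b *: l).
Proof. by move=> ha hf S; apply: cvgM => //; exact: hf. Qed.

Lemma cl_cvgN f l : cl_cvg f l -> cl_cvg (fun t => - f t) (- l).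
Proof. by move=> hf S; apply: cvgN; exact: hf. Qed.

Lemma real_cvg_sum (I : finType) (f : I -> T -> R) (l : I -> R) :
  (forall i, f i @ F --> l i) -> (fun t => \sum_i f i t) @ F --> \sum_i l i.
Proof.
by move=> h; apply: cvg_big => //; exact: add_continuous.
Qed.

Lemma cl_cvgM f g l m : cl_cvg f l -> cl_cvg g m -> cl_cvg (fun t => f t * g t) (l * m).
Proof.
move=> hf hg S; under eq_fun do rewrite cl_mulE; rewrite cl_mulE.
apply: real_cvg_sum => U; apply: cvgM; last exact: hg.
by apply: cvgM; [exact: cvg_cst|exact: hf].
Qed.

Lemma cl_cvg_dot f g l m : cl_cvg f l -> cl_cvg g m ->
  (fun t => cl_dot (f t) (g t)) @ F --> cl_dot l m.
Proof.
by move=> hf hg; apply: real_cvg_sum => U; apply: cvgM; [exact: hf|exact: hg].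
Qed.

Lemma cl_cvg_vec (f : T -> 'cV[R]_n) (v : 'cV[R]_n) :
    (forall i, (fun t => f t i 0) @ F --> v i 0) ->
  cl_cvg (fun t => cl_vec (f t)) (cl_vec v).
Proof.
by move=> h S; apply: real_cvg_sum => i; apply: cvgM; [exact: h|exact: cvg_cst].
Qed.

Lemma cl_cvg_lift (f : T -> 'M[R]_n) (A : 'M[R]_n) :
    (forall i j, (fun t => f t i j) @ F --> A i j) ->
  cl_cvg (fun t => cl_lift (f t)) (cl_lift A).
Proof.
move=> h; rewrite /cl_lift; elim: (enum _) => [|k l IH] /=; first exact: cl_cvg_cst.
apply: cl_cvgZ; first exact: cvg_cst.
apply: cl_cvgD => //; apply: cl_cvgN; apply: cl_cvgM; last exact: cl_cvg_cst.
apply: cl_cvgM => //; apply: cl_cvg_vec => i; rewrite mxE.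
by under eq_fun do rewrite mxE; exact: h.
Qed.
End CliffordConvergence.

Section SpinLift.
Variables (R : realType) (n : nat).
Hypothesis n_odd : odd n.
Local Notation cl := (clifford R n).

Lemma spin_opp (g : Spin R n) : exists h : Spin R n, spin_val h = - spin_val g.
Proof.
have n0 : (0 < n)%N by case: (n) n_odd.
have [v|//|h e] := @spin_exists R n [:: delta_mx (Ordinal n0) 0; delta_mx (Ordinal n0) 0].
  by rewrite !inE orbb => /eqP ->; exact: cl_e_unit.
exists (h * g)%g; rewrite -[LHS]/(spin_val h * spin_val g) e.
by rewrite !big_cons big_nil mulr1 cl_vec_unit ?mulN1r //; exact: cl_e_unit.
Qed.

(** [cl_lift] is continuous and yields a spin lift times a scalar c. This c may vanish, but not near
    the identity, hence the translation by f x0, undone by [h0]. The squared norm [N] is c^2, so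
    dividing by its square root leaves only a sign, and [spin_opp] keeps the result in Spin(n). *)
Lemma spin_local_lift (T : topologicalType) (U : set T) (f : T -> SO R n) (x0 : T) :
  open U -> U x0 ->
  (forall x i j, U x -> {for x, continuous (fun y => so_mx (f y) i j)}) ->
  exists V (p : T -> Spin R n), [/\ open V, V x0, V `<=` U,
    forall x, V x -> spin_cover (p x) = f x
    & forall x, V x -> cl_cvg (nbhs x) (fun y => spin_val (p y)) (spin_val (p x))].
Proof.
move=> oU Ux0 cf; have [h0 hh0] := spin_cover_surj n_odd (f x0).
pose B x := (f x * (f x0)^-1)%g.
pose P x := cl_lift (so_mx (B x)); pose N x := cl_dot (P x) (P x).
have cP x : U x -> cl_cvg (nbhs x) P (P x).
  move=> Ux; apply: cl_cvg_lift => i j.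
  rewrite [so_mx _ _ _]mxE; under eq_fun do rewrite [so_mx _ _ _]mxE.
  apply: real_cvg_sum => k; apply: cvgM; [exact: cf|exact: cvg_cst].
have cN x : U x -> N @ x --> N x by move=> Ux; apply: cl_cvg_dot; exact: cP.
pose V := U `&` [set x | 0 < N x].
have oV : open V.
  rewrite openE => x [Ux Nx]; apply: filterI; first exact: open_nbhs_nbhs.
  by have := @lt_nbhsr R 0 (N x) Nx; exact: (cN x Ux).
have lift x : V x -> exists g : Spin R n, spin_cover g = B x /\
    spin_val g = (Num.sqrt (N x))^-1 *: P x.
  move=> [Ux Nx]; have [g eg] := spin_cover_surj n_odd (B x).
  have := cl_lift_spin g; rewrite eg -/(P x); set c := spin_val _ _ => e.
  have eN : N x = c ^+ 2.
    by rewrite /N e cl_dotZl cl_dotC cl_dotZl spin_norm ?mulr1 ?expr2 //; exact: (rg_valP g).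
  have c0 : c != 0 by apply/eqP => c0; move: Nx; rewrite /= eN c0 expr0n ltxx.
  have [h eh] := spin_opp g.
  rewrite eN sqrtr_sqr e scalerA; case: (ltP c 0) => cs.
    exists h; split; first by rewrite -eg; exact: spin_coverN.
    by rewrite ltr0_norm // invrN mulNr mulVf // scaleN1r.
  by exists g; split=> //; rewrite ger0_norm // mulVf // scale1r.
pose p x : Spin R n := if pselect (V x) is left Vx then (sval (cid (lift x Vx)) * h0)%g else 1%g.
have pE x : V x -> spin_val (p x) = (Num.sqrt (N x))^-1 *: P x * spin_val h0.
  rewrite /p; case: pselect => // Vx _; rewrite -[LHS]/(spin_val _ * spin_val h0).
  by case: cid => g /= [_ ->].
exists V, p; split=> //.
- split=> //=; rewrite /N /P /B mulgV -spin_cover1 cl_lift_spin invg1.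
  rewrite -[spin_val 1%g]/(1 : cl) cl_one_coord eqxx scale1r cl_dot_one cl_one_coord eqxx.
  exact: ltr01.
- by move=> x [].
- move=> x Vx; rewrite /p; case: pselect => // {}Vx; rewrite spin_coverM hh0.
  by case: cid => g /= [-> _]; rewrite /B mulgVK.
- move=> x Vx; rewrite pE // => S.
  have near_eq : \forall y \near x, ((Num.sqrt (N y))^-1 *: P y * spin_val h0) S = spin_val (p y) S.
    by apply: filterS (open_nbhs_nbhs (conj oV Vx)) => y Vy; rewrite pE.
  apply: cvg_trans (near_eq_cvg near_eq) _; move: S {near_eq}.
  apply: cl_cvgM; last exact: cl_cvg_cst.
  have [Ux Nx] := Vx; apply: cl_cvgZ; last exact: cP.
  apply: cvgV; first by rewrite sqrtr_eq0 -ltNge.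
  by apply: continuous_comp; [exact: cN|exact: sqrt_continuous].
Qed.
End SpinLift.

(** * Coordinates on the circle and on the group SpinC *)

Section CircleCoordinates.
Variable R : realType.
Implicit Types z w : circle R.

Definition cre z : R := complex.Re (rg_val z).
Definition cim z : R := complex.Im (rg_val z).

Lemma circle_eq z w : cre z = cre w -> cim z = cim w -> z = w.
Proof.
rewrite /cre /cim => h1 h2; apply: rg_val_inj.
by case: (rg_val z) (rg_val w) h1 h2 => a b [c d] /= -> ->.
Qed.

Lemma circle_norm z : cre z ^+ 2 + cim z ^+ 2 = 1.
Proof.
have := rg_valP z; rewrite /= /circle_set /= /cre /cim.
case: (rg_val z) => a b /=; rewrite normc_def /= => -[h].
by rewrite -[LHS]sqr_sqrtr ?h ?expr1n // addr_ge0 // sqr_ge0.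
Qed.

Lemma creM z w : cre (z * w)%g = cre z * cre w - cim z * cim w.
Proof.
rewrite /cre /cim -[rg_val (z * w)%g]/(rg_val z * rg_val w).
by case: (rg_val z) (rg_val w) => a b [c d].
Qed.

Lemma cimM z w : cim (z * w)%g = cre z * cim w + cim z * cre w.
Proof.
rewrite /cre /cim -[rg_val (z * w)%g]/(rg_val z * rg_val w).
by case: (rg_val z) (rg_val w) => a b [c d].
Qed.

Lemma circleV z : cre z^-1%g = cre z /\ cim z^-1%g = - cim z.
Proof.
have h1 : cre (z^-1 * z)%g = 1 by rewrite mulVg.
have h2 : cim (z^-1 * z)%g = 0 by rewrite mulVg.
rewrite creM in h1; rewrite cimM in h2; have h3 := circle_norm z.
move: (cre z) (cim z) (cre z^-1%g) (cim z^-1%g) h1 h2 h3 => a b a' b' h1 h2 h3.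
split.
  have -> : a' = a' * (a ^+ 2 + b ^+ 2) by rewrite h3 mulr1.
  have -> : a' * (a ^+ 2 + b ^+ 2) = a * (a' * a - b' * b) + b * (a' * b + b' * a) by ring.
  by rewrite h1 h2; ring.
have -> : b' = b' * (a ^+ 2 + b ^+ 2) by rewrite h3 mulr1.
have -> : b' * (a ^+ 2 + b ^+ 2) = a * (a' * b + b' * a) - b * (a' * a - b' * b) by ring.
by rewrite h1 h2; ring.
Qed.

Lemma circle_polar_subproof (t : R) : circle_set (cos t +i* sin t)%C.
Proof. by rewrite /circle_set /= normc_def /= cos2Dsin2 sqrtr1. Qed.

Definition polar (t : R) : circle R :=
  @rg_mk _ (circle_group R) _ (circle_polar_subproof t).

Lemma cre_polar t : cre (polar t) = cos t. Proof. by []. Qed.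
Lemma cim_polar t : cim (polar t) = sin t. Proof. by []. Qed.

Lemma polarD s t : polar (s + t) = (polar s * polar t)%g.
Proof.
apply: circle_eq; rewrite ?creM ?cimM !(cre_polar, cim_polar).
  exact: cosD.
by rewrite sinD addrC.
Qed.

End CircleCoordinates.

Section SpinCCoordinates.
Variables (R : realType) (n : nat).
Local Notation cl := (clifford R n).
Implicit Types (x y : SpinC R n) (u z : circle R) (g : Spin R n).

(** Real and imaginary parts of the product z g in the complexified Clifford algebra. This product
    is the same for (g, z) and (-g, -z), so continuity in SpinC(n) can be handled by coordinates. *)
Definition spinc_re x : cl := cre (spinc_repr x).2 *: spin_val (spinc_repr x).1.
Definition spinc_im x : cl := cim (spinc_repr x).2 *: spin_val (spinc_repr x).1.

Lemma creN z w : rg_val w = - rg_val z -> cre w = - cre z /\ cim w = - cim z.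
Proof. by rewrite /cre /cim => ->; case: (rg_val z). Qed.

Lemma spinc_reE p : spinc_re (spinc_mk p) = cre p.2 *: spin_val p.1.
Proof.
rewrite /spinc_re.
have /spinc_mkP[<-//|[e /creN[h _]]] := spinc_reprK (spinc_mk p).
by rewrite e h scaleNr scalerN opprK.
Qed.

Lemma spinc_imE p : spinc_im (spinc_mk p) = cim p.2 *: spin_val p.1.
Proof.
rewrite /spinc_im.
have /spinc_mkP[<-//|[e /creN[_ h]]] := spinc_reprK (spinc_mk p).
by rewrite e h scaleNr scalerN opprK.
Qed.

Lemma spinc_mkMg p q : (spinc_mk p * spinc_mk q)%g = spinc_mk (p * q)%g :> SpinC R n.
Proof. exact: spinc_mkM. Qed.

Lemma spinc_mkV p : (spinc_mk p)^-1%g = spinc_mk p^-1%g :> SpinC R n.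
Proof. by apply: (mulgI (spinc_mk p)); rewrite mulgV spinc_mkMg mulgV. Qed.

Lemma spinc_reM x y :
  spinc_re (x * y)%g = spinc_re x * spinc_re y - spinc_im x * spinc_im y.
Proof.
rewrite -[x]spinc_reprK -[y]spinc_reprK spinc_mkMg !spinc_reE !spinc_imE.
rewrite -[(_ * _)%g.1]/((spinc_repr x).1 * (spinc_repr y).1)%g.
rewrite -[(_ * _)%g.2]/((spinc_repr x).2 * (spinc_repr y).2)%g creM.
rewrite -!scalerAl -!scalerAr !scalerA -scalerBl; congr (_ *: _).
Qed.

Lemma spinc_imM x y :
  spinc_im (x * y)%g = spinc_re x * spinc_im y + spinc_im x * spinc_re y.
Proof.
rewrite -[x]spinc_reprK -[y]spinc_reprK spinc_mkMg !spinc_reE !spinc_imE.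
rewrite -[(_ * _)%g.1]/((spinc_repr x).1 * (spinc_repr y).1)%g.
rewrite -[(_ * _)%g.2]/((spinc_repr x).2 * (spinc_repr y).2)%g cimM.
by rewrite -!scalerAl -!scalerAr !scalerA -scalerDl; congr (_ *: _).
Qed.

Definition cl_basis (S : {set 'I_n}) : cl := fun T => (T == S)%:R.

Lemma cl_dot_basis (x : cl) S : cl_dot x (cl_basis S) = x S.
Proof.
rewrite /cl_dot (bigD1 S)//= big1 => [|T TS]; last by rewrite /cl_basis (negbTE TS) mulr0.
by rewrite /cl_basis eqxx mulr1 addr0.
Qed.

(** Applying the isometry g to both entries of the product of g^-1 with e_S. The coordinates of the
    inverse are thereby linear in those of g, which gives the continuity of inversion. *)
Lemma spin_valV g S : spin_val g^-1%g S = (spin_val g * cl_basis S) finset.set0.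
Proof.
rewrite -[LHS]cl_dot_basis -(cl_dot_spin _ _ (rg_valP g)).
by rewrite -[rg_val g]/(spin_val g) spin_valK cl_dotC cl_dot_one.
Qed.

Lemma spinc_reV x S : spinc_re x^-1%g S = (spinc_re x * cl_basis S) finset.set0.
Proof.
rewrite -[x]spinc_reprK spinc_mkV !spinc_reE.
rewrite -[_^-1%g.1]/((spinc_repr x).1^-1)%g -[_^-1%g.2]/((spinc_repr x).2^-1)%g.
by rewrite (circleV _).1 cl_scaleE spin_valV -scalerAl.
Qed.

Lemma spinc_imV x S : spinc_im x^-1%g S = - (spinc_im x * cl_basis S) finset.set0.
Proof.
rewrite -[x]spinc_reprK spinc_mkV !spinc_imE.
rewrite -[_^-1%g.1]/((spinc_repr x).1^-1)%g -[_^-1%g.2]/((spinc_repr x).2^-1)%g.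
by rewrite (circleV _).2 cl_scaleE spin_valV -scalerAl mulNr.
Qed.

Definition spinc_scalar u : SpinC R n := spinc_mk (1%g, u).

Lemma spinc_scalarM u z : spinc_scalar (u * z)%g = (spinc_scalar u * spinc_scalar z)%g.
Proof. by rewrite /spinc_scalar spinc_mkMg; congr spinc_mk; congr (_, _); rewrite mulg1. Qed.

Lemma spinc_scalarC u x : (spinc_scalar u * x = x * spinc_scalar u)%g.
Proof.
rewrite -[x]spinc_reprK /spinc_scalar !spinc_mkMg; congr spinc_mk.
congr (_, _); rewrite /= ?mulg1 ?mul1g //.
by apply: rg_val_inj; rewrite -[LHS]/(_ * _) mulrC.
Qed.

Lemma spinc_scalar_inj : injective spinc_scalar.
Proof.
have h u : spinc_re (spinc_scalar u) finset.set0 = cre u.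
  by rewrite spinc_reE cl_scaleE -[spin_val _]/(1 : cl) cl_one_coord eqxx mulr1.
have h' u : spinc_im (spinc_scalar u) finset.set0 = cim u.
  by rewrite spinc_imE cl_scaleE -[spin_val _]/(1 : cl) cl_one_coord eqxx mulr1.
by move=> u v e; apply: circle_eq; rewrite -?h -?h' e.
Qed.

Lemma spinc_cover_scalar u : spinc_cover (spinc_scalar u) = 1%g.
Proof. by rewrite spinc_coverE spin_cover1. Qed.

Lemma spinc_cover1 : spinc_cover (1%g : SpinC R n) = 1%g.
Proof. by apply: (mulgI (spinc_cover 1%g)); rewrite -spinc_coverM !mulg1. Qed.

Lemma spinc_coverV x : spinc_cover x^-1%g = (spinc_cover x)^-1%g.
Proof. by apply: (mulgI (spinc_cover x)); rewrite -spinc_coverM !mulgV spinc_cover1. Qed.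

Lemma spinc_cover_eq x y : spinc_cover x = spinc_cover y ->
  exists u, y = (x * spinc_scalar u)%g.
Proof.
move=> e; have : spinc_cover (x^-1 * y)%g = 1%g by rewrite spinc_coverM spinc_coverV e mulVg.
rewrite -[(x^-1 * y)%g]spinc_reprK; set p := spinc_repr _ => h.
suff [u hu] : exists u, spinc_mk p = spinc_scalar u.
  by exists u; rewrite -hu /p spinc_reprK mulVKg.
case: p h => g z; rewrite spinc_coverE /= => /spin_kernel[h|h].
  by exists z; congr (spinc_mk (_, _)); apply: rg_val_inj.
have N1 : circle_set (-1 : R[i]) by rewrite /circle_set /= normrN1.
pose m : circle R := @rg_mk _ (circle_group R) _ N1.
exists (m * z)%g; apply/spinc_mkP; right; split=> /=.
  by rewrite h opprK.
by rewrite -[LHS]/(-1 * rg_val z) mulN1r.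
Qed.

(** With [spinc_him], the hermitian product of the complexified algebra. Elements of SpinC(n) have
    norm 1, so the product of x with x u is u: the circle factor between two convergent families
    converges. *)
Definition spinc_hre x y : R := cl_dot (spinc_re x) (spinc_re y) + cl_dot (spinc_im x) (spinc_im y).
Definition spinc_him x y : R := cl_dot (spinc_re x) (spinc_im y) - cl_dot (spinc_im x) (spinc_re y).

Lemma spinc_ratio x u :
  spinc_hre x (x * spinc_scalar u)%g = cre u /\ spinc_him x (x * spinc_scalar u)%g = cim u.
Proof.
rewrite -[x]spinc_reprK /spinc_scalar spinc_mkMg /spinc_hre /spinc_him !spinc_reE !spinc_imE /=.
case: (spinc_repr x) => g z /=; rewrite mulg1 creM cimM.
have e a b : cl_dot (a *: spin_val g) (b *: spin_val g) = a * b.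
  by rewrite cl_dotZl cl_dotC cl_dotZl spin_norm ?mulr1 //; exact: (rg_valP g).
have h := circle_norm z; rewrite !e.
split; rewrite -[RHS]mul1r -h; ring.
Qed.

Section Convergence.
Variables (T : Type) (F : set_system T) (FF : Filter F).

Definition spinc_cvg (f : T -> SpinC R n) x :=
  cl_cvg F (spinc_re \o f) (spinc_re x) /\ cl_cvg F (spinc_im \o f) (spinc_im x).

Lemma spinc_cvg_cst x : spinc_cvg (fun=> x) x.
Proof. by split; exact: cl_cvg_cst. Qed.

Lemma spinc_cvgM (f g : T -> SpinC R n) x y : spinc_cvg f x -> spinc_cvg g y ->
  spinc_cvg (fun t => f t * g t)%g (x * y)%g.
Proof.
move=> [f1 f2] [g1 g2]; split; rewrite /comp.
  under eq_fun do rewrite spinc_reM; rewrite spinc_reM.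
  by apply: cl_cvgD; [exact: cl_cvgM|apply: cl_cvgN; exact: cl_cvgM].
under eq_fun do rewrite spinc_imM; rewrite spinc_imM.
by apply: cl_cvgD; exact: cl_cvgM.
Qed.

Lemma spinc_cvgV f x : spinc_cvg f x -> spinc_cvg (fun t => (f t)^-1)%g x^-1%g.
Proof.
move=> [f1 f2]; split=> S; rewrite /comp.
  under eq_fun do rewrite spinc_reV; rewrite spinc_reV.
  by apply: cl_cvgM => //; exact: cl_cvg_cst.
under eq_fun do rewrite spinc_imV; rewrite spinc_imV.
by apply: cvgN; apply: cl_cvgM => //; exact: cl_cvg_cst.
Qed.

Lemma spinc_cvg_mk (g : T -> Spin R n) (z : T -> circle R) g0 z0 :
  cl_cvg F (fun t => spin_val (g t)) (spin_val g0) ->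
  (fun t => cre (z t)) @ F --> cre z0 -> (fun t => cim (z t)) @ F --> cim z0 ->
  spinc_cvg (fun t => spinc_mk (g t, z t)) (spinc_mk (g0, z0)).
Proof.
move=> h1 h2 h3; split; rewrite /comp.
  by under eq_fun do rewrite spinc_reE; rewrite spinc_reE; exact: cl_cvgZ.
by under eq_fun do rewrite spinc_imE; rewrite spinc_imE; exact: cl_cvgZ.
Qed.

Lemma spinc_cvg_ratio (f g : T -> SpinC R n) x y (u : T -> circle R) u0 :
  spinc_cvg f x -> spinc_cvg g y -> y = (x * spinc_scalar u0)%g ->
  (\forall t \near F, g t = f t * spinc_scalar (u t))%g ->
  (fun t => cre (u t)) @ F --> cre u0 /\ (fun t => cim (u t)) @ F --> cim u0.
Proof.
move=> [f1 f2] [g1 g2] e h; split.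
  rewrite -(spinc_ratio x u0).1 -e; apply: (@cvg_trans _ ((fun t => spinc_hre (f t) (g t)) @ F)).
    by apply: near_eq_cvg; apply: filterS h => t ->; rewrite (spinc_ratio _ _).1.
  by apply: cvgD; exact: cl_cvg_dot.
rewrite -(spinc_ratio x u0).2 -e; apply: (@cvg_trans _ ((fun t => spinc_him (f t) (g t)) @ F)).
  by apply: near_eq_cvg; apply: filterS h => t ->; rewrite (spinc_ratio _ _).2.
by apply: cvgB; exact: cl_cvg_dot.
Qed.
End Convergence.

Lemma spin_val_continuous (S : {set 'I_n}) : continuous (fun g : Spin R n => spin_val g S : R).
Proof.
move=> g.
have h1 : {for g, continuous (fun g : Spin R n => spin_val g)} := @initial_continuous _ _ _ g.
have h2 : {for (spin_val g), continuous (fun x : clifford R n => x S : R)}.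
  exact: (@proj_continuous _ (fun=> R) S (spin_val g)).
exact: (continuous_comp h1 h2).
Qed.

Lemma circle_continuous : continuous (@cre R) /\ continuous (@cim R).
Proof.
split=> z.
  apply: (@continuous_comp (circle R) (R * R)%type R (@circle_coords R) fst).
    exact: initial_continuous.
  exact: cvg_fst.
apply: (@continuous_comp (circle R) (R * R)%type R (@circle_coords R) snd).
  exact: initial_continuous.
exact: cvg_snd.
Qed.

Lemma spinc_continuous (x : SpinC R n) : spinc_cvg (nbhs x) id x.
Proof.
have [cR cI] := circle_continuous.
suff h : forall S, continuous (fun x : SpinC R n => spinc_re x S : R) /\
    continuous (fun x : SpinC R n => spinc_im x S : R).
  by split=> S; [exact: (h S).1|exact: (h S).2].
move=> S; split; apply/quotient_continuous.
  rewrite (_ : _ \o _ = (fun p : Spin R n * circle R => cre p.2 * spin_val p.1 S)); last first.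
    by apply/funext => p; rewrite -[LHS]/(spinc_re (spinc_mk p) S) spinc_reE.
  move=> p; apply: cvgM.
    by apply: (@continuous_comp _ _ _ snd (@cre R)); [exact: cvg_snd|exact: cR].
  apply: (@continuous_comp _ _ _ fst (fun g => spin_val g S)); first exact: cvg_fst.
  exact: spin_val_continuous.
rewrite (_ : _ \o _ = (fun p : Spin R n * circle R => cim p.2 * spin_val p.1 S)); last first.
  by apply/funext => p; rewrite -[LHS]/(spinc_im (spinc_mk p) S) spinc_imE.
move=> p; apply: cvgM.
  by apply: (@continuous_comp _ _ _ snd (@cim R)); [exact: cvg_snd|exact: cI].
apply: (@continuous_comp _ _ _ fst (fun g => spin_val g S)); first exact: cvg_fst.
exact: spin_val_continuous.
Qed.
End SpinCCoordinates.

(** * Coordinates on the Milnor join *)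

Section MilnorCoordinates.
Variables (R : realType) (G : topGroupType).
Implicit Types y : EG R G.

Definition EG_dom (i : nat) y : bool := isSome (set_val y i).
Definition EG_el (i : nat) y : G := if set_val y i is Some (_, g) then g else 1%g.

Lemma EG_subbase_open (A : set (EG R G)) : EG_subbase A -> open A.
Proof.
move=> hA; exists [set A]; last by rewrite bigcup_set1.
by move=> _ ->; exact: finI_from1.
Qed.

Lemma EG_el_nbhs i y (V : set G) : EG_dom i y -> nbhs (EG_el i y) V ->
  \forall y' \near y, EG_dom i y' /\ V (EG_el i y').
Proof.
move=> dy; rewrite nbhsE => -[W [oW Wy] WV].
pose A : set (EG R G) := [set x | exists t g, set_val x i = Some (t, g) /\ W g].
have oA : open A by apply: EG_subbase_open; right; exists i, W.
have Ay : A y.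
  by move: dy Wy; rewrite /EG_dom /EG_el /A /=; case: (set_val y i) => // -[t g] _; exists t, g.
apply: filterS (open_nbhs_nbhs (conj oA Ay)) => x [t [g [e Wg]]].
by rewrite /EG_dom /EG_el e; split=> //; exact: WV.
Qed.

Lemma EG_dom_open i : open [set y | EG_dom i y].
Proof.
rewrite openE => y dy; have h := EG_el_nbhs dy (@filterT _ _ (nbhs_filter (EG_el i y))).
by apply: filterS h => x [].
Qed.

Lemma EG_dom_ex y : exists i, EG_dom i y.
Proof.
have [h [N _ e]] := set_valP y; apply: contrapT => hN.
have := e; rewrite big1 => [/eqP|i _]; first by rewrite eq_sym oner_eq0.
rewrite /join_coef; case E : (\val y i) => [[t g]|//].
by case: hN; exists i; rewrite /EG_dom set_valE E.
Qed.

Lemma EG_actE i y g :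
  set_val (EG_act y g) i = omap (fun th => (th.1, th.2 * g)%g) (set_val y i).
Proof. by []. Qed.

Lemma EG_dom_act i y g : EG_dom i (EG_act y g) = EG_dom i y.
Proof. by rewrite /EG_dom EG_actE; case: (set_val y i). Qed.

Lemma EG_el_act i y g : EG_dom i y -> EG_el i (EG_act y g) = (EG_el i y * g)%g.
Proof. by rewrite /EG_dom /EG_el EG_actE; case: (set_val y i) => [[]|]. Qed.

Lemma BG_open (O : set (BG R G)) : open [set y : EG R G | O (BG_proj y)] -> open O.
Proof. by []. Qed.
End MilnorCoordinates.

Section MilnorMapCoordinates.
Variables (R : realType) (G H : topGroupType) (f : G -> H).
Implicit Types y : EG R G.

Lemma EG_mapE i y :
  set_val (EG_map f y) i = omap (fun tg => (tg.1, f tg.2)) (set_val y i).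
Proof. by []. Qed.

Lemma EG_dom_map i y : EG_dom i (EG_map f y) = EG_dom i y.
Proof. by rewrite /EG_dom EG_mapE; case: (set_val y i) => [[]|]. Qed.

Lemma EG_el_map i y : EG_dom i y -> EG_el i (EG_map f y) = f (EG_el i y).
Proof. by rewrite /EG_dom /EG_el EG_mapE; case: (set_val y i) => [[]|]. Qed.
End MilnorMapCoordinates.

Lemma nbhsS3 (T : topologicalType) (x : T) (A B C D : set T) :
  nbhs x A -> nbhs x B -> nbhs x C -> (forall y, A y -> B y -> C y -> D y) -> nbhs x D.
Proof.
move=> hA hB hC h; apply: filterS (filterI hA (filterI hB hC)) => y [a [b c]].
exact: h.
Qed.

Lemma mulg_divr (G : groupType) (a b g : G) : (a * g * (b * g)^-1)%g = (a * b^-1)%g.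
Proof. by rewrite invgM mulgA mulgK. Qed.

Lemma mulg_divK (G : groupType) (a b c : G) : (a * b^-1 * (b * c^-1))%g = (a * c^-1)%g.
Proof. by rewrite mulgA mulgVK. Qed.

(** * Transition functions of the universal SpinC(n)-bundle *)

Section MilnorTransition.
Variables (R : realType) (n : nat).
Local Notation E := (EG R (SpinC R n)).
Local Notation B := (BG R (SpinC R n)).

Definition transition (i j : nat) (y : E) : SpinC R n := (EG_el i y * (EG_el j y)^-1)%g.

Lemma transition_act i j y g : EG_dom i y -> EG_dom j y ->
  transition i j (EG_act y g) = transition i j y.
Proof.
move=> di dj; rewrite /transition (EG_el_act g di) (EG_el_act g dj).
exact: mulg_divr.
Qed.

Lemma transition_cvg i j y : EG_dom i y -> EG_dom j y ->
  spinc_cvg (nbhs y) (transition i j) (transition i j y).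
Proof.
have el k : EG_dom k y -> spinc_cvg (nbhs y) (EG_el k) (EG_el k y).
  move=> dk; have [c1 c2] := @spinc_continuous R n (EG_el k y).
  by split=> S U hU; [have h := EG_el_nbhs dk (c1 S U hU)|have h := EG_el_nbhs dk (c2 S U hU)];
    apply: filterS h => x [].
by move=> di dj; apply: spinc_cvgM; [exact: el|apply: spinc_cvgV; exact: el].
Qed.

(** [BG_repr] is an arbitrary choice of representatives, with no continuity. The quotients g_i
    g_j^-1 are invariant under the right action, so openness in the base can be tested upstairs on
    any representative. *)
Lemma transition_base_cvg i j (b : B) : EG_dom i (BG_repr b) -> EG_dom j (BG_repr b) ->
  spinc_cvg (nbhs b) (fun b' => transition i j (BG_repr b')) (transition i j (BG_repr b)).
Proof.
move=> di dj.
have key (f : SpinC R n -> R) :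
    (forall y : E, EG_dom i y -> EG_dom j y ->
      (f \o transition i j) @ y --> f (transition i j y)) ->
    (fun b' => f (transition i j (BG_repr b'))) @ b --> f (transition i j (BG_repr b)).
  move=> cf V; rewrite nbhsE => -[W [oW Wb] WV].
  pose O : set B := [set b' | [/\ EG_dom i (BG_repr b'), EG_dom j (BG_repr b')
     & W (f (transition i j (BG_repr b')))]].
  have oO : open O.
    have PE y : O (BG_proj y) <-> [/\ EG_dom i y, EG_dom j y & W (f (transition i j y))].
      have /BG_projP[g e] : BG_proj y = BG_proj (BG_repr (BG_proj y)) by rewrite BG_reprK.
      rewrite /O /= e !EG_dom_act.
      by split=> -[h1 h2]; rewrite transition_act.
    apply: BG_open; rewrite openE => y /PE[hi hj hW].
    have n1 := cf y hi hj W (open_nbhs_nbhs (conj oW hW)).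
    have n2 := open_nbhs_nbhs (conj (@EG_dom_open R _ i) hi).
    have n3 := open_nbhs_nbhs (conj (@EG_dom_open R _ j) hj).
    by apply: (nbhsS3 n1 n2 n3) => x x1 x2 x3; apply/PE.
  have Ob : O b by split.
  by apply: filterS (open_nbhs_nbhs (conj oO Ob)) => x [_ _]; exact: WV.
split=> S.
  by apply: (key (fun x => spinc_re x S)) => y hi hj; exact: (transition_cvg hi hj).1.
by apply: (key (fun x => spinc_im x S)) => y hi hj; exact: (transition_cvg hi hj).2.
Qed.
End MilnorTransition.

(** * From a SpinC-structure to transition functions on the universal cover *)

(* On the chart where the i-th barycentric coordinate does not vanish, [cech_phi i x]
   is the i-th group coordinate of the image in ESO(n) of the standard frame at x,
   and [cech_g i j] are the transition functions of the pulled-back Milnor bundle. *)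
Record cech_data (R : realType) (n : nat) (Gamma : subgroup (motion R n)) := CechData {
  cech_U : nat -> set 'cV[R]_n;
  cech_phi : nat -> 'cV[R]_n -> SO R n;
  cech_g : nat -> nat -> 'cV[R]_n -> SpinC R n;
  cech_open : forall i, open (cech_U i);
  cech_cover : forall x, exists i, cech_U i x;
  cech_phi_cont : forall i x a b, cech_U i x ->
    {for x, continuous (fun y => so_mx (cech_phi i y) a b)};
  cech_U_act : forall s i x, subgroup_set Gamma s -> cech_U i x -> cech_U i (motion_act s x);
  cech_phi_act : forall s i x, subgroup_set Gamma s -> cech_U i x ->
    cech_phi i (motion_act s x) = (cech_phi i x * s.1^-1)%g;
  cech_g_act : forall s i j x, subgroup_set Gamma s ->
    cech_g i j (motion_act s x) = cech_g i j x;
  cech_g_cvg : forall i j x, cech_U i x -> cech_U j x ->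
    spinc_cvg (nbhs x) (cech_g i j) (cech_g i j x);
  cech_g_cover : forall i j x, cech_U i x -> cech_U j x ->
    spinc_cover (cech_g i j x) = (cech_phi i x * (cech_phi j x)^-1)%g;
  cech_cocycle : forall i j k x, (cech_g i j x * cech_g j k x)%g = cech_g i k x
}.

Lemma so_mx_continuous (R : realType) (n : nat) (a b : 'I_n) :
  continuous (fun A : SO R n => so_mx A a b).
Proof.
move=> A.
have h1 : {for A, continuous (fun A : SO R n => so_mx A)} := @initial_continuous _ _ _ A.
have h2 : {for (so_mx A), continuous (fun M : 'M[R]_n => M a b)}.
  exact: coord_continuous.
exact: (continuous_comp h1 h2).
Qed.

(** Only the map to the base BSpinC(n) is given, so [L x] is a chosen point above it and only its
    invariant quotients are used. [f x] and the image of [L x] have the same projection to BSO(n);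
    they differ by the right action, which changes neither the charts nor the quotients. *)
Lemma spinc_structure_cech (R : realType) (n : nat) (Gamma : subgroup (motion R n)) :
  has_spinc_structure (@frame_proj R n Gamma) (@frame_act R n Gamma) ->
  exists _ : cech_data Gamma, True.
Proof.
move=> [d [[cd [Phi [cPhi Phi_act Phi_proj]]] [l [cl ld]]]].
pose f x := Phi (frame_pi Gamma (x, 1%g)).
pose L x := BG_repr (l (flat_pi Gamma x)).
have cf : continuous f.
  move=> x; apply: (@continuous_comp _ _ _ (fun x => frame_pi Gamma (x, 1%g)) Phi).
    apply: (@continuous_comp _ _ _ (fun x : 'cV[R]_n => (x, 1%g : SO R n)) (frame_pi Gamma)).
      exact: (cvg_pair (@cvg_id _ (nbhs x)) (@cvg_cst _ (1%g : SO R n) _ (nbhs x) _)).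
    exact: pi_continuous.
  exact: cPhi.
have cpi : continuous (fun x => l (flat_pi Gamma x)).
  move=> x; apply: (@continuous_comp _ _ _ (flat_pi Gamma) l); last exact: cl.
  exact: pi_continuous.
(* For a motion with linear part A, the standard frame at the image of x is the image of the frame
   A^-1 at x. *)
have f_act s x : subgroup_set Gamma s -> f (motion_act s x) = EG_act (f x) s.1^-1%g.
  move=> Gs; rewrite /f -Phi_act frame_actE mul1g; congr Phi.
  by apply/esym/frame_piP; exists s => //; rewrite /motion_frame_act /= mulgV.
have L_act s x : subgroup_set Gamma s -> L (motion_act s x) = L x.
  by move=> Gs; rewrite /L; congr (BG_repr (l _)); apply/esym/flat_piP; exists s.
have fL x : exists h, f x = EG_act (EG_map (@spinc_cover R n) (L x)) h.
  apply/BG_projP; rewrite /f Phi_proj frame_projE -ld /=.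
  by rewrite -[in RHS](BG_reprK (l _)) BG_mapE //; exact: spinc_coverM.
have dL i x : EG_dom i (L x) = EG_dom i (f x).
  by have [h ->] := fL x; rewrite EG_dom_act EG_dom_map.
unshelve eexists; last by [].
apply: (@CechData R n Gamma (fun i => [set x | EG_dom i (f x)])
  (fun i x => EG_el i (f x)) (fun i j x => transition i j (L x))).
- move=> i; have /continuousP h := cf.
  exact: (h [set y | EG_dom i y] (@EG_dom_open _ _ i)).
- by move=> x; exact: EG_dom_ex.
- move=> i x a b dx V hV.
  have h := cf x _ (EG_el_nbhs dx (@so_mx_continuous R n a b _ V hV)).
  by apply: (nbhsS3 h h h) => y [].
- by move=> s i x Gs; rewrite /= f_act // EG_dom_act.
- by move=> s i x Gs dx; rewrite f_act // EG_el_act.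
- by move=> s i j x Gs; rewrite L_act.
- move=> i j x dx dj.
  have [] := @transition_base_cvg R n i j (l (flat_pi Gamma x)).
  + by rewrite -[BG_repr _]/(L x) dL.
  + by rewrite -[BG_repr _]/(L x) dL.
  move=> h1 h2; split=> S.
    exact: (cvg_comp _ _ (cpi x) (h1 S)).
  exact: (cvg_comp _ _ (cpi x) (h2 S)).
- move=> i j x di dj; have [h e] := fL x.
  have dLi : EG_dom i (L x) by rewrite dL.
  have dLj : EG_dom j (L x) by rewrite dL.
  rewrite e !EG_el_act ?EG_dom_map // !EG_el_map // /transition spinc_coverM spinc_coverV.
  by rewrite mulg_divr.
- by move=> i j k x; exact: mulg_divK.
Qed.

(** * Logarithms of circle-valued maps *)

Section WithinConvergence.
Variables (R : realType) (T : topologicalType).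
Implicit Types (K : set T) (x : T) (h : T -> R).

Lemma cvg_withinP K x h (l : R) : h @ within K (nbhs x) --> l <->
  forall V, nbhs l V -> \forall y \near x, K y -> V (h y).
Proof. by []. Qed.

Lemma cvg_within_sub K K' x h (l : R) : K' `<=` K ->
  h @ within K (nbhs x) --> l -> h @ within K' (nbhs x) --> l.
Proof.
move=> sub /cvg_withinP hl; apply/cvg_withinP => V hV.
by apply: filterS (hl V hV) => y hy /sub.
Qed.

Lemma cvg_within_eq K x h h' (l : R) : (forall y, K y -> h y = h' y) ->
  h @ within K (nbhs x) --> l -> h' @ within K (nbhs x) --> l.
Proof.
move=> e /cvg_withinP hl; apply/cvg_withinP => V hV.
by apply: filterS (hl V hV) => y hy Ky; rewrite -e //; exact: hy.
Qed.

Lemma cvg_withinU K1 K2 x h (l : R) : closed K1 -> closed K2 ->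
  (K1 x -> h @ within K1 (nbhs x) --> l) -> (K2 x -> h @ within K2 (nbhs x) --> l) ->
  h @ within (K1 `|` K2) (nbhs x) --> l.
Proof.
move=> c1 c2 h1 h2; apply/cvg_withinP => V hV.
have key K : closed K -> (K x -> h @ within K (nbhs x) --> l) ->
    \forall y \near x, K y -> V (h y).
  move=> cK hK; have [Kx|Kx] := pselect (K x); first exact: (hK Kx V hV).
  have q : nbhs x (~` K) by apply: open_nbhs_nbhs; split=> //; exact: closed_openC.
  by apply: filterS q => y nK /nK.
apply: filterS (filterI (key K1 c1 h1) (key K2 c2 h2)) => y [v1 v2] [k|k].
  exact: v1.
exact: v2.
Qed.

Lemma cvg_within_open K x h (l : R) : nbhs x K ->
  h @ within K (nbhs x) --> l -> h @ x --> l.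
Proof.
move=> Kx /cvg_withinP hl V hV.
suff : nbhs x [set y | V (h y)] by [].
by apply: filterS (filterI Kx (hl V hV)) => y [Ky]; exact.
Qed.

Lemma cvg_within_nbhs K x h (l : R) : h @ x --> l -> h @ within K (nbhs x) --> l.
Proof.
move=> hl; apply/cvg_withinP => V hV.
have q : nbhs x [set y | V (h y)] by exact: hl V hV.
by apply: filterS q.
Qed.

Lemma cvg_within_retract K D x h (l : R) (r : T -> T) : {for x, continuous r} ->
  (forall y, K y -> D (r y)) -> h @ within D (nbhs (r x)) --> l ->
  (h \o r) @ within K (nbhs x) --> l.
Proof.
move=> cr rD /cvg_withinP hl; apply/cvg_withinP => V hV.
have q : nbhs x [set y | D (r y) -> V (h (r y))] by exact: cr _ (hl V hV).
by apply: filterS q => y /= hy /rD; exact: hy.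
Qed.
End WithinConvergence.

Section CircleLog.
Variable R : realType.

Lemma polar_surj (z : circle R) : exists t, polar t = z.
Proof.
have h := circle_norm z.
have a1 : -1 <= cre z <= 1.
  rewrite -ler_norml -(expr_le1 (n := 2)) // real_normK ?num_real //.
  by rewrite -h lerDl sqr_ge0.
have c : cos (acos (cre z)) = cre z by apply: acosK; rewrite in_itv.
have s : sin (acos (cre z)) = `|cim z|.
  by rewrite sin_acos // -h addrC addKr sqrtr_sqr.
have [b0|b0] := leP 0 (cim z).
  by exists (acos (cre z)); apply: circle_eq; rewrite ?cre_polar ?cim_polar // s ger0_norm.
exists (- acos (cre z)); apply: circle_eq; rewrite ?cre_polar ?cim_polar ?cosN //.
by rewrite sinN s ltr0_norm // opprK.
Qed.

Lemma sin_atan (t : R) : sin (atan t) = t * (Num.sqrt (1 + t ^+ 2))^-1.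
Proof.
rewrite -cos_atan -{2}[t]atanK /tan mulfVK //.
by rewrite cos_atan invr_eq0 sqrtr_eq0 -ltNge ltr_wpDr // sqr_ge0.
Qed.

Lemma polar_atan (z : circle R) : 0 < cre z -> polar (atan (cim z / cre z)) = z.
Proof.
move=> a0; have h := circle_norm z.
have e : 1 + (cim z / cre z) ^+ 2 = (cre z)^-1 ^+ 2.
  rewrite -[X in X + _](@divff _ (cre z ^+ 2)) ?sqrf_eq0 ?gt_eqF //.
  by rewrite exprMn exprVn -mulrDl h mul1r.
have s : Num.sqrt (1 + (cim z / cre z) ^+ 2) = (cre z)^-1.
  by rewrite e sqrtr_sqr ger0_norm // invr_ge0 ltW.
apply: circle_eq; rewrite ?cre_polar ?cim_polar ?cos_atan ?sin_atan s invrK //.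
by rewrite mulfVK // gt_eqF.
Qed.

(** After division by u x0 the real part is positive near x0, and there an arctangent serves as
    angle. *)
Lemma circle_local_log (T : topologicalType) (u : T -> circle R) (x0 : T) :
  continuous (fun x => cre (u x)) -> continuous (fun x => cim (u x)) ->
  exists f : T -> R, \forall y \near x0, polar (f y) = u y /\ f @ y --> f y.
Proof.
move=> cu su; have [t0 ht0] := polar_surj (u x0).
pose a y : R := cre (u x0) * cre (u y) + cim (u x0) * cim (u y).
pose b y : R := cre (u x0) * cim (u y) - cim (u x0) * cre (u y).
have ab y : cre ((u x0)^-1 * u y)%g = a y /\ cim ((u x0)^-1 * u y)%g = b y.
  rewrite creM cimM (circleV _).1 (circleV _).2 /a /b; split; ring.
have ca y : a @ y --> a y.
  apply: cvgD; apply: cvgM; do ?[exact: cvg_cst|exact: cu|exact: su].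
have cb y : b @ y --> b y.
  apply: cvgB; apply: cvgM; do ?[exact: cvg_cst|exact: cu|exact: su].
have a0 : 0 < a x0 by rewrite /a -!expr2 circle_norm.
have q : \forall y \near x0, 0 < a y by exact: (ca x0 _ (lt_nbhsr a0)).
exists (fun y => t0 + atan (b y / a y)); apply: filterS q => y ay; split.
  have [e1 e2] := ab y.
  by rewrite polarD ht0 -e1 -e2 polar_atan ?e1 // mulVKg.
apply: cvgD; first exact: cvg_cst.
apply: (@continuous_comp _ _ _ (fun y => b y / a y) atan); last exact: continuous_atan.
by apply: cvgM; [exact: cb|apply: cvgV; [rewrite gt_eqF|exact: ca]].
Qed.

Variables (n : nat) (u : 'cV[R]_n -> circle R).
Hypothesis cu : continuous (fun x => cre (u x)).
Hypothesis su : continuous (fun x => cim (u x)).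

Lemma circle_log : exists2 f : 'cV[R]_n -> R, continuous f & forall x, polar (f x) = u x.
Proof.
pose C (K : set 'cV[R]_n) (f : 'cV[R]_n -> R) := forall x, K x ->
  polar (f x) = u x /\ f @ within K (nbhs x) --> f x.
have [||||||f Cf] := @global_section R n R C.
- move=> K s s' h e x Kx; have [h1 h2] := h x Kx; rewrite -e //; split=> //.
  exact: cvg_within_eq h2.
- move=> K K' s h sub x Kx; have [h1 h2] := h x (sub _ Kx); split=> //.
  exact: cvg_within_sub h2.
- move=> x0; have [f /nbhs_ballP[e e0 he]] := circle_local_log x0 cu su.
  exists e => //; exists f => y /he[p c]; split=> //; exact: cvg_within_nbhs.
- move=> K1 K2 s1 s2 r h1 h2 cr hr.
  (* The added term is a difference of two logarithms of u (r x), thus a logarithm of 1. *)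
  exists (fun x => s2 x + (s1 (r x) - s2 (r x))) => [x K2x|x K1x K2x ->]; last first.
    by rewrite addrC subrK.
  have [k1 k2] := hr _ K2x; have [p1 c1] := h1 _ k1; have [p2 c2] := h2 _ k2.
  have [p3 c3] := h2 _ K2x; split.
    rewrite polarD p3 polarD p1.
    have -> : polar (- s2 (r x)) = (u (r x))^-1%g.
      apply: (mulgI (u (r x))); rewrite mulgV -p2 -polarD subrr.
      by apply: circle_eq; rewrite ?cre_polar ?cim_polar ?cos0 ?sin0.
    by rewrite mulgV mulg1.
  apply: cvgD => //; apply: cvgB.
    exact: (@cvg_within_retract _ _ K2 K1 x s1 _ r (cr x) (fun y h => (hr y h).1) c1).
  exact: (@cvg_within_retract _ _ K2 K2 x s2 _ r (cr x) (fun y h => (hr y h).2) c2).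
- move=> K1 K2 s c1 c2 h1 h2 x Kx; split.
    by case: Kx => [/h1|/h2] [].
  by apply: cvg_withinU => // [/h1|/h2] [].
- move=> s h x _; have [e e0 he] := h x; have [p c] := he x (ballxx x e0); split=> //.
  apply: cvg_within_nbhs.
  by apply: cvg_within_open c; exact: nbhsx_ballx.
exists f => [x|x]; last exact: (Cf x I).1.
by apply: (@cvg_within_open _ _ setT); [exact: filterT|exact: (Cf x I).2].
Qed.

End CircleLog.

(** * Trivialization over the universal cover *)

Section SpinCWithin.
Variables (R : realType) (n : nat) (T : topologicalType).
Implicit Types (K : set T) (x : T) (f : T -> SpinC R n) (l : SpinC R n).

Lemma spinc_within_sub K K' x f l : K' `<=` K ->
  spinc_cvg (within K (nbhs x)) f l -> spinc_cvg (within K' (nbhs x)) f l.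
Proof.
move=> sub [h1 h2]; split=> S.
  exact: cvg_within_sub sub (h1 S).
exact: cvg_within_sub sub (h2 S).
Qed.

Lemma spinc_within_near K x f f' l : (\forall y \near x, K y -> f y = f' y) ->
  spinc_cvg (within K (nbhs x)) f l -> spinc_cvg (within K (nbhs x)) f' l.
Proof.
move=> e [h1 h2]; split=> S; apply/cvg_withinP => V hV.
  by apply: filterS (filterI e ((cvg_withinP _ _ _ _).1 (h1 S) V hV)) => y [ey hy] Ky;
    have := hy Ky; rewrite /= ey.
by apply: filterS (filterI e ((cvg_withinP _ _ _ _).1 (h2 S) V hV)) => y [ey hy] Ky;
  have := hy Ky; rewrite /= ey.
Qed.

Lemma spinc_withinU K1 K2 x f l : closed K1 -> closed K2 ->
  (K1 x -> spinc_cvg (within K1 (nbhs x)) f l) ->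
  (K2 x -> spinc_cvg (within K2 (nbhs x)) f l) ->
  spinc_cvg (within (K1 `|` K2) (nbhs x)) f l.
Proof.
move=> c1 c2 h1 h2; split=> S; apply: cvg_withinU => //.
- by move=> /h1[h _]; exact: h.
- by move=> /h2[h _]; exact: h.
- by move=> /h1[_ h]; exact: h.
- by move=> /h2[_ h]; exact: h.
Qed.

Lemma spinc_within_open K x f l : nbhs x K ->
  spinc_cvg (within K (nbhs x)) f l -> spinc_cvg (nbhs x) f l.
Proof.
move=> Kx [h1 h2]; split=> S.
  exact: cvg_within_open Kx (h1 S).
exact: cvg_within_open Kx (h2 S).
Qed.

Lemma spinc_within_nbhs K x f l :
  spinc_cvg (nbhs x) f l -> spinc_cvg (within K (nbhs x)) f l.
Proof.
by move=> [h1 h2]; split=> S; [exact: cvg_within_nbhs (h1 S)|exact: cvg_within_nbhs (h2 S)].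
Qed.

Lemma spinc_cvgM_within K x f f' l l' : spinc_cvg (within K (nbhs x)) f l ->
  spinc_cvg (within K (nbhs x)) f' l' ->
  spinc_cvg (within K (nbhs x)) (fun y => f y * f' y)%g (l * l')%g.
Proof. exact: spinc_cvgM. Qed.

Lemma spinc_cvg_scalar_within K x (u : T -> circle R) u0 :
  (fun y => cre (u y)) @ within K (nbhs x) --> cre u0 ->
  (fun y => cim (u y)) @ within K (nbhs x) --> cim u0 ->
  spinc_cvg (within K (nbhs x)) (fun y => spinc_scalar n (u y)) (spinc_scalar n u0).
Proof. by move=> h1 h2; apply: spinc_cvg_mk => //; exact: cl_cvg_cst. Qed.

Lemma spinc_cvg_spin_within K x (p : T -> Spin R n) p0 :
  cl_cvg (nbhs x) (fun y => spin_val (p y)) (spin_val p0) ->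
  spinc_cvg (within K (nbhs x)) (fun y => spinc_mk (p y, 1%g)) (spinc_mk (p0, 1%g)).
Proof.
move=> h; apply: spinc_within_nbhs; apply: spinc_cvg_mk => //; exact: cvg_cst.
Qed.

Lemma spinc_ratio_within K x f f' (u : T -> circle R) :
  spinc_cvg (within K (nbhs x)) f (f x) -> spinc_cvg (within K (nbhs x)) f' (f' x) ->
  f' x = (f x * spinc_scalar n (u x))%g ->
  (\forall y \near x, K y -> f' y = f y * spinc_scalar n (u y))%g ->
  (fun y => cre (u y)) @ within K (nbhs x) --> cre (u x) /\
  (fun y => cim (u y)) @ within K (nbhs x) --> cim (u x).
Proof. by move=> h1 h2 e h; apply: spinc_cvg_ratio h1 h2 e h. Qed.
End SpinCWithin.

Section CechSection.
Variables (R : realType) (n : nat) (Gamma : subgroup (motion R n)) (D : cech_data Gamma).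
Hypothesis n_odd : odd n.
Local Notation U := (cech_U D).
Local Notation phi := (cech_phi D).
Local Notation g := (cech_g D).
Implicit Types (K : set 'cV[R]_n) (s : 'cV[R]_n -> nat -> SpinC R n).

(* [s] is the family of local expressions of a section of the SpinC-bundle that
   lifts the standard frame; its values outside the charts are junk. *)
Definition cech_section K s := forall x, K x -> forall i, U i x ->
  [/\ spinc_cover (s x i) = phi i x,
      forall j, U j x -> s x i = (g i j x * s x j)%g
    & spinc_cvg (within K (nbhs x)) (fun y => s y i) (s x i)].

Lemma cech_section_ratio K s s' x :
  (forall i, U i x -> spinc_cover (s x i) = phi i x /\
     forall j, U j x -> s x i = (g i j x * s x j)%g) ->
  (forall i, U i x -> spinc_cover (s' x i) = phi i x /\
     forall j, U j x -> s' x i = (g i j x * s' x j)%g) ->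
  exists u, forall i, U i x -> s' x i = (s x i * spinc_scalar n u)%g.
Proof.
move=> h h'; have [i Ui] := cech_cover D x.
have [c1 e1] := h i Ui; have [c2 e2] := h' i Ui.
have [|u hu] := @spinc_cover_eq R n (s x i) (s' x i); first by rewrite c1 c2.
exists u => j Uj; rewrite ((h' j Uj).2 i Ui) ((h j Uj).2 i Ui) hu.
exact: mulgA.
Qed.

(** In a single chart j the map phi_j lifts locally to Spin(n); the transition functions carry this
    lift to the other charts. *)
Lemma cech_local_section x0 : exists2 e, 0 < e & exists s, cech_section (ball x0 e) s.
Proof.
have [j Uj] := cech_cover D x0.
have [V [p [oV Vx VU pc pcv]]] := spin_local_lift n_odd (@cech_open _ _ _ D j) Uj
  (fun x a b Ux => @cech_phi_cont _ _ _ D j x a b Ux).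
have /nbhs_ballP[e e0 he] := open_nbhs_nbhs (conj oV Vx).
exists e => //; exists (fun x i => g i j x * spinc_mk (p x, 1%g))%g => x /he Vx' i Ui.
have Ujx := VU _ Vx'; split.
- rewrite spinc_coverM cech_g_cover // spinc_coverE /= pc //; exact: mulgVK.
- by move=> k Uk; rewrite mulgA (cech_cocycle D).
- apply: spinc_cvgM_within; first by apply: spinc_within_nbhs; exact: cech_g_cvg.
  by apply: spinc_cvg_spin_within; exact: pcv.
Qed.

Lemma cech_global_section : exists s, cech_section setT s.
Proof.
apply: (@global_section R n _ cech_section).
- move=> K s s' h e x Kx i Ui; have [h1 h2 h3] := h x Kx i Ui; rewrite -e //; split=> //.
  by apply: spinc_within_near h3; apply: filterE => y Ky; rewrite e.
- move=> K K' s h sub x Kx i Ui; have [h1 h2 h3] := h x (sub _ Kx) i Ui; split=> //.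
  exact: spinc_within_sub h3.
- exact: cech_local_section.
- move=> K1 K2 s1 s2 r h1 h2 cr hr.
  (* The ratio of the two sections is a circle factor independent of the chart, because scalars are
     central and both sections obey the same cocycle. *)
  have /boolp.choice[u hu] : forall x, exists u, K1 x -> K2 x ->
      forall i, U i x -> s1 x i = (s2 x i * spinc_scalar n u)%g.
    move=> x; have [k1|?] := pselect (K1 x); last by exists 1%g.
    have [k2|?] := pselect (K2 x); last by exists 1%g.
    have [|i Ui|u hu] := @cech_section_ratio K2 s2 s1 x.
    + by move=> i Ui; have [] := h2 x k2 i Ui.
    + by have [] := h1 x k1 i Ui.
    + by exists u.
  (* [C_retract] asks for equality with [s1 x] at every index, so the junk values off the charts are
     copied from [s1]. *)
  exists (fun x i => if `[< U i x >] then s2 x i * spinc_scalar n (u (r x))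
                     else s1 x i)%g; last first.
    move=> x k1 k2 rx; apply/funext => i; case: asboolP => // Ui; rewrite rx.
    by rewrite (hu x k1 k2 i Ui).
  have cu x : K1 x -> K2 x ->
      (fun y => cre (u y)) @ within (K1 `&` K2) (nbhs x) --> cre (u x) /\
      (fun y => cim (u y)) @ within (K1 `&` K2) (nbhs x) --> cim (u x).
    move=> k1 k2; have [i Ui] := cech_cover D x.
    apply: (@spinc_ratio_within R n _ (K1 `&` K2) x (fun y => s2 y i) (fun y => s1 y i)).
    + by have [_ _] := h2 x k2 i Ui; apply: spinc_within_sub => y [].
    + by have [_ _] := h1 x k1 i Ui; apply: spinc_within_sub => y [].
    + exact: hu.
    + apply: filterS (open_nbhs_nbhs (conj (@cech_open _ _ _ D i) Ui)) => y Uy [y1 y2].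
      exact: hu.
  move=> x k2 i Ui; have [c1 e1 v1] := h2 x k2 i Ui.
  case: asboolP => // _; split.
  + by rewrite spinc_coverM spinc_cover_scalar mulg1.
  + by move=> j Uj; case: asboolP => // _; rewrite (e1 j Uj) mulgA.
  + apply: (@spinc_within_near _ _ _ _ _ (fun y => s2 y i * spinc_scalar n (u (r y)))%g).
      apply: filterS (open_nbhs_nbhs (conj (@cech_open _ _ _ D i) Ui)) => y Uy _.
      by case: asboolP.
    apply: spinc_cvgM_within => //.
    have [d1 d2] := cu _ (hr x k2).1 (hr x k2).2.
    by apply: (@spinc_cvg_scalar_within R n _ K2 x (fun y => u (r y)));
      [exact: (@cvg_within_retract _ _ K2 (K1 `&` K2) x (fun y => cre (u y)) _ r (cr x) hr d1)
      |exact: (@cvg_within_retract _ _ K2 (K1 `&` K2) x (fun y => cim (u y)) _ r (cr x) hr d2)].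
- move=> K1 K2 s c1 c2 h1 h2 x Kx i Ui; split.
  + by case: Kx => [k|k]; [have [] := h1 x k i Ui|have [] := h2 x k i Ui].
  + by case: Kx => [k|k]; [have [] := h1 x k i Ui|have [] := h2 x k i Ui].
  + by apply: spinc_withinU => // k; [have [] := h1 x k i Ui|have [] := h2 x k i Ui].
- move=> s h x _ i Ui; have [e e0 he] := h x.
  have [q1 q2 q3] := he x (ballxx x e0) i Ui; split=> //.
  apply: spinc_within_nbhs; apply: spinc_within_open q3; exact: nbhsx_ballx.
Qed.

End CechSection.

(** * The extension by real functions *)

Section PolarKernel.
Variable R : realType.

Lemma polar0 : polar (0 : R) = 1%g.
Proof. by apply: circle_eq; rewrite ?cre_polar ?cim_polar ?cos0 ?sin0. Qed.

Lemma polar_2pi (k : int) : polar (k%:~R * (pi *+ 2) : R) = 1%g.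
Proof.
have p1 : polar (pi *+ 2 : R) = 1%g.
  by apply: circle_eq; rewrite ?cre_polar ?cim_polar ?cos2pi ?sin2pi.
have pn (m : nat) : polar (m%:R * (pi *+ 2) : R) = 1%g.
  elim: m => [|m IH]; first by rewrite mul0r polar0.
  by rewrite -natr1 mulrDl mul1r polarD IH p1 mulg1.
case: k => m; first exact: pn.
rewrite NegzE mulrNz mulNr; apply: (mulgI (polar (m.+1%:R * (pi *+ 2)))).
by rewrite -polarD subrr polar0 pn mulg1.
Qed.

(** The remainder r of t modulo 2 pi has sin (r / 2) = 0 by the half-angle formula, with r / 2 in
    [0, pi), where the sine vanishes only at 0. *)
Lemma polar_eq1 (t : R) : polar t = 1%g -> exists k : int, t = k%:~R * (pi *+ 2).
Proof.
move=> h; pose k := Num.floor (t / (pi *+ 2)); exists k.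
have p0 : 0 < pi :> R := pi_gt0 R.
have pp : 0 < pi *+ 2 :> R by rewrite mulrn_wgt0.
have /andP[k1 k2] := floor_itv (t / (pi *+ 2)).
rewrite -/k ler_pdivlMr // in k1; rewrite -/k ltr_pdivrMr // intrD mulrDl mul1r in k2.
set r := t - k%:~R * (pi *+ 2).
suff : r / 2 = 0 by rewrite /r; lra.
have pr : polar r = 1%g.
  have e : polar (r + k%:~R * (pi *+ 2)) = 1%g by rewrite subrK.
  by move: e; rewrite polarD polar_2pi mulg1.
have c1 : cos (r / 2) ^+ 2 - sin (r / 2) ^+ 2 = 1.
  by rewrite !expr2 -cosD -splitr -cre_polar pr.
have c2 := cos2Dsin2 (r / 2).
have s0 : sin (r / 2) = 0.
  by apply/eqP; rewrite -sqrf_eq0; apply/eqP; lra.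
apply/eqP; rewrite eq_le; apply/andP; split; last by rewrite /r; lra.
rewrite leNgt; apply/negP => r0.
suff : 0 < sin (r / 2) by rewrite s0 ltxx.
apply: sin_gt0_pi; rewrite r0 /=; move: k2; rewrite mulr2n /r; lra.
Qed.

Lemma polar_cst (n : nat) (D : 'cV[R]_n -> R) : continuous D ->
  (forall x, polar (D x) = 1%g) -> forall x, D x = D 0.
Proof.
move=> cD hD x; pose f (t : R) := D (t *: x).
have cf : continuous f.
  move=> t; apply: (@continuous_comp _ _ _ (fun t : R => t *: x) D); last exact: cD.
  apply: (@col_cvg R n _ (nbhs t)) => i; rewrite mxE; under eq_fun do rewrite mxE.
  by apply: cvgM; [exact: cvg_id|exact: cvg_cst].
have f0 : f 0 = D 0 by rewrite /f scale0r.
have f1 : f 1 = D x by rewrite /f scale1r.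
have p0 : 0 < pi :> R := pi_gt0 R.
have ex y := polar_eq1 (hD y).
have [k0 e0] := ex 0; have [k1 e1] := ex x.
have [//|ne] := eqVneq (D x) (D 0).
(* A value strictly between two consecutive multiples of 2 pi. *)
pose v := Num.min (f 0) (f 1) + pi.
have kne : k0 != k1 by apply: contra ne => /eqP e; rewrite e0 e1 e.
have [|c _ ec] := @IVT R f 0 1 v ler01 (continuous_subspaceT cf).
  rewrite /v f0 f1 e0 e1 lerDl ltW //=.
  have [lt|lt|/eqP] := ltgtP k0 k1; last by rewrite (negbTE kne).
    have h : (k0%:~R + 1 <= k1%:~R :> R) by rewrite -intrD1 ler_int addrC lez1D.
    rewrite mulr2n minElt maxElt; case: ltP; nra.
  have h : (k1%:~R + 1 <= k0%:~R :> R) by rewrite -intrD1 ler_int addrC lez1D.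
  rewrite mulr2n minElt maxElt; case: ltP; nra.
have [k ek] := ex (c *: x); rewrite -/(f c) ec /v f0 f1 in ek.
exfalso.
have : exists l : int, l%:~R * (pi *+ 2) + pi = k%:~R * (pi *+ 2) :> R.
  move: ek; rewrite minElt; case: ifP => _ <-; [exists k0|exists k1]; by rewrite -?e0 -?e1.
move=> [l el].
have : (2 * (k - l) = 1 :> int)%R.
  apply/eqP; rewrite -(eqr_int R) intrM intrB; apply/eqP.
  have : ((k%:~R - l%:~R) * 2 - 1) * pi = 0 :> R by rewrite mulr2n in el; lra.
  move=> /eqP; rewrite mulf_eq0 (gt_eqF p0) orbF => /eqP; lra.
lia.
Qed.
End PolarKernel.

Section ExtensionGroup.
Variables (R : realType) (n : nat).

Definition ext : Type := (motion R n * Spin R n * ('cV[R]_n -> R))%type.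
HB.instance Definition _ := Choice.copy ext (motion R n * Spin R n * ('cV[R]_n -> R))%type.

(* F is the cocycle by which (gamma, g) moves a fixed trivialization, hence the
   twist in the third component of the product. *)
Definition ext_one : ext := (1%g, 1%g, fun=> 0).
Definition ext_mul (x y : ext) : ext :=
  ((x.1.1 * y.1.1)%g, (x.1.2 * y.1.2)%g, fun v => x.2 (motion_act y.1.1 v) + y.2 v).
Definition ext_inv (x : ext) : ext :=
  (x.1.1^-1%g, x.1.2^-1%g, fun v => - x.2 (motion_act x.1.1^-1%g v)).

Lemma ext_mulA : associative ext_mul.
Proof.
move=> x y z; rewrite /ext_mul /= !mulgA; congr (_, _, _).
by apply/funext => v; rewrite motion_actM addrA.
Qed.
Lemma ext_mul1 : left_id ext_one ext_mul.
Proof.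
by move=> [[s g] F]; rewrite /ext_mul /= !mul1g; congr (_, _, _); apply/funext => v; rewrite add0r.
Qed.
Lemma ext_mulr1 : right_id ext_one ext_mul.
Proof.
move=> [[s g] F]; rewrite /ext_mul /= !mulg1; congr (_, _, _).
by apply/funext => v; rewrite motion_act1 addr0.
Qed.
Lemma ext_mulV : left_inverse ext_one ext_inv ext_mul.
Proof.
move=> [[s g] F]; rewrite /ext_mul /= !mulVg; congr (_, _, _).
by apply/funext => v; rewrite -motion_actM mulVg motion_act1 addNr.
Qed.
Lemma ext_mulrV : right_inverse ext_one ext_inv ext_mul.
Proof.
move=> [[s g] F]; rewrite /ext_mul /= !mulgV; congr (_, _, _).
by apply/funext => v; rewrite subrr.
Qed.

HB.instance Definition _ := isGroup.Build ext ext_mulA ext_mul1 ext_mulr1 ext_mulV ext_mulrV.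
End ExtensionGroup.

(** * Lifting the deck transformations *)

Section LiftedGroup.
Variables (R : realType) (n : nat) (Gamma : subgroup (motion R n)) (D : cech_data Gamma).
Local Notation U := (cech_U D).
Variable s : 'cV[R]_n -> nat -> SpinC R n.
Hypothesis sP : cech_section D setT s.

Definition spin_spinc (g : Spin R n) : SpinC R n := spinc_mk (g, 1%g).

Lemma spin_spincM g h : spin_spinc (g * h)%g = (spin_spinc g * spin_spinc h)%g.
Proof. by rewrite /spin_spinc spinc_mkMg; congr spinc_mk; congr (_, _); rewrite mulg1. Qed.

Definition lifts (x : ext R n) : Prop := [/\ subgroup_set Gamma x.1.1, continuous x.2 &
  forall v i, U i v -> (s (motion_act x.1.1 v) i * spin_spinc x.1.2 =
    s v i * spinc_scalar n (polar (x.2 v)))%g].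

Lemma motion_act_continuous (a : motion R n) : continuous (motion_act a).
Proof.
apply: col_continuous => i.
have e : (fun v => motion_act a v i 0) = (fun v => \sum_j so_mx a.1 i j * v j 0 + a.2 i 0).
  by apply/funext => v; rewrite !mxE.
rewrite e => v; apply: (@cvgD _ _ _ (nbhs v)); last exact: cvg_cst.
apply: (@real_cvg_sum R _ (nbhs v)) => j; apply: (@cvgM _ _ (nbhs v)); first exact: cvg_cst.
exact: coord_continuous.
Qed.

Lemma lifts_mul x y : lifts x -> lifts y -> lifts (x * y)%g.
Proof.
move=> [Gx cx hx] [Gy cy hy]; have [_ GM _] := subgroupP Gamma; split.
- exact: GM.
- move=> v; apply: (@cvgD _ _ _ (nbhs v)); last exact: cy.
  apply: (@continuous_comp _ _ _ (motion_act y.1.1) x.2); last exact: cx.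
  exact: motion_act_continuous.
- move=> v i Uv; rewrite -[(x * y)%g.1.1]/(x.1.1 * y.1.1)%g -[(x * y)%g.1.2]/(x.1.2 * y.1.2)%g.
  rewrite motion_actM spin_spincM -[(x * y)%g.2 v]/(x.2 (motion_act y.1.1 v) + y.2 v).
  rewrite addrC polarD spinc_scalarM mulgA hx; last exact: cech_U_act.
  by rewrite -mulgA (spinc_scalarC _ (spin_spinc y.1.2)) mulgA hy // mulgA.
Qed.

(** Pulling [s] back by the motion and multiplying by g gives local expressions with the same
    transition functions and the same images in SO(n); their ratio to [s] is a continuous
    circle-valued function, and [F] is a logarithm of it. *)
Lemma lifts_exists (a : motion R n) (g : Spin R n) : subgroup_set Gamma a ->
  spin_cover g = a.1 -> exists F, lifts (a, g, F).
Proof.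
move=> Ga cg.
have sec v i : U i v -> spinc_cover (s v i) = cech_phi D i v /\
     forall j, U j v -> s v i = (cech_g D i j v * s v j)%g.
  by move=> Uv; have [] := sP I Uv.
have sec' v i : U i v -> spinc_cover (s (motion_act a v) i * spin_spinc g)%g = cech_phi D i v /\
     forall j, U j v -> (s (motion_act a v) i * spin_spinc g =
       cech_g D i j v * (s (motion_act a v) j * spin_spinc g))%g.
  move=> Uv; have Uav := cech_U_act Ga Uv; have [c e] := sec _ _ Uav; split.
    by rewrite spinc_coverM c cech_phi_act // spinc_coverE cg mulgVK.
  by move=> j Uj; rewrite (e j (cech_U_act Ga Uj)) cech_g_act // mulgA.
have /boolp.choice[u hu] := fun v => @cech_section_ratio R n Gamma D setT s
  (fun v i => s (motion_act a v) i * spin_spinc g)%g v (sec v) (sec' v).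
have cu v : (fun y => cre (u y)) @ v --> cre (u v) /\ (fun y => cim (u y)) @ v --> cim (u v).
  have [i Ui] := cech_cover D v.
  have [_ _ c1] := sP I Ui; have [_ _ c2] := sP I (cech_U_act Ga Ui).
  have {}c1 := spinc_within_open (@filterT _ _ (nbhs_filter v)) c1.
  have {}c2 := spinc_within_open (@filterT _ _ (nbhs_filter (motion_act a v))) c2.
  apply: (@spinc_cvg_ratio R n _ (nbhs v) _ (fun y => s y i)
     (fun y => s (motion_act a y) i * spin_spinc g)%g _ _ u (u v) c1 _ (hu v i Ui)).
    apply: spinc_cvgM; last exact: spinc_cvg_cst.
    have ca := @motion_act_continuous a v.
    by split=> S; [exact: (cvg_comp _ _ ca (c2.1 S))|exact: (cvg_comp _ _ ca (c2.2 S))].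
  by apply: filterS (open_nbhs_nbhs (conj (@cech_open _ _ _ D i) Ui)) => y Uy; exact: hu.
have [F cF hF] := circle_log (fun v => (cu v).1) (fun v => (cu v).2).
by exists F; split=> // v i Uv; rewrite hF; exact: hu.
Qed.

(** Projecting the defining equation to SO(n) removes the circle factor and leaves phi A^-1 times
    the image of g equal to phi, where A is the linear part. *)
Lemma lifts_cover x : lifts x -> spin_cover x.1.2 = x.1.1.1.
Proof.
move=> [Gx _ hx]; have [i Ui] := cech_cover D 0.
have := congr1 (@spinc_cover R n) (hx 0 i Ui).
rewrite !spinc_coverM spinc_cover_scalar mulg1 spinc_coverE.
have [c1 _ _] := sP I Ui; have [c2 _ _] := sP I (cech_U_act Gx Ui).
rewrite c1 c2 cech_phi_act // => h.
by apply: (mulgI (x.1.1.1)^-1%g); apply: (mulgI (cech_phi D i 0)); rewrite mulgA h mulVg mulg1.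
Qed.

Variable minus1 : Spin R n.
Hypothesis minus1E : spin_val minus1 = -1.

Definition spin_sign (b : bool) : Spin R n := if b then minus1 else 1%g.

Lemma minus1_sqr : (minus1 * minus1 = 1)%g.
Proof.
by apply: rg_val_inj; rewrite -[LHS]/(spin_val minus1 * spin_val minus1) minus1E mulrNN mulr1.
Qed.

Lemma spin_signD b c : spin_sign (b (+) c) = (spin_sign b * spin_sign c)%g.
Proof. by case: b; case: c; rewrite /= ?mulg1 ?mul1g // minus1_sqr. Qed.

Lemma spin_signC b g : (spin_sign b * g = g * spin_sign b)%g.
Proof.
case: b; rewrite /= ?mulg1 ?mul1g //; apply: rg_val_inj.
rewrite -[LHS]/(spin_val minus1 * spin_val g) -[RHS]/(spin_val g * spin_val minus1).
by rewrite minus1E mulN1r mulrN1.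
Qed.

(* Both components are needed: [-1, 1] and [1, exp(i pi)] are equal in SpinC. *)
Definition zeta (k : int) : ext R n := (1%g, spin_sign (odd `|k|), fun=> k%:~R * pi).

Lemma zetaD k l : zeta (k + l) = (zeta k * zeta l)%g.
Proof.
rewrite -[RHS]/(ext_mul _ _) /ext_mul /zeta /= mulg1 -spin_signD; congr (_, spin_sign _, _).
  lia.
by apply/funext => v; rewrite intrD mulrDl.
Qed.

Lemma zeta_inj : injective zeta.
Proof.
move=> k l /(congr1 (fun x : ext R n => x.2 0)) /= h.
have p0 : 0 < pi :> R := pi_gt0 R.
by apply/eqP; rewrite -(eqr_int R); apply/eqP; apply: (mulIf _ h); rewrite gt_eqF.
Qed.

Lemma zetaC k x : (zeta k * x = x * zeta k)%g.
Proof.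
rewrite -[LHS]/(ext_mul _ _) -[RHS]/(ext_mul _ _) /ext_mul /zeta /= mulg1 mul1g spin_signC.
by congr (_, _, _); apply/funext => v; rewrite motion_act1 addrC.
Qed.

(** The spin components agree up to sign. Equal ones make the difference of the two functions a
    logarithm of 1, opposite ones a logarithm of -1; by connectedness it is a constant k pi, and the
    parity of k matches the sign. *)
Lemma lifts_fiber x y : lifts x -> lifts y -> x.1.1 = y.1.1 -> exists k, x = (y * zeta k)%g.
Proof.
move=> lx ly e; have cx := lifts_cover lx; have cy := lifts_cover ly.
have [_ kx hx] := lx; have [_ ky hy] := ly.
have key (t : R) : (spin_spinc x.1.2 = spin_spinc y.1.2 * spinc_scalar n (polar t))%g ->
    exists k : int, forall v, x.2 v = y.2 v + t + k%:~R * (pi *+ 2).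
  move=> et; pose d v := x.2 v - (y.2 v + t).
  have cd : continuous d.
    move=> v; apply: (@cvgB _ _ _ (nbhs v)); first exact: kx.
    by apply: (@cvgD _ _ _ (nbhs v)); [exact: ky|exact: cvg_cst].
  have d1 v : polar (d v) = 1%g.
    have [i Ui] := cech_cover D v; have := hx v i Ui.
    rewrite et e mulgA hy // -mulgA -spinc_scalarM -polarD => /mulgI /spinc_scalar_inj h.
    by apply: (mulgI (polar (y.2 v + t))); rewrite -polarD mulg1 h /d addrC subrK.
  have [k hk] := polar_eq1 (d1 0); exists k => v.
  by rewrite -hk -(polar_cst cd d1 v) /d addrC subrK.
have mk a k : a = spin_sign (odd `|k|) -> x.1.2 = (y.1.2 * a)%g ->
    (forall v, x.2 v = y.2 v + k%:~R * pi) -> x = (y * zeta k)%g.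
  move=> -> h1 h2; rewrite -[RHS]/(ext_mul _ _) /ext_mul /zeta /= mulg1 -h1 -e.
  case: (x) h2 => [[a' g'] F'] /= h2; congr (_, _, _).
  by apply/funext => v; rewrite motion_act1 h2.
have [h|h] := spin_cover_unique (etrans cx (etrans (congr1 fst e) (esym cy))).
  have xy : x.1.2 = y.1.2 by apply: rg_val_inj.
  have [|k hk] := key 0.
    by rewrite xy polar0 (_ : spinc_scalar n 1%g = 1%g) ?mulg1.
  exists (k + k); apply: (mk 1%g); rewrite ?mulg1 //.
    by rewrite (_ : odd _ = false) //; lia.
  by move=> v; rewrite hk intrD; ring.
have [|k hk] := key pi.
  rewrite /spin_spinc /spinc_scalar spinc_mkMg; apply/spinc_mkP; right; split=> /=.
    by rewrite h opprK -[LHS]/(spin_val y.1.2 * 1) mulr1.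
  rewrite -[LHS]/(1 * rg_val (polar pi)) mul1r -[rg_val 1%g]/(1 : R[i]).
  by apply/eqP; rewrite eq_complex /= cospi sinpi oppr0 !eqxx.
exists (k + k + 1); apply: (mk minus1).
- by rewrite (_ : odd _ = true) //; lia.
- apply: rg_val_inj; rewrite -[LHS]/(spin_val x.1.2) h -[RHS]/(spin_val y.1.2 * spin_val minus1).
  by rewrite minus1E mulrN1.
- by move=> v; rewrite hk !intrD; ring.
Qed.

End LiftedGroup.

(** * Cyclic Hantzsche-Wendt groups *)

Section DiagonalMotions.
Variables (R : realType) (n : nat).
Implicit Types (m : motion R n) (d v : 'I_n -> R).

Definition diagonal_motion m d v :=
  (forall w k, (so_mx m.1 *m w : 'cV_n) k 0 = d k * w k 0) /\ forall k, m.2 k 0 = v k.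

Lemma diagonal_motionM m m' d d' v v' : diagonal_motion m d v -> diagonal_motion m' d' v' ->
  diagonal_motion (m * m')%g (fun k => d k * d' k) (fun k => v k + d k * v' k).
Proof.
move=> [h1 h2] [h1' h2']; rewrite -[(m * m')%g]/(motion_mul m m') /motion_mul; split=> [w k|k] /=.
  by rewrite so_mxM -mulmxA h1 h1' mulrA.
by rewrite mxE h1 h2 h2'.
Qed.

Lemma diagonal_motion_eq m m' d d' v v' : diagonal_motion m d v -> diagonal_motion m' d' v' ->
  (forall k, d k = d' k /\ v k = v' k) -> m = m'.
Proof.
case: m m' => [A a] [A' a'] [/= h1 h2] [/= h1' h2'] e; congr (_, _).
  apply: rg_val_inj; apply/matrixP => i j.
  have := h1 (delta_mx j 0) i; rewrite -colE mxE (e i).1 => ->.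
  by have := h1' (delta_mx j 0) i; rewrite -colE mxE => ->.
by apply/colP => k; rewrite h2 h2' (e k).2.
Qed.

End DiagonalMotions.

Section CyclicHW.
Variables (R : realType) (n : nat) (beta : 'I_n -> motion R n).
Hypothesis beta1 : forall i, so_mx (beta i).1 = hw_rotation R i.
Hypothesis beta2 : forall i, (beta i).2 = hw_translation R i.

Lemma beta_diagonal i : diagonal_motion (beta i) (fun k => if k == i then 1 else -1)
  (fun k => if (k == i) || (k == ordS i) then 2^-1 else 0).
Proof.
by split=> [w k|k]; [rewrite beta1 hw_rotationE|rewrite beta2 mxE].
Qed.

Lemma hw_odd (i0 : 'I_n) : odd n.
Proof.
have n0 : (0 < n)%N := leq_ltn_trans (leq0n i0) (ltn_ord i0).
have [_] := rg_valP (beta i0).1.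
rewrite -[rg_val _]/(so_mx _) beta1 det_diag.
under eq_bigr do rewrite mxE.
rewrite (bigD1 i0) //= eqxx mul1r.
under eq_bigr => i /negbTE -> do [].
rewrite prodr_const cardC1 card_ord -signr_odd => h.
move: h; rewrite -[in odd n](prednK n0) /=; case: (odd _) => //= /eqP.
by rewrite eq_sym -addr_eq0 (_ : 1 + 1 = 2%:R) // pnatr_eq0.
Qed.

Hypothesis n5 : (5 <= n)%N.

(** With the first five indices, the cyclic successor does not wrap around in the commutation
    relations below even for n = 5: the generator of index 4 occurs there only squared. *)
Definition hw_index (i : nat) : 'I_n := widen_ord n5 (inord i).

Lemma hw_indexE i j : (i < 5)%N -> (j < 5)%N -> (hw_index i == hw_index j) = (i == j).
Proof. by move=> hi hj; rewrite -val_eqE /= !inordK. Qed.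

Lemma hw_indexS i : (i < 4)%N -> ordS (hw_index i) = hw_index i.+1.
Proof.
move=> hi; apply: val_inj; rewrite /= !inordK //; last exact: ltnW.
by rewrite modn_small //; lia.
Qed.

Local Notation b i := (beta (hw_index i)).

Lemma beta_sqr_diagonal i : diagonal_motion (beta i * beta i)%g (fun=> 1)
  (fun k => (k == i)%:R).
Proof.
have [h1 h2] := diagonal_motionM (beta_diagonal i) (beta_diagonal i); split=> [w k|k].
  by rewrite h1; case: ifP => _; rewrite ?mulr1 ?mulrNN ?mulr1.
rewrite h2; case: eqP => _ /=; last case: ifP => _; rewrite ?mulr1n; lra.
Qed.

Lemma beta_conj i j : i != j ->
  (beta j * beta j * beta i * (beta j * beta j))%g = beta i.
Proof.
move=> ij; have T := beta_sqr_diagonal j; have Bi := beta_diagonal i.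
apply: diagonal_motion_eq (diagonal_motionM (diagonal_motionM T Bi) T) Bi _ => k.
rewrite mulr1 mul1r; split=> //.
by case: (eqVneq k j) => [->|_]; rewrite ?mulr1n ?mulr0n; [rewrite eq_sym (negbTE ij)|]; lra.
Qed.

(** The translations of b_i b_{i+1} and b_{i+1} b_i differ by e_i - e_{i+1} - e_{i+2}, and B_i
    B_{i+1} reverses exactly the directions i and i + 1; this dictates the squares on each side. *)
Lemma beta_adjacent i : (i < 3)%N ->
  (b i * b i.+1 * (b i * b i * (b i.+2 * b i.+2)))%g =
  (b i.+1 * b i * (b i.+1 * b i.+1))%g.
Proof.
move=> hi; have B j := beta_diagonal (hw_index j); have T j := beta_sqr_diagonal (hw_index j).
apply: diagonal_motion_eq
  (diagonal_motionM (diagonal_motionM (B i) (B i.+1)) (diagonal_motionM (T i) (T i.+2)))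
  (diagonal_motionM (diagonal_motionM (B i.+1) (B i)) (T i.+1)) _ => k.
rewrite !hw_indexS; try lia.
split; first by rewrite !mulr1 mulrC.
have e01 : (hw_index i == hw_index i.+1) = false by rewrite hw_indexE; lia.
have e02 : (hw_index i == hw_index i.+2) = false by rewrite hw_indexE; lia.
have e12 : (hw_index i.+1 == hw_index i.+2) = false by rewrite hw_indexE; lia.
have [->|_] := eqVneq k (hw_index i); first by rewrite ?e01 ?e02 /= ?mulr1n ?mulr0n; lra.
have [->|_] := eqVneq k (hw_index i.+1); first by rewrite ?e12 /= ?mulr1n ?mulr0n; lra.
by have [_|_] := eqVneq k (hw_index i.+2); rewrite /= ?mulr1n ?mulr0n; lra.
Qed.

Lemma beta_far : (b 0 * b 3 * (b 0 * b 0 * (b 4 * b 4)))%g =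
  (b 3 * b 0 * (b 1 * b 1 * (b 3 * b 3)))%g.
Proof.
have B j := beta_diagonal (hw_index j); have T j := beta_sqr_diagonal (hw_index j).
apply: diagonal_motion_eq
  (diagonal_motionM (diagonal_motionM (B 0%N) (B 3)) (diagonal_motionM (T 0%N) (T 4)))
  (diagonal_motionM (diagonal_motionM (B 3) (B 0%N)) (diagonal_motionM (T 1%N) (T 3)))
  _ => k.
rewrite !hw_indexS //.
split; first by rewrite !mulr1 mulrC.
have e i j : (i < 5)%N -> (j < 5)%N -> i != j -> (hw_index i == hw_index j) = false.
  by move=> hi hj ij; rewrite hw_indexE // (negbTE ij).
have [->|_] := eqVneq k (hw_index 0%N); first by rewrite ?e //= ?mulr1n ?mulr0n; lra.
have [->|_] := eqVneq k (hw_index 1%N); first by rewrite ?e //= ?mulr1n ?mulr0n; lra.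
have [->|_] := eqVneq k (hw_index 3); first by rewrite ?e //= ?mulr1n ?mulr0n; lra.
by have [_|_] := eqVneq k (hw_index 4); rewrite /= ?mulr1n ?mulr0n; lra.
Qed.

End CyclicHW.

(** * The extension attached to a cyclic group and its parity obstruction *)

Theorem theorem2 (R : realType) (n : nat) (Gamma : subgroup (motion R n)) :
  (3 < n)%N ->
  hantzsche_wendt Gamma ->
  cyclic_hw Gamma ->
  ~ has_spinc_structure (@frame_proj R n Gamma) (@frame_act R n Gamma).
Proof.
move=> n3 _ [beta [beta1 beta2 eGamma]] /spinc_structure_cech[D _].
have n_odd : odd n by apply: (hw_odd beta1 (Ordinal (ltnW (ltnW (ltnW n3))))).
have n5 : (5 <= n)%N by rewrite ltn_neqAle n3 andbT; apply: contraTN n_odd => /eqP <-.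
have [s sP] := cech_global_section D n_odd.
have [E [E1 E2]] := hw_lift R n_odd.
have [m1 m1E] := spin_opp n_odd (1%g : Spin R n).
rewrite -[spin_val 1%g]/(1 : clifford R n) in m1E.
have GB i : subgroup_set Gamma (beta i) by rewrite eGamma; apply: sub_gen_smallest; exists i.
have cE i : spin_cover (E i) = (beta i).1 by apply: rg_val_inj; rewrite -[LHS]/(so_mx _) E1 -beta1.
have /boolp.choice[F hF] := fun i => lifts_exists sP (GB i) (cE i).
pose e i := hw_index n5 i.
pose b i : ext R n := (beta (e i), E (e i), F (e i)).
have eE i j : (i < 5)%N -> (j < 5)%N -> i != j -> e i != e j.
  by move=> hi hj ij; rewrite /e hw_indexE.
(* [pi] forgets everything but the motion, so relations of Gamma hold in the extension up to the
   centre; [chi] keeps the spin component, which sees a central defect only through its parity. *)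
refine (@central_extension_absurd (ext R n) (motion R n) (Spin R n)
  (fun x => x.1.1) (fun x => x.1.2)
  (zeta m1) (lifts D s) b _ (zetaD m1E) (@zeta_inj R n m1) (zetaC m1E) _
  (@lifts_mul R n Gamma D s) (lifts_fiber sP m1E) _
  (fun i => (b i * b i)%g) (fun i => erefl) _ _ _ _ _).
- by [].
- move=> k; rewrite /zeta /= /spin_sign; case: ifP => [_ h|ho _].
    have := congr1 (fun g : Spin R n => spin_val g finset.set0) h; rewrite m1E.
    rewrite -[RHS]/((1 : clifford R n) finset.set0) -[LHS]/(- (1 : clifford R n) finset.set0).
    rewrite cl_one_coord eqxx mulr1n => /eqP.
    by rewrite eq_sym -addr_eq0 (_ : 1 + 1 = 2%:R) // pnatr_eq0.
  by exists (k %/ 2)%Z; lia.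
- by move=> i hi; exact: hF.
- move=> i j hi hj ij; apply: rg_val_inj.
  rewrite -[LHS]/(spin_val (E (e i)) * spin_val (E (e j))) E2 ?eE //.
  by rewrite -[RHS]/(spin_val (E (e j)) * spin_val (E (e i)) * spin_val m1) m1E mulrN1.
(* The square of beta_i is a translation, so the square of E_i covers the identity and is the spin
   component of [zeta 0] or of [zeta 1]. *)
- move=> i hi; have [h|h] : spin_val (E (e i) * E (e i))%g = 1 \/
      spin_val (E (e i) * E (e i))%g = -1.
  + apply: spin_kernel; rewrite spin_coverM cE.
    have [h _] := beta_sqr_diagonal beta1 beta2 (e i).
    apply: rg_val_inj; apply/matrixP => k l.
    have := h (delta_mx l 0) k; rewrite -colE mxE mul1r => hkl; rewrite [LHS]hkl.
    by rewrite -[rg_val 1%g]/(1%:M) !mxE andbT.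
  + by exists 0; apply: rg_val_inj.
  + by exists 1; apply: rg_val_inj; rewrite -[RHS]/(spin_val m1) m1E.
- by move=> i j hi hj ij; apply: beta_conj; rewrite // eE.
- by move=> i hi; exact: beta_adjacent.
- exact: beta_far.
Qed.
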